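(* There is an algorithm that, given a finite domain $D$ and a $\beta$-acyclic instance $I$ of $\#\mathrm{CSP}_{\mathrm{def}}$ on domain $D$ (all weights and default values given as non-negative rationals in binary), computes the partition function $w(I)$ in time polynomial in the size of the input.
   Context: For sets $D,X$, $D^X$ is the set of maps $X\to D$ (assignments); for $a\in D^X$ and $Y\subseteq X$, $a|_Y$ is the restriction. A weighted constraint with default value $c$ on a finite (possibly empty) variable set $\mathrm{var}(c)=X$ and domain $D$ is a pair $(f,\delta)$ with $f:S\to\mathbb{Q}_{\ge 0}$, $S\subseteq D^X$ (the support $\mathrm{supp}(c)$), and $\delta\in\mathbb{Q}_{\ge0}$ (the default value); it induces the total function $c:D^X\to\mathbb{Q}_{\ge0}$ with $c(a)=f(a)$ for $a\in S$ and $c(a)=\delta$ otherwise. Its size is $|c|=|S|\cdot|X|$. An instance $I$ of $\#\mathrm{CSP}_{\mathrm{def}}$ is a finite set of such constraints over a common domain $D$; $\mathrm{var}(I)=\bigcup_{c\in I}\mathrm{var}(c)$, $\|I\|=\sum_{c\in I}|c|$, and the partition function is $w(I)=\sum_{a\in D^{\mathrm{var}(I)}}\prod_{c\in I}c(a|_{\mathrm{var}(c)})$. The hypergraph of $I$ is $\mathcal H(I)=(\mathrm{var}(I),\{\mathrm{var}(c)\mid c\in I\})$. For a hypergraph $\mathcal H$ and vertex set $S$, $\mathcal H\setminus S$ is the hypergraph on $V(\mathcal H)\setminus S$ with edges $\{e\setminus S\mid e\in E(\mathcal H)\}\setminus\{\emptyset\}$. A vertex $x$ is a nest point of $\mathcal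 H$ if the edges containing $x$ are totally ordered by inclusion. A $\beta$-elimination order of $\mathcal H$ is a sequence $(x_1,\dots,x_n)$ enumerating $V(\mathcal H)$ such that $x_1$ is a nest point of $\mathcal H$ and $(x_2,\dots,x_n)$ is a $\beta$-elimination order of $\mathcal H\setminus x_1$ (the empty sequence for the empty hypergraph). $\mathcal H$ (and an instance $I$ with $\mathcal H(I)=\mathcal H$) is $\beta$-acyclic if it has a $\beta$-elimination order. *)

(* Defs.v *)
From HB Require Import structures.
From mathcomp Require Import all_boot all_order all_algebra.
Set Implicit Arguments. Unset Strict Implicit. Unset Printing Implicit Defensive.
Import Order.TTheory GRing.Theory Num.Theory.
Local Open Scope ring_scope.

(* The domain D is {0, ..., d-1} (a finite set of size d).
   Variables are natural numbers.
   A constraint is (vars, support, default): [vars] lists var(c) (without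
   repetition); [support] lists pairs (a, f a) where the assignment
   a : var(c) -> D is given as the list of values of the variables of [vars]
   in that order; [default] is delta. *)
Definition constraint : Type := (seq nat * seq (seq nat * rat) * rat)%type.
Definition cvars (c : constraint) : seq nat := c.1.1.
Definition csupp (c : constraint) : seq (seq nat * rat) := c.1.2.
Definition cdef (c : constraint) : rat := c.2.

Definition instance : Type := seq constraint.

Definition wf_constraint (d : nat) (c : constraint) : bool :=
  [&& uniq (cvars c),
      all (fun p : seq nat * rat =>
             [&& size p.1 == size (cvars c),
                 all (fun v => (v < d)%N) p.1 & 0 <= p.2]) (csupp c),
      uniq (map fst (csupp c)) & 0 <= cdef c].

Definition wf_instance (d : nat) (I : instance) : bool :=
  all (wf_constraint d) I.

Definition eval_constraint (c : constraint) (asg : nat -> nat) : rat :=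
  let t := map asg (cvars c) in
  let i := find (fun p : seq nat * rat => p.1 == t) (csupp c) in
  if (i < size (csupp c))%N then (nth ([::], 0) (csupp c) i).2 else cdef c.

Definition ivars (I : instance) : seq nat := undup (flatten (map cvars I)).

(* global assignment D^{var(I)} represented as a finite function on the
   positions of var(I) *)
Definition asg_of (V : seq nat) (d : nat) (a : {ffun 'I_(size V) -> 'I_d})
  (x : nat) : nat :=
  if insub (index x V) is Some i then nat_of_ord (a i) else 0%N.

Definition partition_fn (d : nat) (I : instance) : rat :=
  \sum_(a : {ffun 'I_(size (ivars I)) -> 'I_d})
     \prod_(c <- I) eval_constraint c (asg_of a).

(* A hypergraph is given by its list of edges; its vertex set is the   *)
(* union of its edges (this is the case for H(I), whose vertex set is  *)
(* var(I), and is preserved by vertex deletion).                       *)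

Definition hvertices (E : seq (seq nat)) : seq nat := undup (flatten E).

Definition subedge (e1 e2 : seq nat) : bool := all (fun v => v \in e2) e1.

Definition nest_point (E : seq (seq nat)) (x : nat) : bool :=
  all (fun e1 => all (fun e2 =>
        (x \in e1) ==> (x \in e2) ==> (subedge e1 e2 || subedge e2 e1)) E) E.

Definition del_vertex (x : nat) (E : seq (seq nat)) : seq (seq nat) :=
  filter (fun e => ~~ nilp e) (map (filter (fun v => v != x)) E).

Fixpoint beta_elim_order (E : seq (seq nat)) (s : seq nat) : bool :=
  match s with
  | [::] => nilp (hvertices E)
  | x :: s' => [&& x \in hvertices E, nest_point E x &
                   beta_elim_order (del_vertex x E) s']
  end.

Definition beta_acyclic (E : seq (seq nat)) : Prop :=
  exists s, beta_elim_order E s.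

Definition hypergraph_of (I : instance) : seq (seq nat) := map cvars I.

Fixpoint nbits (fuel n : nat) : seq bool :=
  match fuel with
  | 0 => [::]
  | f.+1 => if n == 0%N then [::] else odd n :: nbits f n./2
  end.
Definition bin (n : nat) : seq bool := nbits n n.   (* LSB first *)

(* self-delimiting binary code of a natural number *)
Definition enc_nat (n : nat) : seq bool :=
  flatten (map (fun b => [:: true; b]) (bin n)) ++ [:: false].

Definition enc_list (T : Type) (f : T -> seq bool) (s : seq T) : seq bool :=
  enc_nat (size s) ++ flatten (map f s).

(* non-negative rational in binary: numerator, denominator *)
Definition enc_rat (q : rat) : seq bool :=
  enc_nat `|numq q|%N ++ enc_nat `|denq q|%N.

Definition enc_constraint (c : constraint) : seq bool :=
  enc_list enc_nat (cvars c)
  ++ enc_list (fun p : seq nat * rat => enc_list enc_nat p.1 ++ enc_rat p.2)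
              (csupp c)
  ++ enc_rat (cdef c).

(* the input: the domain D (listing its elements) and the instance I *)
Definition enc_input (d : nat) (I : instance) : seq bool :=
  enc_list enc_nat (iota 0 d) ++ enc_list enc_constraint I.

(* Machine model: RAM with logarithmic cost (polynomially equivalent   *)
(* to Turing machines).  Registers R[0], R[1], ... hold naturals.      *)

Inductive instr : Type :=
| Iconst (r n : nat)
| Iadd (r a b : nat)
| Isub (r a b : nat)          (* R[r] := R[a] - R[b]  (truncated) *)
| Imul (r a b : nat)
| Idiv (r a b : nat)          (* R[r] := R[a] / R[b]  (0 if R[b] = 0) *)
| Iload (r a : nat)
| Istore (a b : nat)
| Ijz (r l : nat)
| Ihalt.

Definition program := seq instr.
Definition memory := nat -> nat.

Definition blen (n : nat) : nat := (trunc_log 2 n).+1.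

Definition upd (m : memory) (r v : nat) : memory :=
  fun i => if i == r then v else m i.

Definition step (p : program) (pc : nat) (m : memory)
  : option (nat * memory * nat) :=
  match nth Ihalt p pc with
  | Ihalt => None
  | Iconst r n => Some (pc.+1, upd m r n, (1 + blen r + blen n)%N)
  | Iadd r a b => Some (pc.+1, upd m r (m a + m b)%N,
                        (1 + blen r + blen a + blen b + blen (m a) + blen (m b))%N)
  | Isub r a b => Some (pc.+1, upd m r (m a - m b)%N,
                        (1 + blen r + blen a + blen b + blen (m a) + blen (m b))%N)
  | Imul r a b => Some (pc.+1, upd m r (m a * m b)%N,
                        (1 + blen r + blen a + blen b + blen (m a) + blen (m b))%N)
  | Idiv r a b => Some (pc.+1, upd m r (m a %/ m b)%N,
                        (1 + blen r + blen a + blen b + blen (m a) + blen (m b))%N)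
  | Iload r a => Some (pc.+1, upd m r (m (m a)),
                       (1 + blen r + blen a + blen (m a) + blen (m (m a)))%N)
  | Istore a b => Some (pc.+1, upd m (m a) (m b),
                        (1 + blen a + blen b + blen (m a) + blen (m b))%N)
  | Ijz r l => Some (if m r == 0%N then l else pc.+1, m,
                     (1 + blen r + blen l + blen (m r))%N)
  end.

Fixpoint run (p : program) (fuel : nat) (pc : nat) (m : memory)
  : option (memory * nat) :=
  match step p pc m with
  | None => Some (m, 0%N)
  | Some (pc', m', c) =>
      match fuel with
      | 0 => None
      | f.+1 => omap (fun r => (r.1, (c + r.2)%N)) (run p f pc' m')
      end
  end.

(* input bit string x: R[0] = |x|, R[i+1] = i-th bit of x, others 0 *)
Definition init_mem (x : seq bool) : memory :=
  fun i => if i == 0%N then size x else nth 0%N (map nat_of_bool x) i.-1.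

(* Main.v *)
Require Import Defs.
From HB Require Import structures.
From mathcomp Require Import all_boot all_order all_algebra.
From mathcomp Require Import zify.
Set Implicit Arguments. Unset Strict Implicit. Unset Printing Implicit Defensive.
Import Order.TTheory GRing.Theory Num.Theory.

(* The variables are eliminated along a beta-elimination order. The constraints
   containing a nest point x form a chain c_1, ..., c_k by inclusion of their
   variable sets; with P_i(a) the sum over the value of x of c_1 ... c_i, each c_i
   is replaced by c_i' = P_i / P_(i-1), so that c_1' ... c_k' = P_k up to the
   factor |D| = P_0. An assignment that extends to no element of supp(c_i) gets
   the default value of c_i, so neither supports nor defaults grow.

   The weights stay small for the following reason. Sort the constraints
   lexicographically by their variables, the last eliminated variable being the
   most significant: this is one linear order that refines all the chains. Then
   after t eliminations the product of the first i constraints is, up to |D|^t,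
   the partition function of the first i original constraints with the t
   variables summed out, and every weight is a quotient of two such numbers.
   To have nonzero denominators, weights are first scaled to integers N and
   replaced by N * B + 1 for a large B; the true value is recovered by rounding
   down a division by a power of B.

   Polynomial time is established by a class FP of functions on heap-allocated
   data, closed under composition, pairing, conditionals and folds with
   polynomially bounded accumulators, whose members are compiled to the RAM. *)

(** Membership in the class FP concerns every input, but the weights are known to stay small only
    for well-formed beta-acyclic instances. Every new weight is therefore clamped at a bound [M]
    computed beforehand, which does not affect the result on such instances. Moreover a bound on the
    value of a quotient says nothing about a stored fraction: it must be in lowest terms, since a
    reduced numerator and denominator divide those of any other representation, in particular two
    partial partition functions.

    The perturbation is harmless because, with m constraints, the product of the N_c * B + 1 has
    leading term B^m times the product of the N_c, and the remaining terms, summed over all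
    assignments, stay below B^m as soon as B exceeds the sum of the products of the N_c + 1.

    The elimination order is not part of the input. It is found greedily, and this never gets stuck:
    a nest point remains one when other vertices are deleted. *)

(** * Bit lengths *)

Lemma blen_gt0 n : 0 < blen n. Proof. by []. Qed.

Lemma blen_le m n : m <= n -> blen m <= blen n.
Proof. by move=> le_mn; rewrite /blen ltnS leq_trunc_log. Qed.

Lemma ltn_blen n : n < 2 ^ blen n.
Proof. by rewrite /blen trunc_log_ltn. Qed.

Lemma blen_ltn n b : n < 2 ^ b -> blen n <= maxn b 1.
Proof.
case: n => [|n] lt; first by rewrite /blen trunc_log0; lia.
rewrite /blen; case: b lt => [|b] lt; first by rewrite expn0 in lt.
have : trunc_log 2 n.+1 < b.+1.
  by rewrite -(ltn_exp2l _ _ (isT : 1 < 2)); apply: leq_ltn_trans lt; apply: trunc_logP.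
lia.
Qed.

Lemma blen_leS n : blen n <= n.+1.
Proof. by rewrite ltnS; have := @trunc_logP 2 n isT; have := ltn_expl (trunc_log 2 n) (isT : 1 < 2); case: n => [|n]; [rewrite trunc_log0|lia]. Qed.

(** Coarser than the maximum plus one, but of the same form as for products: [fp_op] asks for this
    form from every arithmetic operation. *)
Lemma blenD m n : blen (m + n) <= blen m + blen n.
Proof.
have le k l : m < 2 ^ k.+1 -> n < 2 ^ l.+1 -> m + n < 2 ^ (k.+1 + l.+1).
  rewrite addSn addnS !expnS expnD => lm ln.
  have := expn_gt0 2 k; have := expn_gt0 2 l; nia.
have := blen_ltn (le _ _ (ltn_blen m) (ltn_blen n)).
by have := blen_gt0 m; rewrite /blen; lia.
Qed.

Lemma blenM m n : blen (m * n) <= blen m + blen n.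
Proof.
have lt : m * n < 2 ^ (blen m + blen n).
  by rewrite expnD; have := ltn_blen m; have := ltn_blen n; nia.
by have := blen_ltn lt; have := blen_gt0 m; lia.
Qed.

Lemma blen1 : blen 1 = 1. Proof. by []. Qed.
Lemma blen0 : blen 0 = 1. Proof. by []. Qed.

(** * A structured language compiled to the RAM *)

(* Register 1 is the scratch register of unconditional jumps: the code of a
   conditional or a loop sets it to 0 and then uses [Ijz 1]. *)
Inductive cmd : Type :=
| Cbas of instr
| Cseq of cmd & cmd
| Cif of nat & cmd & cmd
| Cwhile of nat & cmd.

Definition basic (i : instr) : bool :=
  match i with Ijz _ _ | Ihalt => false | _ => true end.

(** The effect of a basic instruction does not depend on its position, so it can be read off the
    one-instruction program. *)
Definition eff (i : instr) (m : memory) : memory * nat :=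
  if step [:: i] 0 m is Some (_, m', t) then (m', t) else (m, 0).

(** Jump labels and the unconditional jumps are not charged here, so the cost does not depend on
    where the code is placed; [exec_compile] accounts for them. *)
Inductive exec : cmd -> memory -> memory -> nat -> Prop :=
| Ebas i m : basic i -> exec (Cbas i) m (eff i m).1 (eff i m).2
| Eseq c1 c2 m m1 m2 t1 t2 : exec c1 m m1 t1 -> exec c2 m1 m2 t2 ->
    exec (Cseq c1 c2) m m2 (t1 + t2)
| Eif1 r c1 c2 m m' t : m r != 0 -> exec c1 m m' t ->
    exec (Cif r c1 c2) m (upd m' 1 0) (1 + blen r + blen (m r) + t)
| Eif0 r c1 c2 m m' t : m r = 0 -> exec c2 m m' t ->
    exec (Cif r c1 c2) m m' (1 + blen r + blen (m r) + t)
| Ewhile0 r c m : m r = 0 ->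
    exec (Cwhile r c) m m (1 + blen r + blen (m r))
| Ewhile1 r c m m1 m2 t1 t2 : m r != 0 -> exec c m m1 t1 ->
    exec (Cwhile r c) (upd m1 1 0) m2 t2 ->
    exec (Cwhile r c) m m2 (1 + blen r + blen (m r) + t1 + t2).

Fixpoint compile (pc : nat) (c : cmd) : program :=
  match c with
  | Cbas i => [:: i]
  | Cseq c1 c2 => compile pc c1 ++ compile (pc + size (compile pc c1)) c2
  | Cif r c1 c2 =>
      let s1 := compile pc.+1 c1 in
      let s2 := compile (pc + size s1 + 3) c2 in
      Ijz r (pc + size s1 + 3) ::
        s1 ++ [:: Iconst 1 0; Ijz 1 (pc + size s1 + 3 + size s2)] ++ s2
  | Cwhile r c =>
      let s := compile pc.+1 c in
      Ijz r (pc + size s + 3) :: s ++ [:: Iconst 1 0; Ijz 1 pc]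
  end.

Inductive steps (p : program) :
  nat -> memory -> nat -> nat -> memory -> Prop :=
| Steps0 pc m : steps p pc m 0 pc m
| StepsS pc m pc1 m1 t1 pc2 m2 t2 : step p pc m = Some (pc1, m1, t1) ->
    steps p pc1 m1 t2 pc2 m2 -> steps p pc m (t1 + t2) pc2 m2.

Lemma steps_cat p pc m t pc1 m1 t1 pc2 m2 :
  steps p pc m t pc1 m1 -> steps p pc1 m1 t1 pc2 m2 ->
  steps p pc m (t + t1) pc2 m2.
Proof.
elim=> // {pc m t pc1 m1} pc m pca ma ta pcb mb tb st _ IH /IH sts.
by rewrite -addnA; apply: StepsS st sts.
Qed.

Lemma steps_run p pc m t pc' m' : steps p pc m t pc' m' ->
  step p pc' m' = None -> exists fuel, run p fuel pc m = Some (m', t).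
Proof.
elim=> {pc m t pc' m'} [pc m st|pc m pc1 m1 t1 pc2 m2 t2 st _ IH /IH[f Hf]].
  by exists 0; rewrite /= st.
by exists f.+1; rewrite /= st Hf.
Qed.

Definition code_at (p : program) (pc : nat) (s : program) : Prop :=
  exists p1 p2, p = p1 ++ s ++ p2 /\ size p1 = pc.

Lemma code_at_catl p pc s1 s2 : code_at p pc (s1 ++ s2) -> code_at p pc s1.
Proof.
by case=> p1 [p2 [-> <-]]; exists p1, (s2 ++ p2); split; rewrite // -!catA.
Qed.

Lemma code_at_catr p pc s1 s2 :
  code_at p pc (s1 ++ s2) -> code_at p (pc + size s1) s2.
Proof.
case=> p1 [p2 [-> <-]]; exists (p1 ++ s1), p2.
by rewrite -!catA size_cat.
Qed.

Lemma code_at_cons p pc i s : code_at p pc (i :: s) ->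
  nth Ihalt p pc = i /\ code_at p pc.+1 s.
Proof.
move=> H; split; last by rewrite -addn1; apply: (@code_at_catr _ _ [:: i]).
by case: H => p1 [p2 [-> <-]]; rewrite nth_cat ltnn subnn.
Qed.

Lemma code_at_size p pc s : code_at p pc s -> pc + size s <= size p.
Proof. by case=> p1 [p2 [-> <-]]; rewrite !size_cat addnA leq_addr. Qed.

Lemma step_basic p pc m i : nth Ihalt p pc = i -> basic i ->
  step p pc m = Some (pc.+1, (eff i m).1, (eff i m).2).
Proof. by rewrite /step /eff /step /= => ->; case: i. Qed.

(** A test, of cost at least 1, gains at most two labels of [blen (size p)] bits each and six
    further units, for [Iconst 1 0] and the unconditional jump. Hence the factor. *)
Lemma exec_compile p c m m' t : exec c m m' t ->
  forall pc, code_at p pc (compile pc c) ->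
  exists t', steps p pc m t' (pc + size (compile pc c)) m' /\
             t' <= (7 + 2 * blen (size p)) * t.
Proof.
set L := blen (size p).
have lab l : l <= size p -> blen l <= L by exact: blen_le.
elim=> {c m m' t}.
- move=> i m bi pc /code_at_cons[ni _].
  exists ((eff i m).2 + 0); split; last by lia.
  by rewrite addn1; apply: StepsS (Steps0 _ _ _); apply: step_basic.
- move=> c1 c2 m m1 m2 t1 t2 _ IH1 _ IH2 pc /= cod.
  have [t1' [st1 le1]] := IH1 _ (code_at_catl cod).
  have [t2' [st2 le2]] := IH2 _ (code_at_catr cod).
  exists (t1' + t2'); split; last by rewrite mulnDr leq_add.
  by rewrite size_cat addnA; apply: steps_cat st1 st2.
- move=> r c1 c2 m m' t nz _ IH pc /= cod.
  have sz := code_at_size cod.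
  have [nj cod1] := code_at_cons cod.
  have [t' [st le]] := IH _ (code_at_catl cod1).
  have /= cod2 := code_at_catr cod1.
  have [nc cod3] := code_at_cons cod2; have [nl _] := code_at_cons cod3.
  move: sz nj nc nl; rewrite /= !size_cat /=.
  set s1 := size _; set s2 := size _ => sz nj nc nl.
  exists (1 + blen r + blen (pc + s1 + 3) + blen (m r) +
           (t' + (3 + (3 + blen (pc + s1 + 3 + s2) + 0)))); split; last first.
    have l1 : blen (pc + s1 + 3) <= L by apply: lab; lia.
    have l2 : blen (pc + s1 + 3 + s2) <= L by apply: lab; lia.
    nia.
  apply: (StepsS (pc1 := pc.+1) (m1 := m)); first by rewrite /step nj (negbTE nz).
  apply: steps_cat st _.
  apply: (StepsS (pc1 := (pc.+1 + s1).+1) (m1 := upd m' 1 0)).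
    by rewrite /step nc blen1 blen0.
  have -> : pc + (s1 + s2.+2).+1 = pc + s1 + 3 + s2 by lia.
  apply: StepsS (Steps0 _ _ _).
  by rewrite /step nl (_ : upd _ 1 0 1 = 0) // blen1 blen0 eqxx; congr (Some (_, _)); lia.
- move=> r c1 c2 m m' t z _ IH pc /= cod.
  have sz := code_at_size cod.
  have [nj cod1] := code_at_cons cod.
  have cod2 := (code_at_cons (code_at_cons (code_at_catr cod1)).2).2.
  move: sz nj cod2.
  rewrite /= !size_cat /=.
  set s1 := size (compile pc.+1 c1).
  have -> : (pc.+1 + s1).+2 = pc + s1 + 3 by lia.
  move=> sz nj cod2; have [t' [st le]] := IH _ cod2.
  move: st sz nj; set s2 := size _ => st sz nj.
  exists (1 + blen r + blen (pc + s1 + 3) + blen (m r) + t'); split; last first.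
    have l1 : blen (pc + s1 + 3) <= L by apply: lab; lia.
    nia.
  have -> : pc + (s1 + s2.+2).+1 = pc + s1 + 3 + s2 by lia.
  by apply: StepsS st; rewrite /step nj z.
- move=> r c m z pc /= cod.
  have sz := code_at_size cod; have [nj _] := code_at_cons cod.
  move: sz nj; rewrite /= size_cat /=; set s := size _ => sz nj.
  exists (1 + blen r + blen (pc + s + 3) + blen (m r) + 0); split; last first.
    have l1 : blen (pc + s + 3) <= L by apply: lab; lia.
    nia.
  apply: StepsS (Steps0 _ _ _); rewrite /step nj z eqxx.
  by congr (Some (_, _, _)); lia.
- move=> r c m m1 m2 t1 t2 nz _ IH1 _ IH2 pc /= cod.
  have sz := code_at_size cod.
  have [nj cod1] := code_at_cons cod.
  have [t1' [st1 le1]] := IH1 _ (code_at_catl cod1).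
  have [t2' [st2 le2]] := IH2 _ cod.
  have /= cod2 := code_at_catr cod1.
  have [nc cod3] := code_at_cons cod2; have [nl _] := code_at_cons cod3.
  move: st2 sz nj nc nl; rewrite /= !size_cat /=.
  set s := size _ => st2 sz nj nc nl.
  exists (1 + blen r + blen (pc + s + 3) + blen (m r) +
           (t1' + (3 + (3 + blen pc + t2')))); split; last first.
    have l1 : blen (pc + s + 3) <= L by apply: lab; lia.
    have l2 : blen pc <= L by apply: lab; lia.
    nia.
  apply: (StepsS (pc1 := pc.+1) (m1 := m)); first by rewrite /step nj (negbTE nz).
  apply: steps_cat st1 _.
  apply: (StepsS (pc1 := (pc.+1 + s).+1) (m1 := upd m1 1 0)).
    by rewrite /step nc blen1 blen0.
  apply: StepsS st2.
  by rewrite /step nl (_ : upd _ 1 0 1 = 0) // blen1 blen0 eqxx; congr (Some (_, _)); lia.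
Qed.

(** * Polynomially bounded functions *)

(** The base is at least 2 even at n = 0, so a single exponent absorbs constants and
    coefficients. *)
Definition poly_bounded (P : nat -> nat) : Prop :=
  exists b, forall n, P n <= n.+2 ^ b.

Lemma poly_le P Q : poly_bounded Q -> (forall n, P n <= Q n) -> poly_bounded P.
Proof. by case=> b Hb le; exists b => n; apply: leq_trans (Hb n). Qed.

Lemma poly_const c : poly_bounded (fun=> c).
Proof.
exists c => n; apply: leq_trans (ltnW (ltn_expl c (isT : 1 < 2))) _.
by case: c => // c; rewrite leq_exp2r.
Qed.

Lemma poly_id : poly_bounded id.
Proof. by exists 1 => n; rewrite expn1; lia. Qed.

Lemma poly_pow b : poly_bounded (fun n => n.+2 ^ b).
Proof. by exists b. Qed.

Lemma leq_pow2 n a b : a <= b -> n.+2 ^ a <= n.+2 ^ b.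
Proof. by move=> le; rewrite leq_exp2l. Qed.

Lemma poly_add P Q : poly_bounded P -> poly_bounded Q ->
  poly_bounded (fun n => P n + Q n).
Proof.
case=> a Ha [b Hb]; exists (maxn a b).+1 => n.
have := leq_pow2 n (leq_maxl a b); have := leq_pow2 n (leq_maxr a b).
by have := Ha n; have := Hb n; rewrite expnS; nia.
Qed.

Lemma poly_mul P Q : poly_bounded P -> poly_bounded Q ->
  poly_bounded (fun n => P n * Q n).
Proof. by case=> a Ha [b Hb]; exists (a + b) => n; rewrite expnD leq_mul. Qed.

Lemma poly_comp P Q : poly_bounded P -> poly_bounded Q ->
  poly_bounded (fun n => P (Q n)).
Proof.
case=> a Ha [b Hb]; exists (b.+2 * a) => n; apply: leq_trans (Ha _) _.
rewrite expnM; case: a {Ha} => // a; rewrite leq_exp2r //.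
by have := Hb n; have := expn_gt0 n.+2 b; rewrite !expnS; nia.
Qed.

Lemma poly_succ P : poly_bounded P -> poly_bounded (fun n => (P n).+1).
Proof.
by move=> HP; apply: poly_le (poly_add HP (poly_const 1)) _ => n; rewrite addn1.
Qed.

Ltac poly := cbv beta;
  lazymatch goal with
  | |- poly_bounded id => exact poly_id
  | |- poly_bounded (fun n => n) => exact poly_id
  | |- poly_bounded (fun _ => ?c) => exact (poly_const c)
  | |- poly_bounded (fun n => addn (@?f n) (@?g n)) => apply (@poly_add f g); poly
  | |- poly_bounded (fun n => muln (@?f n) (@?g n)) => apply (@poly_mul f g); poly
  | |- poly_bounded (fun n => S (@?f n)) => apply (@poly_succ f); poly
  | H : poly_bounded ?P |- poly_bounded ?P => exact H
  | H : poly_bounded ?P |- poly_bounded (fun n => ?P (@?Q n)) =>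
      apply (@poly_comp P Q H); poly
  end.

Lemma leq_pow m n b : m <= n -> m.+2 ^ b <= n.+2 ^ b.
Proof. by case: b => // b le; rewrite leq_exp2r. Qed.

(** * Heap representation of data *)

(* [drep m lo hi w x]: in memory [m] the word [w] represents [x], all cells of
   the representation being at addresses in [lo, hi). *)
Class Data (T : Type) := {
  dsz : T -> nat;
  drep : memory -> nat -> nat -> nat -> T -> Prop;
  drep_mono : forall m m' lo hi hi' w x,
    (forall i, lo <= i < hi -> m' i = m i) -> hi <= hi' ->
    drep m lo hi w x -> drep m' lo hi' w x;
  drep_word : forall m lo hi w x, drep m lo hi w x -> blen w <= dsz x + blen hi;
  dsz_gt0 : forall x, 0 < dsz x
}.

#[global, refine] Instance Data_nat : Data nat :=
  {| dsz := blen; drep := fun _ _ _ w x => w = x |}.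
Proof. by []. by move=> m lo hi w x ->; apply: leq_addr. by []. Defined.

#[global, refine] Instance Data_bool : Data bool :=
  {| dsz := fun=> 1; drep := fun _ _ _ w x => w = nat_of_bool x |}.
Proof. by []. by move=> m lo hi w [] ->. by []. Defined.

Section DataPair.
Context {A B : Type} {DA : Data A} {DB : Data B}.

Definition pair_rep m lo hi w (x : A * B) :=
  [/\ lo <= w, w.+1 < hi, drep m lo hi (m w) x.1 & drep m lo hi (m w.+1) x.2].

#[global, refine] Instance Data_pair : Data (A * B) :=
  {| dsz := fun x => dsz x.1 + dsz x.2 + 1; drep := pair_rep |}.
Proof.
- move=> m m' lo hi hi' w x agree le [lw wh ra rb]; split => //=; first lia.
    by rewrite agree; [apply: drep_mono ra | lia].
  by rewrite agree; [apply: drep_mono rb | lia].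
- by move=> m lo hi w x [lw wh _ _]; have := @blen_le w hi; lia.
- by move=> x; rewrite addn1.
Defined.
End DataPair.

Section DataSeq.
Context {A : Type} {DA : Data A}.

(** The word 0 is the empty list, so cells need a nonzero address. Apart from that a cons cell has
    the layout of a pair, which makes [fp_cons0] a mere cast. *)
Fixpoint seq_rep m lo hi w (s : seq A) : Prop :=
  if s is x :: s' then
    [/\ lo <= w, w.+1 < hi, 0 < w, drep m lo hi (m w) x
      & seq_rep m lo hi (m w.+1) s']
  else w = 0.

Definition seq_dsz (s : seq A) := foldr (fun x n => dsz x + n + 1) 1 s.

#[global, refine] Instance Data_seq : Data (seq A) :=
  {| dsz := seq_dsz; drep := seq_rep |}.
Proof.
- move=> m m' lo hi hi' w x agree le; elim: x w => [|x s IH] w //= [lw wh w0 rx rs].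
  have e1 : m' w = m w by apply: agree; lia.
  have e2 : m' w.+1 = m w.+1 by apply: agree; lia.
  split=> //; first lia.
    by rewrite e1; apply: drep_mono rx.
  by rewrite e2; apply: IH.
- move=> m lo hi w [|x s] /=; first by move=> ->.
  by case=> lw wh _ _ _; have := @blen_le w hi; lia.
- by case=> //= x s; rewrite addn1.
Defined.
End DataSeq.

(** * Polynomial-time computable functions *)

(* Calling convention: register 0 is the heap pointer, register 1 is scratch, and
   code for frame [k] reads its argument from register [k], leaves its result
   there, and otherwise touches only registers above [k] and fresh heap cells. *)
Definition frame (k lo : nat) (m m' : memory) : Prop :=
  [/\ forall i, 2 <= i < k -> m' i = m i,
      forall i, lo <= i < m 0 -> m' i = m i & m 0 <= m' 0].

(** Heap growth is bounded by the size of the argument alone, whereas the time also depends on the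
    length of addresses, hence on the heap pointer. The [nr] registers from [k] on lie below [lo],
    where the heap begins. *)
Definition computes {A B : Type} `{Data A} `{Data B} (f : A -> B) (nr : nat)
    (code : nat -> cmd) (P : nat -> nat) : Prop :=
  forall k lo m x, 2 <= k -> k + nr <= lo -> lo <= m 0 ->
    drep m lo (m 0) (m k) x ->
  exists m' t,
    [/\ exec (code k) m m' t, frame k lo m m',
        m' 0 <= m 0 + P (dsz x), drep m' lo (m' 0) (m' k) (f x)
      & t <= P (dsz x + blen (m 0))].

(** The size of the result needs its own bound because heap data may be shared: a pair [(x, x)]
    takes two new words but doubles the size. *)
Definition FP {A B : Type} `{Data A} `{Data B} (f : A -> B) : Prop :=
  exists nr code b,
    computes f nr code (fun n => n.+2 ^ b) /\
    forall x, dsz (f x) <= (dsz x).+2 ^ b.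

Lemma frame_refl k lo m : frame k lo m m.
Proof. by split. Qed.

Lemma frame_trans k k' lo m1 m2 m3 : k <= k' -> frame k lo m1 m2 ->
  frame k' lo m2 m3 -> frame k lo m1 m3.
Proof.
move=> kk [a1 b1 c1] [a2 b2 c2]; split; last lia.
  by move=> i ri; rewrite a2; [apply: a1 | lia].
by move=> i ri; rewrite b2; [apply: b1 | lia].
Qed.

Lemma frame_le k k' lo m1 m2 : k <= k' -> frame k' lo m1 m2 -> frame k lo m1 m2.
Proof. by move=> le; apply: frame_trans le (frame_refl _ _ _). Qed.

Lemma frame_rep {A : Type} `{Data A} k lo m m' w (x : A) : frame k lo m m' ->
  drep m lo (m 0) w x -> drep m' lo (m' 0) w x.
Proof. by case=> _ agree le; apply: drep_mono. Qed.

Section FPIntro.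
Context {A B : Type} `{Data A} `{Data B}.

Lemma fp_intro (f : A -> B) nr code P S :
  poly_bounded P -> poly_bounded S ->
  computes f nr code P -> (forall x, dsz (f x) <= S (dsz x)) -> FP f.
Proof.
move=> [a Ha] [b Hb] Hc Hs; exists nr, code, (maxn a b); split.
  move=> k lo m x k2 le1 le2 rx; have [m' [t [e fr h r le]]] := Hc _ _ _ _ k2 le1 le2 rx.
  exists m', t; split=> //.
    by apply: leq_trans h _; rewrite leq_add2l (leq_trans (Ha _)) // leq_pow2 ?leq_maxl.
  by apply: leq_trans le _; rewrite (leq_trans (Ha _)) // leq_pow2 ?leq_maxl.
by move=> x; rewrite (leq_trans (Hs _)) // (leq_trans (Hb _)) // leq_pow2 ?leq_maxr.
Qed.

Lemma fp_elim (f : A -> B) : FP f -> exists nr code P,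
  [/\ poly_bounded P, {homo P : m n / m <= n}, computes f nr code P
    & forall x, dsz (f x) <= P (dsz x)].
Proof.
case=> nr [code [b [c s]]]; exists nr, code, (fun n => n.+2 ^ b).
by split=> //; [exact: poly_pow | move=> m n; apply: leq_pow].
Qed.

Lemma fp_ext (f g : A -> B) : f =1 g -> FP f -> FP g.
Proof.
move=> fg [nr [code [b [c s]]]]; exists nr, code, b; split.
  by move=> k lo m x k2 l1 l2 /c[] // m' [t []]; rewrite fg; exists m', t.
by move=> x; rewrite -fg.
Qed.
End FPIntro.

(** * Straight-line code *)

Fixpoint Cbs (s : seq instr) : cmd :=
  match s with
  | [::] => Cbas (Iconst 1 0)
  | [:: i] => Cbas i
  | i :: s' => Cseq (Cbas i) (Cbs s')
  end.

Fixpoint effs (s : seq instr) (m : memory) : memory * nat :=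
  if s is i :: s' then
    let r := effs s' (eff i m).1 in (r.1, (eff i m).2 + r.2)
  else (m, 0).

Lemma exec_Cbs s m : 0 < size s -> all basic s ->
  exec (Cbs s) m (effs s m).1 (effs s m).2.
Proof.
elim: s m => // i s IH m _ /= /andP[bi bs].
case: s IH bs => [|j s] IH bs; first by rewrite addn0; apply: Ebas.
by apply: Eseq; [apply: Ebas | apply: IH].
Qed.

Lemma updE m r v i : upd m r v i = if i == r then v else m i.
Proof. by []. Qed.

Ltac regs := repeat
  match goal with
  | |- context [?a == ?b :> nat] =>
      first [ rewrite (_ : (a == b) = true); last by lia
            | rewrite (_ : (a == b) = false); last by lia ]
  end.

(** Register [r] is written after both fields have been stored, so it may coincide with [a] or [b];
    [Isub r 0 1] recovers the address of the first field. *)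
Definition alloc (r a b : nat) : cmd :=
  Cbs [:: Istore 0 a; Iconst 1 1; Iadd 0 0 1; Istore 0 b; Isub r 0 1; Iadd 0 0 1].

Lemma exec_alloc r a b m : 2 <= r < m 0 -> 2 <= a < m 0 -> 2 <= b < m 0 ->
  exists m' t,
  [/\ exec (alloc r a b) m m' t,
      [/\ m' 0 = (m 0).+2, m' r = m 0, m' (m 0) = m a & m' (m 0).+1 = m b],
      forall i, 2 <= i -> i != r -> i != m 0 -> i != (m 0).+1 -> m' i = m i
    & t <= 30 + 12 * blen (m 0) + blen (m a) + blen (m b)].
Proof.
move=> rr ra rb.
eexists; eexists; split; first by apply: exec_Cbs.
- split; rewrite /= ?updE; regs; lia.
- by move=> i i2 i3 i4 i5; rewrite /= !updE; regs.
- rewrite /=  !updE; regs.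
  have := @blen_le r (m 0); have := @blen_le a (m 0); have := @blen_le b (m 0).
  have := blenD (m 0) 1; have := blenD (m 0 + 1) 1; rewrite blen1 blen0; lia.
Qed.

(** For straight-line code that allocates nothing: the result lies in the old heap. *)
Lemma fp_simple {A B : Type} {DA : Data A} {DB : Data B} (f : A -> B) nr
    (s : nat -> seq instr) T S :
  poly_bounded T -> poly_bounded S -> (forall k, 0 < size (s k)) ->
  (forall k, all basic (s k)) ->
  (forall k lo m x, 2 <= k -> k + nr <= lo -> lo <= m 0 ->
     drep m lo (m 0) (m k) x ->
     let m' := (effs (s k) m).1 in
     [/\ forall i, 2 <= i -> (i < k) || (lo <= i) -> m' i = m i,
         m' 0 = m 0, drep m lo (m 0) (m' k) (f x)
       & (effs (s k) m).2 <= T (dsz x + blen (m 0))]) ->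
  (forall x, dsz (f x) <= S (dsz x)) -> FP f.
Proof.
move=> pT pS sn sb spec fS; apply: (fp_intro (nr := nr) (code := fun k => Cbs (s k)) pT pS) => //.
move=> k lo m x k2 l1 l2 rx; have [ag h r t] := spec k lo m x k2 l1 l2 rx.
have fr : frame k lo m (effs (s k) m).1.
  split; last by rewrite h.
    by move=> i ri; apply: ag; lia.
  by move=> i ri; apply: ag; lia.
exists (effs (s k) m).1, (effs (s k) m).2; split=> //; first exact: exec_Cbs.
  by rewrite h leq_addr.
exact: frame_rep fr r.
Qed.

Section Basic.
Context {A B C : Type} {DA : Data A} {DB : Data B} {DC : Data C}.

(** For functions whose value is represented by the very word that represents the argument; the code
    only touches the scratch register. *)
Lemma fp_cast (f : A -> B) S : poly_bounded S ->
  (forall m lo hi w x, 0 < lo -> drep m lo hi w x -> drep m lo hi w (f x)) ->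
  (forall x, dsz (f x) <= S (dsz x)) -> FP f.
Proof.
move=> pS cast fS.
apply: (@fp_simple _ _ _ _ f 0 (fun=> [:: Iconst 1 0]) (fun=> 3) S) => //.
  exact: poly_const.
move=> k lo m x k2 l1 l2 rx; split=> //=.
- by move=> i i2 _; rewrite updE; regs.
- by rewrite updE; regs; apply: cast => //; lia.
Qed.

Lemma fp_comp (f : A -> B) (g : B -> C) : FP f -> FP g -> FP (fun x => g (f x)).
Proof.
move=> /fp_elim[nf [cf [P [pP mP Cf Sf]]]] /fp_elim[ng [cg [Q [pQ mQ Cg Sg]]]].
apply: (@fp_intro _ _ _ _ _ (maxn nf ng) (fun k => Cseq (cf k) (cg k))
  (* [Q (P n)] pays for the heap cells of [g]. The argument of the last [Q] bounds the size of [f x]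
     plus the length of the heap pointer after [f] has run. *)
  (fun n => P n + Q (P n) + Q (P n + (n + (P n).+1))) (fun n => Q (P n))).
- by poly.
- by poly.
- move=> k lo m x k2 l1 l2 rx.
  have [|m1 [t1 [e1 fr1 h1 r1 le1]]] := Cf k lo m x k2 _ l2 rx; first lia.
  have l1' : lo <= m1 0 by case: fr1 => _ _; lia.
  have [|m2 [t2 [e2 fr2 h2 r2 le2]]] := Cg k lo m1 (f x) k2 _ l1' r1; first lia.
  exists m2, (t1 + t2); split=> //.
  + exact: Eseq e1 e2.
  + exact: frame_trans fr1 fr2.
  + have s3 : Q (dsz (f x)) <= Q (P (dsz x)) by exact/mQ/Sf.
    have h1' : m1 0 <= m 0 + P (dsz x) := h1.
    have h2' : m2 0 <= m1 0 + Q (dsz (f x)) := h2.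
    lia.
  + have h1' : m1 0 <= m 0 + P (dsz x) := h1.
    have le1' : t1 <= P (dsz x + blen (m 0)) := le1.
    have le3 : dsz (f x) + blen (m1 0) <=
       P (dsz x + blen (m 0)) + (dsz x + blen (m 0) + (P (dsz x + blen (m 0))).+1).
      have s1 : P (dsz x) <= P (dsz x + blen (m 0)) by exact/mP/leq_addr.
      have sf : dsz (f x) <= P (dsz x) := Sf x.
      have s2 := blen_le h1'.
      have s3 : blen (m 0 + P (dsz x)) <= blen (m 0) + blen (P (dsz x)) by exact: blenD.
      have s4 : blen (P (dsz x)) <= (P (dsz x)).+1 by exact: blen_leS.
      lia.
    have le2' : t2 <= Q _ := leq_trans le2 (mQ _ _ le3).
    lia.
- by move=> x; apply: leq_trans (Sg _) _; apply: mQ; apply: Sf.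
Qed.

(** Code overwrites its own argument register, so [f] and [g] work on copies of the argument, in the
    frames [k.+1] and [k.+2]. *)
Lemma fp_pair (f : A -> B) (g : A -> C) :
  FP f -> FP g -> FP (fun x => (f x, g x)).
Proof.
move=> /fp_elim[nf [cf [P [pP mP Cf Sf]]]] /fp_elim[ng [cg [Q [pQ mQ Cg Sg]]]].
pose mov r a := Cbs [:: Iconst 1 0; Iadd r a 1].
apply: (@fp_intro _ _ _ _ _ (nf + ng + 4)
  (fun k => Cseq (mov k.+1 k) (Cseq (cf k.+1) (Cseq (mov k.+2 k)
     (Cseq (cg k.+2) (alloc k k.+1 k.+2)))))
  (fun n => P n + Q (n + P n + 1) + Q n + 100 + 100 * (n + P n + Q n)) (fun n => P n + Q n + 1)).
- by poly.
- by poly.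
- move=> k lo m x k2 l1 l2 rx.
  set s := dsz x.
  have bk i : i <= k.+2 -> blen i <= blen (m 0) by move=> ?; apply: blen_le; lia.
  have wx : blen (m k) <= s + blen (m 0) by exact: drep_word rx.
  set ma := (effs [:: Iconst 1 0; Iadd k.+1 k 1] m).1.
  have ma0 : ma 0 = m 0 by rewrite /ma /= !updE; regs.
  have mak : ma k = m k by rewrite /ma /= !updE; regs.
  have mak1 : ma k.+1 = m k by rewrite /ma /= !updE; regs; lia.
  have fra : frame k.+1 lo m ma.
    by split; rewrite ?ma0 // => i ri; rewrite /ma /= !updE; regs.
  have ta : (effs [:: Iconst 1 0; Iadd k.+1 k 1] m).2 <= 10 + 2 * blen (m 0) + blen (m k).
    rewrite /= !updE; regs; rewrite blen1 blen0.
    by have := bk k; have := bk k.+1; lia.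
  have rx1 : drep ma lo (ma 0) (ma k.+1) x by rewrite mak1; exact: frame_rep fra rx.
  have [|||m1 [t1 [e1 fr1 h1 r1 le1]]] := Cf k.+1 lo ma x _ _ _ rx1; [lia..|].
  have frm1 := frame_trans (leqnn _) fra fr1.
  have m1k : m1 k = m k by case: frm1 => H _ _; apply: H; lia.
  have lm1 : m 0 <= m1 0 by case: frm1.
  set mb := (effs [:: Iconst 1 0; Iadd k.+2 k 1] m1).1.
  have mb0 : mb 0 = m1 0 by rewrite /mb /= !updE; regs.
  have mbk2 : mb k.+2 = m k by rewrite /mb /= !updE; regs; lia.
  have frb : frame k.+2 lo m1 mb.
    by split; rewrite ?mb0 // => i ri; rewrite /mb /= !updE; regs.
  have tb : (effs [:: Iconst 1 0; Iadd k.+2 k 1] m1).2 <= 10 + 2 * blen (m 0) + blen (m k).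
    rewrite /= !updE; regs; rewrite blen1 blen0 m1k.
    by have := bk k; have := bk k.+2; lia.
  have frmb := frame_trans (leqnSn _) frm1 frb.
  have rx2 : drep mb lo (mb 0) (mb k.+2) x by rewrite mbk2; exact: frame_rep frmb rx.
  have [|||m2 [t2 [e2 fr2 h2 r2 le2]]] := Cg k.+2 lo mb x _ _ _ rx2; [lia..|].
  have frm2 := frame_trans (leqnSn _) frmb fr2.
  have lm2 : mb 0 <= m2 0 by case: fr2.
  have r1' : drep m2 lo (m2 0) (m2 k.+1) (f x).
    have -> : m2 k.+1 = m1 k.+1.
      case: (frame_trans (leqnn _) frb fr2) => H _ _; apply: H; lia.
    exact: frame_rep (frame_trans (leqnn _) frb fr2) r1.
  have [|||m3 [t3 [e3 [a0 ak ah ah1] ag le3]]] := @exec_alloc k k.+1 k.+2 m2; [lia..|].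
  have fr3 : frame k lo m2 m3.
    by split; [move=> i ri; apply: ag; lia | move=> i ri; apply: ag; lia | lia].
  exists m3, ((effs [:: Iconst 1 0; Iadd k.+1 k 1] m).2 + (t1 +
     ((effs [:: Iconst 1 0; Iadd k.+2 k 1] m1).2 + (t2 + t3)))).
  have H1 : m1 0 <= m 0 + P s by rewrite -ma0.
  have H2 : m2 0 <= m 0 + P s + Q s by rewrite mb0 -/s in h2; lia.
  have B1 : blen (m1 0) <= blen (m 0) + (P s).+1.
    apply: leq_trans (blen_le H1) _; apply: leq_trans (blenD _ _) _.
    by rewrite leq_add2l blen_leS.
  have B2 : blen (m2 0) <= blen (m 0) + (P s + Q s).+1.
    move: H2; rewrite -addnA => H2.
    apply: leq_trans (blen_le H2) _; apply: leq_trans (blenD _ _) _.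
    by rewrite leq_add2l blen_leS.
  have Ps : P s <= P (s + blen (m 0)) by exact/mP/leq_addr.
  have Qs : Q s <= Q (s + blen (m 0)) by exact/mQ/leq_addr.
  split.
  + apply: Eseq (exec_Cbs _ _ _) _ => //; apply: Eseq e1 _.
    by apply: Eseq (exec_Cbs _ _ _) _ => //; apply: Eseq e2 e3.
  + by apply: frame_trans fr3; [|apply: frame_le frm2; lia].
  + rewrite a0; move: H2; rewrite -/s; lia.
  + rewrite ak; split=> /=; rewrite ?a0 ?ah ?ah1; try lia.
      by rewrite -a0; apply: frame_rep fr3 r1'.
    by rewrite -a0; apply: frame_rep fr3 r2.
  + have w1 := drep_word r1'; have w2 := drep_word r2.
    have sf : dsz (f x) <= P s := Sf x.
    have sg : dsz (g x) <= Q s := Sg x.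
    rewrite ma0 mb0 -/s in le1 le2.
    have Qz : Q (s + blen (m1 0)) <= Q (s + blen (m 0) + P (s + blen (m 0)) + 1).
      by apply: mQ; lia.
    lia.
- move=> x /=; have sf : dsz (f x) <= P (dsz x) := Sf x.
  have sg : dsz (g x) <= Q (dsz x) := Sg x.
  lia.
Qed.
End Basic.

Section Prims.
Context {A B : Type} {DA : Data A} {DB : Data B}.

Lemma fp_id : FP (fun x : A => x).
Proof. by apply: (fp_cast poly_id). Qed.

Lemma fp_fst0 : FP (fun p : A * B => p.1).
Proof.
apply: (@fp_simple _ _ _ _ _ 1 (fun k => [:: Iload k k]) (fun n => 10 * n.+1) id) => //.
- by poly.
- exact: poly_id.
- move=> k lo m x k2 l1 l2 [lw wh ra rb]; split=> //=.
  + by move=> i i2 ri; rewrite updE; regs.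
  + by rewrite updE; regs.
  + by rewrite updE; regs.
  + have := @blen_le k (m 0); have := @blen_le (m k) (m 0); have := drep_word ra; lia.
- by move=> x /=; lia.
Qed.

Lemma fp_snd0 : FP (fun p : A * B => p.2).
Proof.
apply: (@fp_simple _ _ _ _ _ 1 (fun k => [:: Iconst 1 1; Iadd k k 1; Iload k k])
  (fun n => 20 * n.+1) id) => //.
- by poly.
- exact: poly_id.
- move=> k lo m x k2 l1 l2 [lw wh ra rb]; split=> //=.
  + by move=> i i2 ri; rewrite !updE; regs.
  + by rewrite !updE; regs.
  + by rewrite !updE; regs; rewrite addn1; regs.
  + rewrite !updE; regs; rewrite !addn1; regs.
    have := @blen_le k (m 0); have := @blen_le (m k) (m 0); have := drep_word rb.
    have := @blen_le (m k).+1 (m 0); rewrite ?blen1; lia.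
- by move=> x /=; lia.
Qed.

Lemma fp_cst0 (n : nat) : FP (fun _ : A => n).
Proof.
apply: (@fp_simple _ _ _ _ _ 1 (fun k => [:: Iconst k n]) (fun s => s + 1 + blen n)
   (fun=> blen n)) => //.
- by poly.
- by poly.
- move=> k lo m x k2 l1 l2 rx; split=> //=.
  + by move=> i i2 ri; rewrite updE; regs.
  + by rewrite updE; regs.
  + by rewrite updE; regs.
  + by have := @blen_le k (m 0); lia.
Qed.

Lemma fp_nil0 : FP (fun _ : A => [::] : seq B).
Proof.
apply: (@fp_comp _ _ _ _ _ _ (fun=> 0) (fun _ : nat => [::]) (fp_cst0 0)).
apply: (@fp_simple _ _ _ _ _ 1 (fun k => [:: Iconst k 0]) (fun s => s + 2)
   (fun=> 1)) => //.
- by poly.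
- by poly.
- move=> k lo m x k2 l1 l2 rx; split=> //=.
  + by move=> i i2 ri; rewrite updE; regs.
  + by rewrite updE; regs.
  + by rewrite updE; regs.
  + by have := @blen_le k (m 0); rewrite ?blen0; lia.
Qed.
End Prims.

Lemma fp_op (op : nat -> nat -> nat) (I : nat -> nat -> nat -> instr) :
  (forall r a b, basic (I r a b)) ->
  (forall r a b m, eff (I r a b) m = (upd m r (op (m a) (m b)),
     1 + blen r + blen a + blen b + blen (m a) + blen (m b))) ->
  (forall a b, blen (op a b) <= blen a + blen b) ->
  FP (fun p : nat * nat => op p.1 p.2).
Proof.
move=> bI eI sI.
apply: (@fp_simple _ _ _ _ _ 2 (fun k => [:: Iload k.+1 k; Iconst 1 1; Iadd k k 1; Iload k k; I k k.+1 k])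
  (fun n => 60 * n.+1) id) => //.
- by poly.
- exact: poly_id.
- by move=> k /=; rewrite bI.
- move=> k lo m x k2 l1 l2 [lw wh /= ra rb]; rewrite /= eI /=; split=> //.
  + by move=> i i2 ri; rewrite !updE; regs.
  + by rewrite !updE; regs.
  + by rewrite !updE; regs; rewrite addn1; regs; rewrite ra rb.
  + rewrite !updE; regs; rewrite !addn1; regs; rewrite -ra -rb.
    have := @blen_le k (m 0); have := @blen_le (m k) (m 0).
    have := @blen_le k.+1 (m 0); have := @blen_le (m k).+1 (m 0); rewrite ?blen1; lia.
- by move=> x; apply: leq_trans (sI _ _) _ => /=; lia.
Qed.

Lemma fp_eq00 : FP (fun n : nat => n == 0).
Proof.
apply: (@fp_simple _ _ _ _ _ 1 (fun k => [:: Iconst 1 1; Isub k 1 k])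
  (fun n => 20 * n.+1) (fun=> 1)) => //.
- by poly.
- by poly.
- move=> k lo m x k2 l1 l2 /= rx; split=> //=.
  + by move=> i i2 ri; rewrite !updE; regs.
  + by rewrite !updE; regs.
  + by rewrite !updE; regs; rewrite rx; case: x {rx} => // x; lia.
  + rewrite !updE; regs; rewrite rx.
    have := @blen_le k (m 0); rewrite ?blen1; lia.
Qed.

Lemma fp_cons0 {A} {DA : Data A} : FP (fun p : A * seq A => p.1 :: p.2).
Proof.
apply: (fp_cast poly_id) => // m lo hi w [x s] lo0 [/= lw wh rx rs].
by split=> //; lia.
Qed.

Lemma fp_if {A B : Type} {DA : Data A} {DB : Data B} (c : A -> bool) (f g : A -> B) :
  FP c -> FP f -> FP g -> FP (fun x => if c x then f x else g x).
Proof.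
move=> /fp_elim[nc [cc [R [pR mR Cc Sc]]]] /fp_elim[nf [cf [P [pP mP Cf Sf]]]].
move=> /fp_elim[ng [cg [Q [pQ mQ Cg Sg]]]].
pose mov r a := Cbs [:: Iconst 1 0; Iadd r a 1].
apply: (@fp_intro _ _ _ _ _ (nc + nf + ng + 4)
  (fun k => Cseq (mov k.+1 k) (Cseq (cc k.+1) (Cif k.+1 (cf k) (cg k))))
  (fun n => R n + P n + P (n + R n + 1) + Q n + Q (n + R n + 1) + 100 + 100 * n)
  (fun n => P n + Q n)).
- by poly.
- by poly.
- move=> k lo m x k2 l1 l2 rx.
  set s := dsz x.
  have bk i : i <= k.+2 -> blen i <= blen (m 0) by move=> ?; apply: blen_le; lia.
  have wx : blen (m k) <= s + blen (m 0) by exact: drep_word rx.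
  set ma := (effs [:: Iconst 1 0; Iadd k.+1 k 1] m).1.
  have ma0 : ma 0 = m 0 by rewrite /ma /= !updE; regs.
  have mak : ma k = m k by rewrite /ma /= !updE; regs.
  have mak1 : ma k.+1 = m k by rewrite /ma /= !updE; regs; lia.
  have fra : frame k.+1 lo m ma.
    by split; rewrite ?ma0 // => i ri; rewrite /ma /= !updE; regs.
  have ta : (effs [:: Iconst 1 0; Iadd k.+1 k 1] m).2 <= 10 + 2 * blen (m 0) + blen (m k).
    rewrite /= !updE; regs; rewrite blen1 blen0.
    by have := bk k; have := bk k.+1; lia.
  have rx1 : drep ma lo (ma 0) (ma k.+1) x by rewrite mak1; exact: frame_rep fra rx.
  have [|||m1 [t1 [e1 fr1 h1 r1 le1]]] := Cc k.+1 lo ma x _ _ _ rx1; [lia..|].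
  have frm1 := frame_trans (leqnn _) fra fr1.
  have m1k : m1 k = m k by case: frm1 => H _ _; apply: H; lia.
  have lm1 : m 0 <= m1 0 by case: frm1.
  have rx2 : drep m1 lo (m1 0) (m1 k) x by rewrite m1k; exact: frame_rep frm1 rx.
  have H1 : m1 0 <= m 0 + R s by rewrite -ma0.
  have B1 : blen (m1 0) <= blen (m 0) + (R s).+1.
    apply: leq_trans (blen_le H1) _; apply: leq_trans (blenD _ _) _.
    by rewrite leq_add2l blen_leS.
  have Rs : R s <= R (s + blen (m 0)) by exact/mR/leq_addr.
  have Ps : P s <= P (s + blen (m 0)) by exact/mP/leq_addr.
  have Qs : Q s <= Q (s + blen (m 0)) by exact/mQ/leq_addr.
  have Qz : Q (s + blen (m1 0)) <= Q (s + blen (m 0) + R (s + blen (m 0)) + 1).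
    by apply: mQ; lia.
  have Pz : P (s + blen (m1 0)) <= P (s + blen (m 0) + R (s + blen (m 0)) + 1).
    by apply: mP; lia.
  rewrite /= in r1; rewrite ma0 -/s in le1.
  have bk1 : blen (m1 k.+1) = 1 by rewrite r1; case: (c x).
  move: r1; case: (c x) => r1.
    have [|||m2 [t2 [e2 fr2 h2 r2 le2]]] := Cf k lo m1 x _ _ _ rx2; [lia..|].
    exists (upd m2 1 0), ((effs [:: Iconst 1 0; Iadd k.+1 k 1] m).2 + (t1 +
      (1 + blen k.+1 + blen (m1 k.+1) + t2))).
    have fr3 : frame k lo m2 (upd m2 1 0).
      by split=> // i ri; rewrite updE; regs.
    split.
    + apply: Eseq (exec_Cbs _ _ _) _ => //; apply: Eseq e1 _.
      by apply: Eif1 e2; rewrite r1.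
    + by apply: frame_trans fr3; last (apply: frame_trans fr2; last (apply: frame_le frm1)).
    + by rewrite -/s in h2; rewrite updE; regs; rewrite -/s; lia.
    + rewrite (_ : upd m2 1 0 k = m2 k); first exact: (frame_rep fr3).
      by rewrite updE; regs.
    + rewrite -/s in le2.
      by have := bk k.+1; rewrite -/s; lia.
  have [|||m2 [t2 [e2 fr2 h2 r2 le2]]] := Cg k lo m1 x _ _ _ rx2; [lia..|].
  exists m2, ((effs [:: Iconst 1 0; Iadd k.+1 k 1] m).2 + (t1 +
      (1 + blen k.+1 + blen (m1 k.+1) + t2))).
  split.
  + apply: Eseq (exec_Cbs _ _ _) _ => //; apply: Eseq e1 _.
    by apply: Eif0 e2; rewrite r1.
  + by apply: frame_trans fr2; last (apply: frame_le frm1).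
  + by rewrite -/s in h2; rewrite -/s; lia.
  + by [].
  + rewrite -/s in le2.
    by have := bk k.+1; rewrite -/s; lia.
- move=> x; have sf : dsz (f x) <= P (dsz x) := Sf x.
  have sg : dsz (g x) <= Q (dsz x) := Sg x.
  by case: (c x); lia.
Qed.

Arguments dsz {T Data} x : simpl never.

Lemma poly_mono Q : poly_bounded Q ->
  exists Q', [/\ poly_bounded Q', {homo Q' : m n / m <= n} & forall n, Q n <= Q' n].
Proof.
case=> b Hb; exists (fun n => n.+2 ^ b); split=> //; first exact: poly_pow.
by move=> m n; apply: leq_pow.
Qed.

Lemma dsz_cons {E : Type} {DE : Data E} (e : E) l :
  dsz (e :: l) = dsz e + dsz l + 1.
Proof. by []. Qed.

Lemma dsz_nil {E : Type} {DE : Data E} : dsz ([::] : seq E) = 1.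
Proof. by []. Qed.

Lemma dsz_pair {A B : Type} {DA : Data A} {DB : Data B} (a : A) (b : B) :
  dsz (a, b) = dsz a + dsz b + 1.
Proof. by []. Qed.

Lemma dsz_cat {E : Type} {DE : Data E} (l1 l2 : seq E) :
  (dsz (l1 ++ l2)).+1 = dsz l1 + dsz l2.
Proof. by elim: l1 => [|e l1 IH] //; rewrite cat_cons !dsz_cons; lia. Qed.

Lemma dsz_mem {E : Type} {DE : Data E} (l1 l2 : seq E) e :
  dsz e < dsz (l1 ++ e :: l2).
Proof.
have := @dsz_cat E DE l1 (e :: l2); rewrite dsz_cons.
have h1 : 0 < dsz l1 by exact: dsz_gt0.
have h2 : 0 < dsz l2 by exact: dsz_gt0.
lia.
Qed.

Lemma size_dsz {E : Type} {DE : Data E} (l : seq E) : size l < dsz l.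
Proof. by elim: l => // e l; rewrite dsz_cons /=; lia. Qed.

(** Iterating a polynomial-time step may produce exponentially large values, so all intermediate
    accumulators are required to be polynomially bounded. Registers [k] to [k.+4] hold the
    parameter, the accumulator, the rest of the list, its head, and the argument of the step. *)
Lemma fp_foldl {X A E : Type} {DX : Data X} {DA : Data A} {DE : Data E}
    (b : X -> A -> E -> A) (i : X -> A) (l : X -> seq E) Q0 :
  FP (fun p : X * (A * E) => b p.1 p.2.1 p.2.2) -> FP i -> FP l ->
  poly_bounded Q0 ->
  (forall x j, dsz (foldl (b x) (i x) (take j (l x))) <= Q0 (dsz x)) ->
  FP (fun x => foldl (b x) (i x) (l x)).
Proof.
move=> /fp_elim[nb [cb [Pb [pPb mPb Cb Sb]]]] /fp_elim[ni [ci [Pi [pPi mPi Ci Si]]]].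
move=> /fp_elim[nl [cl [Pl [pPl mPl Cl Sl]]]] /poly_mono[Q [pQ mQ leQ]] bnd0.
have bnd x j : dsz (foldl (b x) (i x) (take j (l x))) <= Q (dsz x).
  exact: leq_trans (bnd0 _ _) (leQ _).
(* [U] bounds the argument [(x, (acc, e))] of a step, [G] the heap growth of one iteration (4 words
   for the two pairs), [HH] that of the whole fold, and [CI] the time of an iteration. *)
pose U s := s + Q s + Pl s + 2.
pose G s := 4 + Pb (U s).
pose HH s := Pi s + Pl s + Pl s * G s.
pose CI s := 300 + 100 * (s + HH s + U s) + Pb (U s + s + HH s + 1).
have pU : poly_bounded U by rewrite /U; poly.
have pG : poly_bounded G by rewrite /G; poly.
have pHH : poly_bounded HH by rewrite /HH; poly.
have pCI : poly_bounded CI by rewrite /CI; poly.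
have mU : {homo U : m n / m <= n}.
  by move=> m n le; rewrite /U; have := mQ _ _ le; have := mPl _ _ le; lia.
have mG : {homo G : m n / m <= n}.
  by move=> m n le; rewrite /G; have := mPb _ _ (mU _ _ le); lia.
have mHH : {homo HH : m n / m <= n}.
  by move=> m n le; rewrite /HH !leq_add ?leq_mul // ?mPi ?mPl ?mG.
have mCI : {homo CI : m n / m <= n}.
  move=> m n le; rewrite /CI.
  have h1 := mU _ _ le; have h2 := mHH _ _ le.
  have h3 : Pb (U m + m + HH m + 1) <= Pb (U n + n + HH n + 1) by apply: mPb; lia.
  lia.
pose mov r a := Cbs [:: Iconst 1 0; Iadd r a 1].
pose nxt k := [:: Iconst 1 0; Iadd k.+1 k.+4 1; Iconst 1 1; Iadd k.+2 k.+2 1; Iload k.+2 k.+2].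
pose loop k := Cwhile k.+2 (Cseq (Cbs [:: Iload k.+3 k.+2]) (Cseq (alloc k.+4 k.+1 k.+3)
    (Cseq (alloc k.+4 k k.+4) (Cseq (cb k.+4) (Cbs (nxt k)))))).
(* [B] bounds the length of the heap pointer at the end of the loop, hence of all addresses met on
   the way, so that every iteration gets the same time bound. *)
have loopP k lo x B l2 : 2 <= k -> k + (nb + 5) <= lo -> forall l1 m,
    l x = l1 ++ l2 -> lo <= m 0 ->
    drep m lo (m 0) (m k) x ->
    drep m lo (m 0) (m k.+1) (foldl (b x) (i x) l1) ->
    drep m lo (m 0) (m k.+2) l2 ->
    blen (m 0 + size l2 * G (dsz x)) <= B ->
  exists m' t, [/\ exec (loop k) m m' t, frame k.+1 lo m m',
    m' 0 <= m 0 + size l2 * G (dsz x),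
    drep m' lo (m' 0) (m' k.+1) (foldl (b x) (i x) (l x))
    & t <= (size l2).+1 * (200 + 100 * (B + U (dsz x)) + Pb (U (dsz x) + B))].
  move=> k2 l1o; elim: l2 => [|e l2 IH] l1 m lx lom rx ra rl leB.
    exists m, (1 + blen k.+2 + blen (m k.+2)).
    have z : m k.+2 = 0 by exact: rl.
    split=> //; first exact: Ewhile0.
    - by rewrite leq_addr.
    - by rewrite lx cats0.
    - rewrite z blen0 /= mul0n addn0 in leB *.
      by have := @blen_le k.+2 (m 0); lia.
  case: rl => [lw wh w0 re rl0].
  have rl : drep m lo (m 0) (m (m k.+2).+1) l2 by exact: rl0.
  set s := dsz x in leB IH *.
  have bH : blen (m 0) <= B by apply: leq_trans leB; apply: blen_le; lia.
  have bk j : j <= k.+4 -> blen j <= blen (m 0) by move=> ?; apply: blen_le; lia.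
  have wx : blen (m k) <= s + blen (m 0) by exact: drep_word rx.
  have sa : dsz (foldl (b x) (i x) l1) <= Q s.
    by have := bnd x (size l1); rewrite lx take_size_cat.
  have wa : blen (m k.+1) <= Q s + blen (m 0) by have := drep_word ra; lia.
  have se : dsz e < Pl s.
    by have := Sl x; rewrite lx -/s; have := @dsz_mem E DE l1 l2 e; lia.
  have we : blen (m (m k.+2)) <= Pl s + blen (m 0) by have := drep_word re; lia.
  have wl : blen (m k.+2) <= blen (m 0) by apply: blen_le; lia.
  set ma := (effs [:: Iload k.+3 k.+2] m).1.
  have ma0 : ma 0 = m 0 by rewrite /ma /= !updE; regs.
  have mak3 : ma k.+3 = m (m k.+2) by rewrite /ma /= !updE; regs.
  have fra : frame k.+3 lo m ma.
    by split; rewrite ?ma0 // => j rj; rewrite /ma /= !updE; regs.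
  have ta : (effs [:: Iload k.+3 k.+2] m).2 <= 2 + 3 * blen (m 0) + blen (m (m k.+2)).
    rewrite /=; have := bk k.+3; have := bk k.+2; lia.
  have [|||m1 [t1 [e1 [b0 bk4 bh bh1] ag1 le1]]] := @exec_alloc k.+4 k.+1 k.+3 ma; [lia..|].
  have fr1 : frame k.+4 lo ma m1.
    by split; [move=> j rj; apply: ag1; lia | move=> j rj; apply: ag1; lia | lia].
  have frm1 := frame_trans (leqnSn _) fra fr1.
  have [|||m2 [t2 [e2 [c0 ck4 ch ch1] ag2 le2]]] := @exec_alloc k.+4 k k.+4 m1; [lia..|].
  have fr2 : frame k.+4 lo m1 m2.
    by split; [move=> j rj; apply: ag2; lia | move=> j rj; apply: ag2; lia | lia].
  have frm2 := frame_trans (leqnSn _) frm1 fr2.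
  have m1k : m1 k = m k by case: frm1 => H _ _; apply: H; lia.
  have mak1 : ma k.+1 = m k.+1 by case: fra => H _ _; apply: H; lia.
  have rp1 : drep m1 lo (m1 0) (m1 k.+4) (foldl (b x) (i x) l1, e).
    rewrite bk4; split=> /=; rewrite ?bh ?bh1; try lia.
      by rewrite mak1; apply: frame_rep frm1 ra.
    by rewrite mak3; apply: frame_rep frm1 re.
  have rp : drep m2 lo (m2 0) (m2 k.+4) (x, (foldl (b x) (i x) l1, e)).
    rewrite ck4; split; rewrite ?ch ?ch1; try lia.
      by rewrite m1k; apply: frame_rep frm2 rx.
    exact: frame_rep fr2 rp1.
  have [|||m3 [t3 [e3 fr3 h3 r3 le3]]] := Cb k.+4 lo m2 _ _ _ _ rp; [lia..|].
  have frm3 := frame_trans (leqnSn _) frm2 fr3.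
  have m3k2 : m3 k.+2 = m k.+2 by case: frm3 => H _ _; apply: H; lia.
  have m3w : m3 (m k.+2).+1 = m (m k.+2).+1 by case: frm3 => _ H _; apply: H; lia.
  have lm3 : m 0 <= m3 0 by case: frm3.
  have sp : dsz (x, (foldl (b x) (i x) l1, e)) <= U s.
    by rewrite /U !dsz_pair -/s; lia.
  have h3' : m3 0 <= m 0 + G s by rewrite /G; have := mPb _ _ sp; lia.
  have b3 : blen (m3 0) <= B.
    by apply: leq_trans leB; apply: blen_le; rewrite /= mulSn; lia.
  have b2 : blen (m2 0) <= B.
    by apply: leq_trans b3; apply: blen_le; case: fr3.
  have b1 : blen (m1 0) <= B.
    by apply: leq_trans b2; apply: blen_le; case: fr2.
  set m4 := (effs (nxt k) m3).1.
  have m40 : m4 0 = m3 0 by rewrite /m4 /= !updE; regs.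
  have m4k1 : m4 k.+1 = m3 k.+4.
    by rewrite /m4 /= !updE; regs; rewrite addn0.
  have m4k2 : m4 k.+2 = m (m k.+2).+1.
    rewrite /m4 /= !updE; regs; rewrite m3k2 addn1; regs.
    exact: m3w.
  have fr4 : frame k.+1 lo m3 m4.
    by split; rewrite ?m40 // => j rj; rewrite /m4 /= !updE; regs.
  have sn : dsz (foldl (b x) (i x) (rcons l1 e)) <= Q s.
    by have := bnd x (size l1).+1; rewrite lx -cat_rcons take_size_cat ?size_rcons.
  have r3' : drep m3 lo (m3 0) (m3 k.+4) (foldl (b x) (i x) (rcons l1 e)).
    by rewrite -cats1 foldl_cat.
  have t4 : (effs (nxt k) m3).2 <= 30 + 11 * B + Q s + Pl s + dsz l2.
    have w4 := drep_word r3'; have w5 := drep_word rl.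
    rewrite /= !updE; regs; rewrite m3k2 !addn1; regs; rewrite m3w ?blen0 ?blen1.
    have := @blen_le (m k.+2).+1 (m 0); have := bk k.+4; have := bk k.+2; have := bk k.+1; lia.
  set m5 := upd m4 1 0.
  have fr5 : frame k.+3 lo m4 m5 by split=> // j rj; rewrite /m5 updE; regs.
  have frm5 : frame k.+1 lo m m5.
    have frk : frame k.+1 lo m m3 by apply: frame_le frm3; lia.
    have le13 : k.+1 <= k.+3 by lia.
    exact: frame_trans le13 (frame_trans (leqnn _) frk fr4) fr5.
  have fr35 : frame k.+1 lo m3 m5 by apply: (frame_trans (_ : k.+1 <= k.+3) fr4 fr5); lia.
  have m5E j : 2 <= j -> m5 j = m4 j by move=> ?; rewrite /m5 updE; regs.
  have m50 : m5 0 = m3 0 by rewrite -m40.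
  have m5k1 : m5 k.+1 = m3 k.+4 by rewrite -m4k1; apply: m5E; lia.
  have m5k2 : m5 k.+2 = m (m k.+2).+1 by rewrite -m4k2; apply: m5E; lia.
  have [||||||m6 [t6 [e6 fr6 h6 r6 le6]]] := IH (rcons l1 e) m5.
  - by rewrite lx cat_rcons.
  - by rewrite m50; lia.
  - have -> : m5 k = m k by case: (frm5) => H _ _; apply: H; lia.
    exact: frame_rep frm5 rx.
  - by rewrite m5k1; apply: frame_rep fr35 r3'.
  - by rewrite m5k2; apply: frame_rep frm5 rl.
  - by apply: leq_trans leB; apply: blen_le; rewrite m50 /= mulSn; lia.
  have sl2 : dsz l2 <= Pl s.
    have := Sl x; rewrite lx; have := @dsz_cat E DE l1 (e :: l2); rewrite dsz_cons.
    have h1 : 0 < dsz l1 by exact: dsz_gt0.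
    rewrite -/s; lia.
  eexists; eexists; split.
  - apply: Ewhile1 e6; first by lia.
    apply: Eseq (exec_Cbs _ _ _) _ => //; apply: Eseq e1 _.
    by apply: Eseq e2 _; apply: Eseq e3 _; apply: exec_Cbs.
  - exact: frame_trans frm5 fr6.
  - by rewrite m50 in h6; rewrite /= mulSn; lia.
  - by [].
  - rewrite -/s in le3 le6.
    have le3' : t3 <= Pb (U s + B) by apply: leq_trans le3 _; apply: mPb; lia.
    rewrite [X in _ <= X]mulSn; apply: leq_add; last exact: le6.
    have : 1 + blen k.+2 + blen (m k.+2) + ((effs [:: Iload k.+3 k.+2] m).2 +
      (t1 + (t2 + (t3 + (effs (nxt k) m3).2)))) <=
      200 + 100 * (B + U s) + Pb (U s + B).
      rewrite ma0 in le1.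
      have w1 : blen (ma k.+1) <= Q s + B by rewrite mak1; lia.
      have w3 : blen (ma k.+3) <= Pl s + B by rewrite mak3; lia.
      have w4 : blen (m1 k.+4) <= B by rewrite bk4 ma0.
      have w5 : blen (m1 k) <= s + B by rewrite m1k; lia.
      have uE : U s = s + Q s + Pl s + 2 by [].
      have := bk k.+2; lia.
    by [].
apply: (@fp_intro _ _ _ _ _ (nb + ni + nl + 5)
  (fun k => Cseq (mov k.+1 k) (Cseq (ci k.+1) (Cseq (mov k.+2 k)
     (Cseq (cl k.+2) (Cseq (loop k) (mov k k.+1))))))
  (fun n => Pi (n + HH n + 1) + Pl (n + HH n + 1) + (Pl n).+1 * CI (n + HH n + 1) + 100 * (n + HH n + Q n) + 100) Q).
- by poly.
- by [].
- move=> k lo m x k2 lk lom rx.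
  set s := dsz x.
  have bk j : j <= k.+2 -> blen j <= blen (m 0) by move=> ?; apply: blen_le; lia.
  have wx : blen (m k) <= s + blen (m 0) by exact: drep_word rx.
  set ma := (effs [:: Iconst 1 0; Iadd k.+1 k 1] m).1.
  have ma0 : ma 0 = m 0 by rewrite /ma /= !updE; regs.
  have mak : ma k = m k by rewrite /ma /= !updE; regs.
  have mak1 : ma k.+1 = m k by rewrite /ma /= !updE; regs; lia.
  have fra : frame k.+1 lo m ma.
    by split; rewrite ?ma0 // => j rj; rewrite /ma /= !updE; regs.
  have ta : (effs [:: Iconst 1 0; Iadd k.+1 k 1] m).2 <= 10 + 2 * blen (m 0) + blen (m k).
    rewrite /= !updE; regs; rewrite blen1 blen0.
    by have := bk k; have := bk k.+1; lia.
  have rx1 : drep ma lo (ma 0) (ma k.+1) x by rewrite mak1; exact: frame_rep fra rx.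
  have [|||m1 [t1 [e1 fr1 h1 r1 le1]]] := Ci k.+1 lo ma x _ _ _ rx1; [lia..|].
  have frm1 := frame_trans (leqnn _) fra fr1.
  have m1k : m1 k = m k by case: frm1 => H _ _; apply: H; lia.
  have lm1 : m 0 <= m1 0 by case: frm1.
  set mb := (effs [:: Iconst 1 0; Iadd k.+2 k 1] m1).1.
  have mb0 : mb 0 = m1 0 by rewrite /mb /= !updE; regs.
  have mbk2 : mb k.+2 = m k by rewrite /mb /= !updE; regs; lia.
  have frb : frame k.+2 lo m1 mb.
    by split; rewrite ?mb0 // => j rj; rewrite /mb /= !updE; regs.
  have tb : (effs [:: Iconst 1 0; Iadd k.+2 k 1] m1).2 <= 10 + 2 * blen (m 0) + blen (m k).
    rewrite /= !updE; regs; rewrite blen1 blen0 m1k.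
    by have := bk k; have := bk k.+2; lia.
  have frmb := frame_trans (leqnSn _) frm1 frb.
  have rx2 : drep mb lo (mb 0) (mb k.+2) x by rewrite mbk2; exact: frame_rep frmb rx.
  have [|||m2 [t2 [e2 fr2 h2 r2 le2]]] := Cl k.+2 lo mb x _ _ _ rx2; [lia..|].
  have frm2 := frame_trans (leqnSn _) frmb fr2.
  have lm2 : mb 0 <= m2 0 by case: fr2.
  have m2k : m2 k = m k by case: frm2 => H _ _; apply: H; lia.
  have r1' : drep m2 lo (m2 0) (m2 k.+1) (i x).
    have -> : m2 k.+1 = m1 k.+1.
      case: (frame_trans (leqnn _) frb fr2) => H _ _; apply: H; lia.
    exact: frame_rep (frame_trans (leqnn _) frb fr2) r1.
  have rx3 : drep m2 lo (m2 0) (m2 k) x by rewrite m2k; exact: frame_rep frm2 rx.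
  set B := blen (m 0) + HH s + 1.
  have sl : size (l x) <= Pl s by have := @size_dsz E DE (l x); have := Sl x; rewrite -/s; lia.
  have H1 : m1 0 <= m 0 + Pi s by rewrite -ma0.
  have H2 : m2 0 <= m 0 + Pi s + Pl s by rewrite mb0 -/s in h2; lia.
  have H3 : m2 0 + size (l x) * G s <= m 0 + HH s.
    rewrite /HH; have : size (l x) * G s <= Pl s * G s by rewrite leq_mul2r sl orbT.
    lia.
  have B3 : blen (m2 0 + size (l x) * G s) <= B.
    apply: leq_trans (blen_le H3) _; apply: leq_trans (blenD _ _) _.
    by rewrite /B -addnA leq_add2l addn1 blen_leS.
  have lk5 : k + (nb + 5) <= lo by lia.
  have lm2' : lo <= m2 0 by lia.
  have [m3 [t3 [e3 fr3 h3 r3 le3]]] :=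
    @loopP k lo x B (l x) k2 lk5 [::] m2 erefl lm2' rx3 r1' r2 B3.
  rewrite -/s in h3 le3.
  have lm3 : m2 0 <= m3 0 by case: fr3.
  set mc := (effs [:: Iconst 1 0; Iadd k k.+1 1] m3).1.
  have mc0 : mc 0 = m3 0 by rewrite /mc /= !updE; regs.
  have mck : mc k = m3 k.+1 by rewrite /mc /= !updE; regs; lia.
  have frc : frame k lo m3 mc.
    by split; rewrite ?mc0 // => j rj; rewrite /mc /= !updE; regs.
  have frm3 := frame_trans (leqnn _) (frame_le (leqnSn _) frm2) (frame_le (leqnSn _) fr3).
  exists mc; eexists; split.
  + apply: Eseq (exec_Cbs _ _ _) _ => //; apply: Eseq e1 _.
    apply: Eseq (exec_Cbs _ _ _) _ => //; apply: Eseq e2 _.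
    by apply: Eseq e3 _; apply: exec_Cbs.
  + by apply: frame_trans frc; last apply: frm3.
  + by rewrite mc0 -/s; lia.
  + by rewrite mck; apply: frame_rep frc r3.
  + set z := s + blen (m 0).
    have sz : s <= z by rewrite leq_addr.
    have HHz := mHH _ _ sz.
    have zE : z = s + blen (m 0) by [].
    have BE : B = blen (m 0) + HH s + 1 by [].
    clearbody z B.
    have Bz : B <= z + HH z + 1 by lia.
    have b3 : blen (m3 0) <= B by apply: leq_trans B3; apply: blen_le.
    have b1 : blen (m1 0) <= B by apply: leq_trans b3; apply: blen_le; lia.
    have tc : (effs [:: Iconst 1 0; Iadd k k.+1 1] m3).2 <= 10 + 3 * B + Q s.
      have w3 := drep_word r3.
      have q3 : dsz (foldl (b x) (i x) (l x)) <= Q s.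
        by have := bnd x (size (l x)); rewrite take_size.
      rewrite /= !updE; regs; rewrite blen1 blen0.
      by have := bk k; have := bk k.+1; lia.
    have le1' : t1 <= Pi (z + HH z + 1).
      by apply: leq_trans le1 _; apply: mPi; rewrite ma0 -/s; lia.
    have le2' : t2 <= Pl (z + HH z + 1).
      by apply: leq_trans le2 _; apply: mPl; rewrite mb0 -/s; lia.
    have le3' : t3 <= (Pl z).+1 * CI (z + HH z + 1).
      apply: leq_trans le3 _; apply: leq_mul; first by have := mPl _ _ sz; lia.
      set Z := z + HH z + 1 in Bz *.
      have sZ : s <= Z by rewrite /Z; lia.
      have uZ := mU _ _ sZ; rewrite /CI.
      have : Pb (U s + B) <= Pb (U Z + Z + HH Z + 1) by apply: mPb; lia.
      lia.
    have Qz := mQ _ _ sz.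
    lia.
- by move=> x; have := bnd x (size (l x)); rewrite take_size.
Qed.

(** * A clock of logarithmic length *)

Fixpoint halves_rec (f n : nat) (acc : seq nat) : seq nat :=
  if f is f'.+1 then
    if n == 0 then acc else halves_rec f' (n %/ 2) (n :: acc)
  else acc.

Definition halves (n : nat) : seq nat := halves_rec n n [::].

(** The exact number of halvings that lead to 0; it differs from [blen] at 0 only. *)
Definition nbit (n : nat) : nat := if n == 0 then 0 else blen n.

Lemma nbit_half n : 0 < n -> nbit n = (nbit (n %/ 2)).+1.
Proof.
move=> n0; rewrite /nbit /blen divn2.
case: (ltngtP n 1) => [|n1|->]; [lia| |by []].
by rewrite trunc_log2S // !ifF //; lia.
Qed.

Lemma halves_recP f n acc : n <= f ->
  size (halves_rec f n acc) = nbit n + size acc /\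
  (forall B, blen n <= B ->
    dsz (halves_rec f n acc) <= dsz acc + nbit n * B.+1).
Proof.
elim: f n acc => [|f IH] n acc le /=.
  have -> : n = 0 by lia.
  by split=> // B _; rewrite leq_addr.
case: eqP => [->|nz]; first by split=> // B _; rewrite leq_addr.
have n0 : 0 < n by lia.
have [|s d] := IH (n %/ 2) (n :: acc); first by rewrite divn2; lia.
rewrite nbit_half //; split; first by rewrite s /=; lia.
move=> B leB; have leB' : blen (n %/ 2) <= B.
  by apply: leq_trans leB; apply: blen_le; rewrite leq_div.
have := d B leB'; rewrite dsz_cons mulSn.
have -> : dsz n = blen n by []. lia.
Qed.

Lemma nbit_le n : nbit n <= blen n.
Proof. by rewrite /nbit; case: eqP => // _. Qed.

Lemma ltn_halves n : n < 2 ^ size (halves n).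
Proof.
rewrite /halves (halves_recP _ (leqnn n)).1 addn0 /nbit.
by case: eqP => [->|_] //; apply: ltn_blen.
Qed.

(** A fold needs a list as its clock. Here a list as long as the binary representation is made from
    a number, so the loop has to be programmed directly. *)
Lemma fp_halves0 : FP halves.
Proof.
pose nxt k := [:: Iconst 1 2; Idiv k k 1].
pose loop k := Cwhile k (Cseq (alloc k.+1 k k.+1) (Cbs (nxt k))).
have loopP k lo B f : 2 <= k -> k + 2 <= lo -> forall n acc m,
    n <= f -> lo <= m 0 -> m k = n -> blen n <= B ->
    drep m lo (m 0) (m k.+1) acc -> blen (m k.+1) <= B ->
    blen (m 0 + 2 * nbit n) <= B ->
  exists m' t, [/\ exec (loop k) m m' t, frame k lo m m',
    m' 0 <= m 0 + 2 * nbit n,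
    drep m' lo (m' 0) (m' k.+1) (halves_rec f n acc) /\ blen (m' k.+1) <= B
    & t <= (nbit n).+1 * (100 + 100 * B)].
  move=> k2 lk; elim: f => [|f IH] n acc m le lom mk bn ra ba bB.
    have z : n = 0 by lia.
    exists m, (1 + blen k + blen (m k)); split=> //.
    - by apply: Ewhile0; rewrite mk.
    - by rewrite leq_addr.
    - rewrite z /= addn0 in bB *; have := @blen_le k (m 0); rewrite mk; lia.
  have bH : blen (m 0) <= B by apply: leq_trans bB; apply: blen_le; lia.
  have bk j : j <= k.+1 -> blen j <= blen (m 0) by move=> ?; apply: blen_le; lia.
  rewrite /=; case: eqP => [z|nz].
    exists m, (1 + blen k + blen (m k)); split=> //.
    - by apply: Ewhile0; rewrite mk.
    - by rewrite leq_addr.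
    - by have := bk k; rewrite mk; lia.
  have n0 : 0 < n by lia.
  have [|||m1 [t1 [e1 [b0 bk1 bh bh1] ag1 le1]]] := @exec_alloc k.+1 k k.+1 m; [lia..|].
  have fr1 : frame k.+1 lo m m1.
    by split; [move=> j rj; apply: ag1; lia | move=> j rj; apply: ag1; lia | lia].
  have m1k : m1 k = n by rewrite -mk; apply: ag1; lia.
  have r1 : drep m1 lo (m1 0) (m1 k.+1) (n :: acc).
    rewrite bk1; split; rewrite ?bh ?bh1; try lia; first exact: mk.
    exact: frame_rep fr1 ra.
  set m2 := upd (effs (nxt k) m1).1 1 0.
  have m20 : m2 0 = m1 0 by rewrite /m2 /= !updE; regs.
  have m2k : m2 k = n %/ 2 by rewrite /m2 /= !updE; regs; rewrite m1k.
  have m2k1 : m2 k.+1 = m1 k.+1 by rewrite /m2 /= !updE; regs.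
  have fr2 : frame k lo m1 m2.
    by split; rewrite ?m20 // => j rj; rewrite /m2 /= !updE; regs.
  have frm2 := frame_trans (leqnn _) (frame_le (leqnSn _) fr1) fr2.
  have r2 : drep m2 lo (m2 0) (m2 k.+1) (n :: acc).
    by rewrite m2k1; apply: frame_rep fr2 r1.
  have nbE := nbit_half n0.
  have [|||||||m3 [t3 [e3 fr3 h3 [r3 w3] le3]]] := IH (n %/ 2) (n :: acc) m2.
  - by rewrite divn2; lia.
  - lia.
  - exact: m2k.
  - by apply: leq_trans bn; apply: blen_le; rewrite leq_div.
  - exact: r2.
  - by rewrite m2k1 bk1.
  - by apply: leq_trans bB; apply: blen_le; lia.
  exists m3; eexists; split.
  - apply: Ewhile1 e3; first by lia.
    by apply: Eseq e1 _; apply: exec_Cbs.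
  - exact: frame_trans frm2 fr3.
  - lia.
  - by [].
  - rewrite nbE [X in _ <= X]mulSn; apply: leq_add le3.
    have : (effs (nxt k) m1).2 <= 10 + 4 * B.
      rewrite /= !updE; regs; rewrite m1k.
      by have := bk k; have -> : blen 2 = 2 by []; rewrite blen1; lia.
    by have := bk k; rewrite mk in le1 *; lia.
pose P n := 1000 + 1000 * n + n.+1 * (100 + 100 * (10 * n + 10)).
apply: (@fp_intro _ _ _ _ _ 3
  (fun k => Cseq (Cbs [:: Iconst k.+1 0]) (Cseq (loop k) (Cbs [:: Iconst 1 0; Iadd k k.+1 1])))
  P (fun n => 1 + n * n.+1)).
- by rewrite /P; poly.
- by poly.
- move=> k lo m n k2 lk lom mk; rewrite /drep /= in mk.
  set ma := (effs [:: Iconst k.+1 0] m).1.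
  have ma0 : ma 0 = m 0 by rewrite /ma /= !updE; regs.
  have mak : ma k = n by rewrite /ma /= !updE; regs.
  have fra : frame k lo m ma.
    by split; rewrite ?ma0 // => j rj; rewrite /ma /= !updE; regs.
  have mak1 : ma k.+1 = 0 by rewrite /ma /= !updE; regs.
  set B := 3 * (blen n + blen (m 0)).
  have bB : blen (ma 0 + 2 * nbit n) <= B.
    apply: leq_trans (blenD _ _) _; rewrite ma0.
    have s1 := blenM 2 (nbit n); have s2 := blen_leS (nbit n).
    have s3 := nbit_le n; have s4 := blen_gt0 (m 0); have s5 : blen 2 = 2 by [].
    have s6 := blen_gt0 n; rewrite /B; lia.
  have l1 : k + 2 <= lo by lia.
  have l2 : lo <= ma 0 by lia.
  have bn : blen n <= B by rewrite /B; lia.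
  have bk1 : blen (ma k.+1) <= B by rewrite mak1 /B blen0; have := blen_gt0 n; lia.
  have ra : drep ma lo (ma 0) (ma k.+1) ([::] : seq nat) by rewrite mak1.
  have [m1 [t1 [e1 fr1 h1 [r1 w1] le1]]] := @loopP k lo B n k2 l1 n [::] ma (leqnn n) l2 mak bn ra bk1 bB.
  set mc := (effs [:: Iconst 1 0; Iadd k k.+1 1] m1).1.
  have mc0 : mc 0 = m1 0 by rewrite /mc /= !updE; regs.
  have mck : mc k = m1 k.+1 by rewrite /mc /= !updE; regs; lia.
  have frc : frame k lo m1 mc.
    by split; rewrite ?mc0 // => j rj; rewrite /mc /= !updE; regs.
  have dn : dsz n = blen n by [].
  have nbl := nbit_le n.
  exists mc; eexists; split.
  + apply: Eseq (exec_Cbs _ _ _) _ => //; apply: Eseq e1 _.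
    exact: exec_Cbs.
  + exact: frame_trans (leqnn _) fra (frame_trans (leqnn _) fr1 frc).
  + by rewrite mc0 dn /P; lia.
  + by rewrite mck; apply: frame_rep frc r1.
  + have t0 : (effs [:: Iconst k.+1 0] m).2 <= 5 + B.
      rewrite /=; have := @blen_le k.+1 (m 0); rewrite /B blen0; lia.
    have tc : (effs [:: Iconst 1 0; Iadd k k.+1 1] m1).2 <= 10 + 3 * B.
      rewrite /= !updE; regs; rewrite ?blen1 ?blen0.
      have := @blen_le k.+1 (m 0); have := @blen_le k (m 0); rewrite /B; rewrite /B in w1; lia.
    rewrite dn /P; set z := blen n + blen (m 0).
    have BE : B = 3 * z by [].
    have : (nbit n).+1 * (100 + 100 * B) <= z.+1 * (100 + 100 * (10 * z + 10)).
      by apply: leq_mul; rewrite /z; lia.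
    clearbody z B; lia.
- move=> n; have := (halves_recP [::] (leqnn n)).2 _ (leqnn (blen n)).
  have := nbit_le n; rewrite dsz_nil; have -> : dsz n = blen n by [].
  by rewrite -/(halves n); nia.
Qed.

(** * Closure properties *)

Section Apply.
Context {X A B C D E : Type} {DX : Data X} {DA : Data A} {DB : Data B}
  {DC : Data C} {DD : Data D} {DE : Data E}.

Lemma fp_app1 (F : A -> B) (f : X -> A) : FP F -> FP f -> FP (fun x => F (f x)).
Proof. by move=> hF hf; apply: fp_comp. Qed.

Lemma fp_app2 (F : A -> B -> C) (f : X -> A) (g : X -> B) :
  FP (fun p : A * B => F p.1 p.2) -> FP f -> FP g -> FP (fun x => F (f x) (g x)).
Proof.
move=> hF hf hg.
exact: (fp_comp (g := fun p : A * B => F p.1 p.2) (fp_pair hf hg)).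
Qed.

Lemma fp_app3 (F : A -> B -> C -> D) (f : X -> A) (g : X -> B) (h : X -> C) :
  FP (fun p : A * (B * C) => F p.1 p.2.1 p.2.2) -> FP f -> FP g -> FP h ->
  FP (fun x => F (f x) (g x) (h x)).
Proof.
move=> hF hf hg hh.
exact: (fp_comp (g := fun p : A * (B * C) => F p.1 p.2.1 p.2.2)
         (fp_pair hf (fp_pair hg hh))).
Qed.

Lemma fp_app4 (F : A -> B -> C -> D -> E) (f : X -> A) (g : X -> B) (h : X -> C)
    (k : X -> D) :
  FP (fun p : A * (B * (C * D)) => F p.1 p.2.1 p.2.2.1 p.2.2.2) ->
  FP f -> FP g -> FP h -> FP k -> FP (fun x => F (f x) (g x) (h x) (k x)).
Proof.
move=> hF hf hg hh hk.
exact: (fp_comp (g := fun p : A * (B * (C * D)) => F p.1 p.2.1 p.2.2.1 p.2.2.2)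
         (fp_pair hf (fp_pair hg (fp_pair hh hk)))).
Qed.

Lemma fp_app5 {G : Type} {DG : Data G} (F : A -> B -> C -> D -> E -> G) (f : X -> A)
    (g : X -> B) (h : X -> C) (k : X -> D) (l : X -> E) :
  FP (fun p : A * (B * (C * (D * E))) => F p.1 p.2.1 p.2.2.1 p.2.2.2.1 p.2.2.2.2) ->
  FP f -> FP g -> FP h -> FP k -> FP l ->
  FP (fun x => F (f x) (g x) (h x) (k x) (l x)).
Proof.
move=> hF hf hg hh hk hl.
exact: (fp_comp (g := fun p : A * (B * (C * (D * E))) =>
                        F p.1 p.2.1 p.2.2.1 p.2.2.2.1 p.2.2.2.2)
         (fp_pair hf (fp_pair hg (fp_pair hh (fp_pair hk hl))))).
Qed.
End Apply.

Create HintDb fpdb.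

Lemma fp_add0 : FP (fun p : nat * nat => p.1 + p.2).
Proof. by apply: (@fp_op addn Iadd) => // a b; apply: blenD. Qed.
Lemma fp_sub0 : FP (fun p : nat * nat => p.1 - p.2).
Proof.
apply: (@fp_op subn Isub) => // a b.
by apply: leq_trans (blen_le (leq_subr _ _)) _; apply: leq_addr.
Qed.
Lemma fp_mul0 : FP (fun p : nat * nat => p.1 * p.2).
Proof. by apply: (@fp_op muln Imul) => // a b; apply: blenM. Qed.
Lemma fp_div0 : FP (fun p : nat * nat => p.1 %/ p.2).
Proof.
apply: (@fp_op divn Idiv) => // a b.
by apply: leq_trans (blen_le (leq_div _ _)) _; apply: leq_addr.
Qed.

#[global] Hint Resolve fp_fst0 fp_snd0 fp_cons0 fp_add0 fp_sub0 fp_mul0 fp_div0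
  fp_halves0 : fpdb.

(** A hook of the tactic [fp], redefined once the closure properties for [map], [filter] and other
    constructs that bind a variable are available. *)
Ltac fp_special := fail.

Ltac fp := cbv beta;
  lazymatch goal with
  | |- FP (fun x => x) => exact fp_id
  | |- FP (fun _ => ?c) =>
      first [ exact (fp_cst0 c) | exact fp_nil0 | fp_gen ]
  | |- _ => fp_gen
  end
with fp_gen :=
  lazymatch goal with
  | |- FP (fun x => (@?f x, @?g x)) =>
      refine (fp_pair (f := f) (g := g) _ _); fp
  | _ => first
    [ fp_special
    | lazymatch goal with
      | |- FP (fun x => ?F (@?f x)) =>
        refine (fp_app1 (F := F) (f := f) _ _);
        [solve [auto with fpdb nocore] | fp]
      end
    | lazymatch goal with
      | |- FP (fun x => ?F (@?f x) (@?g x)) =>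
        refine (fp_app2 (F := F) (f := f) (g := g) _ _ _);
        [solve [auto with fpdb nocore] | fp | fp]
      end
    | lazymatch goal with
      | |- FP (fun x => ?F (@?f x) (@?g x) (@?h x)) =>
        refine (fp_app3 (F := F) (f := f) (g := g) (h := h) _ _ _ _);
        [solve [auto with fpdb nocore] | fp | fp | fp]
      end
    | lazymatch goal with
      | |- FP (fun x => ?F (@?f x) (@?g x) (@?h x) (@?k x)) =>
        refine (fp_app4 (F := F) (f := f) (g := g) (h := h) (k := k) _ _ _ _ _);
        [solve [auto with fpdb nocore] | fp | fp | fp | fp]
      end
    | lazymatch goal with
      | |- FP (fun x => ?F (@?f x) (@?g x) (@?h x) (@?k x) (@?l x)) =>
        refine (fp_app5 (F := F) (f := f) (g := g) (h := h) (k := k) (l := l) _ _ _ _ _ _);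
        [solve [auto with fpdb nocore] | fp | fp | fp | fp | fp]
      end
    | refine (fp_if _ _ _); fp
    | solve [auto with fpdb nocore]
    | idtac ]
  end.


Lemma fp_true {X} {DX : Data X} : FP (fun _ : X => true).
Proof. by apply: fp_ext (fp_comp (fp_cst0 0) fp_eq00) => x. Qed.
Lemma fp_false {X} {DX : Data X} : FP (fun _ : X => false).
Proof. by apply: fp_ext (fp_comp (fp_cst0 1) fp_eq00) => x. Qed.

Ltac fp_special ::=
  lazymatch goal with
  | |- FP (fun _ => true) => exact fp_true
  | |- FP (fun _ => false) => exact fp_false
  end.

#[global] Hint Resolve fp_eq00 : fpdb.

Lemma fp_negb0 : FP negb.
Proof.
apply: (@fp_ext _ _ _ _ (fun b : bool => if b then false else true)); first by case.
by fp.
Qed.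

Lemma fp_leq0 : FP (fun p : nat * nat => p.1 <= p.2).
Proof. exact: (fp_comp fp_sub0 fp_eq00). Qed.

#[global] Hint Resolve fp_leq0 fp_negb0 : fpdb.

Lemma fp_eqn0 : FP (fun p : nat * nat => p.1 == p.2).
Proof.
apply: (@fp_ext _ _ _ _ (fun p => if p.1 <= p.2 then p.2 <= p.1 else false)).
  by move=> p; rewrite eqn_leq; case: leqP.
by fp.
Qed.

#[global] Hint Resolve fp_eqn0 : fpdb.

Lemma fp_mod0 : FP (fun p : nat * nat => p.1 %% p.2).
Proof.
apply: (@fp_ext _ _ _ _ (fun p => p.1 - p.1 %/ p.2 * p.2)); last by fp.
by move=> p; rewrite {1}(divn_eq p.1 p.2) addKn.
Qed.

#[global] Hint Resolve fp_mod0 : fpdb.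

Lemma fp_min0 : FP (fun p : nat * nat => minn p.1 p.2).
Proof.
apply: (@fp_ext _ _ _ _ (fun p => if p.1 <= p.2 then p.1 else p.2)); last by fp.
by move=> p; case: (leqP p.1 p.2); lia.
Qed.

Lemma fp_max0 : FP (fun p : nat * nat => maxn p.1 p.2).
Proof.
apply: (@fp_ext _ _ _ _ (fun p => if p.1 <= p.2 then p.2 else p.1)); last by fp.
by move=> p; case: (leqP p.1 p.2); lia.
Qed.

#[global] Hint Resolve fp_min0 fp_max0 : fpdb.

Lemma fp_andb0 : FP (fun p : bool * bool => p.1 && p.2).
Proof. by apply: (@fp_ext _ _ _ _ (fun p => if p.1 then p.2 else false)) => //; fp. Qed.
Lemma fp_orb0 : FP (fun p : bool * bool => p.1 || p.2).
Proof. by apply: (@fp_ext _ _ _ _ (fun p => if p.1 then true else p.2)) => //; fp. Qed.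
Lemma fp_implb0 : FP (fun p : bool * bool => p.1 ==> p.2).
Proof. by apply: (@fp_ext _ _ _ _ (fun p => if p.1 then p.2 else true)) => //; fp. Qed.

#[global] Hint Resolve fp_andb0 fp_orb0 fp_implb0 : fpdb.

(** * Folds and list functions *)

Section Folds.
Context {X A E : Type} {DX : Data X} {DA : Data A} {DE : Data E}.

(** If each step adds an amount that does not depend on the accumulator, the total growth is at most
    the length of the list times a polynomial. *)
Lemma fp_foldl_add (b : X -> A -> E -> A) (i : X -> A) (l : X -> seq E) R0 :
  FP (fun p : X * (A * E) => b p.1 p.2.1 p.2.2) -> FP i -> FP l ->
  poly_bounded R0 ->
  (forall x acc e, dsz (b x acc e) <= dsz acc + R0 (dsz x + dsz e)) ->
  FP (fun x => foldl (b x) (i x) (l x)).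
Proof.
move=> hb hi hl /poly_mono[R [pR mR leR]] bnd.
have [_ [_ [Pi [pPi _ _ Si]]]] := fp_elim hi.
have [_ [_ [Pl [pPl mPl _ Sl]]]] := fp_elim hl.
apply: (@fp_foldl _ _ _ _ _ _ b i l (fun s => Pi s + Pl s * R (s + Pl s))) => //.
  by poly.
move=> x j; set s := dsz x.
have := Si x; rewrite -/s => si.
suff H l1 l2 : l1 ++ l2 = l x ->
    @dsz A DA (foldl (b x) (i x) l1) <= Pi s + size l1 * R (s + Pl s).
  have Hj := H (take j (l x)) (drop j (l x)) (cat_take_drop _ _).
  apply: (leq_trans Hj).
  rewrite leq_add2l leq_mul2r; apply/orP; right.
  have := @size_dsz E DE (l x); have := Sl x; rewrite -/s size_take_min; lia.
elim/last_ind: l1 l2 => [|l1 e IH] l2 lx; first by rewrite addn0.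
rewrite -cats1 foldl_cat size_cat addn1 /= mulSn.
apply: leq_trans (bnd _ _ _) _; rewrite cat_rcons in lx.
have := IH _ lx; have se := Sl x; rewrite -/s -lx in se.
have sm := @dsz_mem E DE l1 l2 e.
have : R0 (s + dsz e) <= R (s + Pl s) by apply: leq_trans (leR _) _; apply: mR; lia.
by rewrite /s; lia.
Qed.
End Folds.

Lemma fp_rev0 {E : Type} {DE : Data E} : FP (@rev E).
Proof.
apply: (@fp_ext _ _ _ _ (fun s : seq E => foldl (fun acc e => e :: acc) [::] s)).
  move=> s; rewrite -[RHS]cats0 -catrevE; by elim: s [::] => [|e s IH] acc //=.
apply: (fp_foldl_add (R0 := fun n => n + 1)); [by fp | by fp | by fp | by poly |].
by move=> x acc e; rewrite dsz_cons; lia.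
Qed.
#[global] Hint Resolve fp_rev0 : fpdb.

Section Lists.
Context {X A E : Type} {DX : Data X} {DA : Data A} {DE : Data E}.

Lemma fp_foldr_add (b : X -> E -> A -> A) (i : X -> A) (l : X -> seq E) R0 :
  FP (fun p : X * (E * A) => b p.1 p.2.1 p.2.2) -> FP i -> FP l ->
  poly_bounded R0 ->
  (forall x e acc, dsz (b x e acc) <= dsz acc + R0 (dsz x + dsz e)) ->
  FP (fun x => foldr (b x) (i x) (l x)).
Proof.
move=> hb hi hl pR bnd.
apply: (@fp_ext _ _ _ _ (fun x => foldl (fun acc e => b x e acc) (i x) (rev (l x)))).
  by move=> x; rewrite foldl_rev.
apply: (fp_foldl_add (R0 := R0)) => //; last by fp.
apply: (@fp_app1 _ _ _ _ _ _ (fun p : X * (E * A) => b p.1 p.2.1 p.2.2)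
          (fun p : X * (A * E) => (p.1, (p.2.2, p.2.1)))) => //.
by fp.
Qed.

End Lists.

Section Map.
Context {X A E : Type} {DX : Data X} {DA : Data A} {DE : Data E}.

Lemma fp_map (b : X -> E -> A) (l : X -> seq E) :
  FP (fun p : X * E => b p.1 p.2) -> FP l -> FP (fun x => map (b x) (l x)).
Proof.
move=> hb hl; have [_ [_ [P [pP mP _ Sb]]]] := fp_elim hb.
have hb' : FP (fun p : X * (E * seq A) => b p.1 p.2.1).
  by apply: (@fp_app2 _ _ _ _ _ _ _ _ b (fun p => p.1) (fun p => p.2.1)) => //; fp.
apply: (@fp_foldr_add _ _ _ _ _ _ (fun x e acc => b x e :: acc) (fun=> [::]) l
          (fun n => P n.+1 + 1)); [by fp | by fp | by [] | by poly |].
move=> x e acc; rewrite dsz_cons.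
by have := Sb (x, e); rewrite /= dsz_pair addn1; lia.
Qed.

Lemma fp_filter (b : X -> E -> bool) (l : X -> seq E) :
  FP (fun p : X * E => b p.1 p.2) -> FP l -> FP (fun x => filter (b x) (l x)).
Proof.
move=> hb hl.
have hb' : FP (fun p : X * (E * seq E) => b p.1 p.2.1).
  by apply: (@fp_app2 _ _ _ _ _ _ _ _ b (fun p => p.1) (fun p => p.2.1)) => //; fp.
apply: (@fp_foldr_add _ _ _ _ _ _ (fun x e acc => if b x e then e :: acc else acc)
   (fun=> [::]) l (fun n => n + 1)); [by fp | by fp | by [] | by poly |].
by move=> x e acc; case: ifP => _; rewrite ?dsz_cons; lia.
Qed.

Lemma fp_all (b : X -> E -> bool) (l : X -> seq E) :
  FP (fun p : X * E => b p.1 p.2) -> FP l -> FP (fun x => all (b x) (l x)).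
Proof.
move=> hb hl.
have hb' : FP (fun p : X * (E * bool) => b p.1 p.2.1).
  by apply: (@fp_app2 _ _ _ _ _ _ _ _ b (fun p => p.1) (fun p => p.2.1)) => //; fp.
apply: (@fp_foldr_add _ _ _ _ _ _ (fun x e acc => b x e && acc)
   (fun=> true) l (fun n => n)); [by fp | by fp | by [] | by poly |].
by move=> x e acc; rewrite leq_addr.
Qed.

Lemma fp_has (b : X -> E -> bool) (l : X -> seq E) :
  FP (fun p : X * E => b p.1 p.2) -> FP l -> FP (fun x => has (b x) (l x)).
Proof.
move=> hb hl.
have hb' : FP (fun p : X * (E * bool) => b p.1 p.2.1).
  by apply: (@fp_app2 _ _ _ _ _ _ _ _ b (fun p => p.1) (fun p => p.2.1)) => //; fp.
apply: (@fp_foldr_add _ _ _ _ _ _ (fun x e acc => b x e || acc)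
   (fun=> false) l (fun n => n)); [by fp | by fp | by [] | by poly |].
by move=> x e acc; rewrite leq_addr.
Qed.
End Map.

Lemma fp_mem {X : Type} {DX : Data X} (f : X -> nat) (g : X -> seq nat) :
  FP f -> FP g -> FP (fun x => f x \in g x).
Proof.
move=> hf hg; apply: (@fp_ext _ _ _ _ (fun x => has (fun y => y == f x) (g x))).
  by move=> x; rewrite has_pred1.
apply: (fp_has (b := fun x y => y == f x)) => //.
have hf' : FP (fun p : X * nat => f p.1) by apply: fp_app1 => //; fp.
by fp.
Qed.

Ltac fp_special ::=
  lazymatch goal with
  | |- FP (fun _ => true) => exact fp_true
  | |- FP (fun _ => false) => exact fp_false
  | |- FP (fun x => map (@?b x) (@?l x)) => refine (fp_map (b := b) (l := l) _ _); fp
  | |- FP (fun x => filter (@?b x) (@?l x)) =>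
      refine (fp_filter (b := b) (l := l) _ _); fp
  | |- FP (fun x => all (@?b x) (@?l x)) => refine (fp_all (b := b) (l := l) _ _); fp
  | |- FP (fun x => has (@?b x) (@?l x)) => refine (fp_has (b := b) (l := l) _ _); fp
  | |- FP (fun x => in_mem (@?f x) (mem (@?g x))) =>
      refine (fp_mem (f := f) (g := g) _ _); fp
  end.


Section ListFunctions.
Context {E : Type} {DE : Data E}.

Lemma fp_cat0 : FP (fun p : seq E * seq E => p.1 ++ p.2).
Proof.
apply: (@fp_ext _ _ _ _ (fun p : seq E * seq E => foldr (@cons E) p.2 p.1)).
  by move=> [s1 s2] /=; elim: s1 => //= e s ->.
apply: (fp_foldr_add (b := fun _ => @cons E) (R0 := fun n => n + 1)); [fp | fp | fp | by poly |].
by move=> x e acc; rewrite dsz_cons; lia.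
Qed.

Lemma dsz_take n (s : seq E) : dsz (take n s) <= dsz s.
Proof.
have := @dsz_cat E DE (take n s) (drop n s); rewrite cat_take_drop.
have h : 0 < dsz (drop n s) by exact: dsz_gt0.
lia.
Qed.

Lemma dsz_drop n (s : seq E) : dsz (drop n s) <= dsz s.
Proof.
have := @dsz_cat E DE (take n s) (drop n s); rewrite cat_take_drop.
have h : 0 < dsz (take n s) by exact: dsz_gt0.
lia.
Qed.

Lemma fp_take0 : FP (fun p : nat * seq E => take p.1 p.2).
Proof.
pose b (_ : nat * seq E) (st : nat * seq E) (e : E) :=
  if st.1 == 0 then st else (st.1 - 1, e :: st.2).
apply: (@fp_ext _ _ _ _ (fun p => rev (foldl (b p) (p.1, [::]) p.2).2)).
  move=> [n s] /=; rewrite -[RHS](revK (take n s)); congr rev.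
  rewrite -[RHS]cats0; elim: s n [::] => [|e s IH] n acc //=.
  rewrite /b /=; case: n => [|n] /=.
    by have := IH 0 acc; rewrite take0.
  by rewrite subn1 /= IH rev_cons cat_rcons.
have h : FP (fun p : nat * seq E => foldl (b p) (p.1, [::]) p.2); last by fp.
apply: (fp_foldl_add (b := b) (i := fun p => (p.1, [::])) (l := fun p => p.2)
  (R0 := fun n => n + 1)); [by rewrite /b; fp | by fp | by fp | by poly |].
move=> x [n acc] e; rewrite /b /=; case: ifP => _; rewrite !dsz_pair ?dsz_cons; first lia.
have : dsz (n - 1) <= dsz n by apply: blen_le; lia.
lia.
Qed.

Lemma fp_drop0 : FP (fun p : nat * seq E => drop p.1 p.2).
Proof.
pose b (_ : nat * seq E) (st : nat * seq E) (e : E) :=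
  if st.1 == 0 then (0, e :: st.2) else (st.1 - 1, st.2).
apply: (@fp_ext _ _ _ _ (fun p => rev (foldl (b p) (p.1, [::]) p.2).2)).
  move=> [n s] /=; rewrite -[RHS](revK (drop n s)); congr rev.
  rewrite -[RHS]cats0; elim: s n [::] => [|e s IH] n acc //=.
  rewrite /b /=; case: n => [|n] /=.
    by have := IH 0 (e :: acc); rewrite drop0 => ->; rewrite rev_cons cat_rcons.
  by rewrite subn1 /= IH.
have h : FP (fun p : nat * seq E => foldl (b p) (p.1, [::]) p.2); last by fp.
apply: (fp_foldl_add (b := b) (i := fun p => (p.1, [::])) (l := fun p => p.2)
  (R0 := fun n => n + 1)); [by rewrite /b; fp | by fp | by fp | by poly |].
move=> x [n acc] e; rewrite /b /=; case: eqP => [->|_]; rewrite !dsz_pair ?dsz_cons; first lia.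
have : dsz (n - 1) <= dsz n by apply: blen_le; lia.
lia.
Qed.

Lemma fp_behead0 : FP (@behead E).
Proof.
apply: (fp_ext (f := fun s => drop 1 s)); first by move=> s; rewrite drop1.
exact: (@fp_app2 _ _ _ _ _ _ _ _ (fun n (s : seq E) => drop n s) (fun=> 1) id fp_drop0 (fp_cst0 1) fp_id).
Qed.

Lemma fp_head0 : FP (fun p : E * seq E => head p.1 p.2).
Proof.
apply: (fp_ext (f := fun p => foldr (fun e _ => e) p.1 p.2)); first by case=> x [].
apply: (fp_foldr_add (b := fun _ e _ => e) (R0 := fun n => n)); [by fp | by fp | by fp | by poly |].
by move=> x e acc; lia.
Qed.
End ListFunctions.
#[global] Hint Resolve fp_cat0 fp_take0 fp_drop0 fp_behead0 fp_head0 : fpdb.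

Lemma fp_flatten0 {E : Type} {DE : Data E} : FP (@flatten E).
Proof.
apply: (fp_foldr_add (b := fun _ => @cat E) (i := fun=> [::]) (l := fun s => s) (R0 := fun n => n));
  [by fp | by fp | by fp | by poly |].
by move=> x e acc; have := @dsz_cat E DE e acc; lia.
Qed.

Definition add_new (x : nat) (s : seq nat) : seq nat :=
  if has (fun y : nat => y == x) s then s else x :: s.

Lemma fp_add_new : FP (fun p : nat * seq nat => add_new p.1 p.2).
Proof. by rewrite /add_new; fp. Qed.
#[global] Hint Resolve fp_add_new : fpdb.

Lemma fp_undup0 : FP (undup : seq nat -> seq nat).
Proof.
apply: (fp_ext (f := fun s : seq nat => foldr add_new [::] s)).
  by elim=> //= x s ->; rewrite /add_new has_pred1 mem_undup.
apply: (fp_foldr_add (b := fun _ => add_new) (R0 := fun n => n + 1));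
  [by fp | by fp | by fp | by poly |].
by move=> x e acc; rewrite /add_new; case: ifP => _; rewrite ?dsz_cons; lia.
Qed.

Definition prodn (s : seq nat) : nat := foldr muln 1 s.

Lemma fp_sumn0 : FP sumn.
Proof.
apply: (fp_foldr_add (b := fun _ => addn) (i := fun=> 0) (l := fun s => s) (R0 := fun n => n));
  [by fp | by fp | by fp | by poly |].
move=> x e acc; have : dsz (e + acc) <= dsz e + dsz acc by exact: blenD.
lia.
Qed.

Lemma fp_prodn0 : FP prodn.
Proof.
apply: (fp_foldr_add (b := fun _ => muln) (i := fun=> 1) (l := fun s => s) (R0 := fun n => n));
  [by fp | by fp | by fp | by poly |].
move=> x e acc; have : dsz (e * acc) <= dsz e + dsz acc by exact: blenM.
lia.
Qed.
#[global] Hint Resolve fp_flatten0 fp_undup0 fp_sumn0 fp_prodn0 : fpdb.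

(** For steps whose growth is not visibly additive: the size bound is drawn from an invariant that
    may mention the number of steps made. *)
Lemma fp_foldl_inv {X A E : Type} {DX : Data X} {DA : Data A} {DE : Data E}
    (b : X -> A -> E -> A) (i : X -> A) (l : X -> seq E)
    (Inv : X -> nat -> A -> Prop) Q :
  FP (fun p : X * (A * E) => b p.1 p.2.1 p.2.2) -> FP i -> FP l ->
  poly_bounded Q -> (forall x, Inv x 0 (i x)) ->
  (forall x j acc e, dsz e <= dsz (l x) -> Inv x j acc -> Inv x j.+1 (b x acc e)) ->
  (forall x j acc, j <= size (l x) -> Inv x j acc -> dsz acc <= Q (dsz x)) ->
  FP (fun x => foldl (b x) (i x) (l x)).
Proof.
move=> hb hi hl pQ i0 iS iQ; apply: (fp_foldl hb hi hl pQ) => x j.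
have H : forall l1 l2, l1 ++ l2 = l x ->
    Inv x (size l1) (foldl (b x) (i x) l1).
  elim/last_ind=> [|l1 e IH] l2 lx; first exact: i0.
  rewrite -cats1 foldl_cat size_cat addn1 /=; rewrite cat_rcons in lx.
  apply: iS; last exact: IH lx.
  by rewrite -lx; apply/ltnW/dsz_mem.
apply: (iQ _ (size (take j (l x)))).
  by rewrite size_take_min; lia.
exact: H (cat_take_drop j (l x)).
Qed.

Lemma fp_size0 {E : Type} {DE : Data E} : FP (@size E).
Proof.
apply: (@fp_ext _ _ _ _ (fun s : seq E => sumn (map (fun=> 1) s))); last by fp.
by elim=> //= e s ->.
Qed.

Lemma dsz_filter {E : Type} {DE : Data E} (p : pred E) s : dsz (filter p s) <= dsz s.
Proof. by elim: s => //= e s IH; case: ifP => _; rewrite !dsz_cons; lia. Qed.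

Lemma dsz_filterD {E : Type} {DE : Data E} (p : pred E) s :
  dsz (filter (fun e => ~~ p e) s) + dsz (filter p s) = (dsz s).+1.
Proof. by elim: s => //= e s IH; case: (p e); rewrite /= !dsz_cons; lia. Qed.

Lemma dsz_filterC {E : Type} {DE : Data E} (p : pred E) s :
  dsz (filter (fun e => ~~ p e) s ++ filter p s) = dsz s.
Proof.
have := @dsz_cat E DE (filter (fun e => ~~ p e) s) (filter p s).
by rewrite dsz_filterD; lia.
Qed.

#[global] Hint Resolve fp_size0 : fpdb.

(** * Greatest common divisors *)

Definition gcd_step (st : nat * nat) : nat * nat :=
  if st.2 == 0 then st else (st.2, st.1 %% st.2).

(** The binary length of [a * b] bounds the number of steps from an ordered pair; the padding of the
    clock covers the step that swaps the arguments when [a < b]. *)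
Definition euclid (a b : nat) : nat :=
  (foldl (fun st (_ : nat) => gcd_step st) (a, b) (halves (a * b) ++ [:: 0; 0])).1.

Lemma gcd_step_gcd st : gcdn (gcd_step st).1 (gcd_step st).2 = gcdn st.1 st.2.
Proof.
rewrite /gcd_step; case: eqP => //= _.
by rewrite gcdnC gcdn_modl.
Qed.

(* Each step at least halves the product of an ordered pair. *)
Lemma gcd_step_bound (l : seq nat) a b : b <= a -> a * b < 2 ^ size l ->
  (foldl (fun st (_ : nat) => gcd_step st) (a, b) l).2 = 0.
Proof.
elim: l a b => [|e l IH] a b le; first by rewrite expn0 /=; nia.
rewrite [size _]/= expnS /= => lt; rewrite {2}/gcd_step /=; case: eqP => [b0|/eqP b0].
  by rewrite b0; apply: IH => //; rewrite muln0 expn_gt0.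
have lb : 0 < b by rewrite lt0n.
apply: IH; first exact/ltnW/ltn_pmod.
have := divn_eq a b; have := ltn_pmod a lb.
have : 0 < a %/ b by rewrite divn_gt0.
nia.
Qed.

Lemma euclidE a b : euclid a b = gcdn a b.
Proof.
pose f := fun st (_ : nat) => gcd_step st.
have inv l st : gcdn (foldl f st l).1 (foldl f st l).2 = gcdn st.1 st.2.
  by elim: l st => //= e l IH st; rewrite IH gcd_step_gcd.
suff z : (foldl f (a, b) (halves (a * b) ++ [:: 0; 0])).2 = 0.
  by have := inv (halves (a * b) ++ [:: 0; 0]) (a, b); rewrite z gcdn0 /= => <-.
set l := halves _ ++ _.
have sl : size l = (size (halves (a * b))).+2 by rewrite size_cat /=; lia.
have hl := ltn_halves (a * b).
case: (leqP b a) => le.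
  by apply: gcd_step_bound => //; rewrite sl !expnS; lia.
have : 1 < size l by rewrite sl.
case: l sl => // e l /= sl _.
rewrite {2}/f /gcd_step /= ifF; last by lia.
rewrite modn_small //; apply: gcd_step_bound; first exact: ltnW.
by case: sl => ->; rewrite mulnC expnS; lia.
Qed.

Lemma fp_gcd0 : FP (fun p : nat * nat => gcdn p.1 p.2).
Proof.
apply: (@fp_ext _ _ _ _ (fun p => euclid p.1 p.2)); first by move=> p; rewrite euclidE.
rewrite /euclid.
have h : FP (fun p : nat * nat =>
  foldl (fun st (_ : nat) => gcd_step st) (p.1, p.2) (halves (p.1 * p.2) ++ [:: 0; 0]));
  last by fp.
apply: (fp_foldl_inv (b := fun _ st _ => gcd_step st)
  (Inv := fun p _ st => st.1 <= maxn p.1 p.2 /\ st.2 <= maxn p.1 p.2)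
  (Q := fun n => n + n + 1)).
- by rewrite /gcd_step; fp.
- by fp.
- by fp.
- by poly.
- by move=> p /=; split; rewrite ?leq_maxl ?leq_maxr.
- move=> p j [u v] e _ [/= hu hv]; rewrite /gcd_step /=; case: eqP => //= _; split=> //.
  exact: leq_trans (leq_mod _ _) hu.
- move=> [a b] j [u v] _ [/= hu hv]; rewrite !dsz_pair.
  have bm : blen (maxn a b) <= dsz a + dsz b.
    by case: (leqP a b) => _; [exact: leq_addl | exact: leq_addr].
  have h1 : dsz u <= dsz a + dsz b by exact: leq_trans (blen_le hu) bm.
  have h2 : dsz v <= dsz a + dsz b by exact: leq_trans (blen_le hv) bm.
  lia.
Qed.
#[global] Hint Resolve fp_gcd0 : fpdb.

(** * Decoding the input *)

(** The state consists of a flag (1 if the next bit is a digit, 0 if it is a continuation mark), the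
    weight of the next digit, the value read so far, and the finished numbers in reverse order. *)
Definition tok_step (st : nat * (nat * (nat * seq nat))) (b : nat) :
    nat * (nat * (nat * seq nat)) :=
  if st.1 == 0 then
    if b == 0 then (0, (1, (0, st.2.2.1 :: st.2.2.2))) else (1, st.2)
  else (0, (2 * st.2.1,
         ((if b == 0 then st.2.2.1 else st.2.2.1 + st.2.1), st.2.2.2))).

Definition tokens (s : seq nat) : seq nat :=
  rev (foldl tok_step (0, (1, (0, [::]))) s).2.2.2.

Lemma fp_tokens0 : FP tokens.
Proof.
rewrite /tokens.
have h : FP (fun s : seq nat => foldl tok_step (0, (1, (0, [::]))) s); last by fp.
apply: (fp_foldl_inv (b := fun _ => tok_step)
  (Inv := fun _ j st => [/\ st.1 <= 1, st.2.2.1 < st.2.1, st.2.1 <= 2 ^ j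
                          & dsz st.2.2.2 <= 1 + j * (j + 2)])
  (Q := fun n => 10 + 10 * n + n * (n + 2))).
- by rewrite /tok_step; fp.
- by fp.
- by fp.
- by poly.
- by [].
- move=> s j [md [pw [v out]]] e _ [/= h1 h2 h3 h4]; rewrite /tok_step /=.
  have vb : blen v <= j.+1 by have := @blen_ltn v j; lia.
  have p0 := expn_gt0 2 j.
  case: eqP => _; case: eqP => _; rewrite /= ?dsz_cons ?expnS; split; try lia.
  by have -> : dsz v = blen v by []; lia.
- move=> s j [md [pw [v out]]] js [/= h1 h2 h3 h4]; rewrite !dsz_pair.
  have ss := @size_dsz nat Data_nat s.
  have s1 : dsz md <= 1 by apply: (@blen_le md 1).
  have s2 : dsz pw <= j.+2.
    have : pw < 2 ^ j.+1 by rewrite expnS; have := expn_gt0 2 j; lia.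
    by move/blen_ltn; rewrite /dsz /=; lia.
  have s3 : dsz v <= dsz pw by apply: blen_le; lia.
  have : j * (j + 2) <= dsz s * (dsz s + 2) by apply: leq_mul; lia.
  lia.
Qed.
#[global] Hint Resolve fp_tokens0 : fpdb.

(** [p_list] iterates a parser on its own remainder, so the remainder must not grow at all: a
    polynomial bound would not survive the iteration. *)
Definition parser_ok {A : Type} {DA : Data A} (p : seq nat -> A * seq nat) : Prop :=
  FP p /\ forall ts, dsz (p ts).2 <= dsz ts.

Definition p_seq (ts : seq nat) : seq nat * seq nat :=
  (take (head 0 ts) (behead ts), drop (head 0 ts) (behead ts)).

Definition p_frac (ts : seq nat) : (nat * nat) * seq nat :=
  ((head 0 ts, head 0 (behead ts)), behead (behead ts)).

Definition p_bind {A B : Type} (p : seq nat -> A * seq nat)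
    (q : seq nat -> B * seq nat) (ts : seq nat) : (A * B) * seq nat :=
  (((p ts).1, (q (p ts).2).1), (q (p ts).2).2).

Definition p_list_step {A : Type} (p : seq nat -> A * seq nat)
    (st : nat * (seq nat * seq A)) : nat * (seq nat * seq A) :=
  if st.1 == 0 then st
  else (st.1 - 1, ((p st.2.1).2, (p st.2.1).1 :: st.2.2)).

(* The token list itself serves as the clock of the loop. *)
Definition p_list_loop {A : Type} (p : seq nat -> A * seq nat) (ts : seq nat) :
    nat * (seq nat * seq A) :=
  foldl (fun st (_ : nat) => p_list_step p st) (head 0 ts, (behead ts, [::])) ts.

Definition p_list {A : Type} (p : seq nat -> A * seq nat) (ts : seq nat) :
    seq A * seq nat :=
  (rev (p_list_loop p ts).2.2, (p_list_loop p ts).2.1).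

Lemma dsz_behead {E : Type} {DE : Data E} (s : seq E) : dsz (behead s) <= dsz s.
Proof. by rewrite -drop1 dsz_drop. Qed.

Lemma parser_seq : parser_ok p_seq.
Proof.
split; first by rewrite /p_seq; fp.
by move=> ts; apply: leq_trans (dsz_drop _ _) (dsz_behead _).
Qed.

Lemma parser_frac : parser_ok p_frac.
Proof.
split; first by rewrite /p_frac; fp.
by move=> ts; apply: leq_trans (dsz_behead _) (dsz_behead _).
Qed.

Section Parsers.
Context {A B : Type} {DA : Data A} {DB : Data B}.

Lemma parser_bind (p : seq nat -> A * seq nat) (q : seq nat -> B * seq nat) :
  parser_ok p -> parser_ok q -> parser_ok (p_bind p q).
Proof.
move=> [hp sp] [hq sq]; split; first by rewrite /p_bind; fp.
by move=> ts; apply: leq_trans (sq _) (sp _).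
Qed.

Lemma parser_list (p : seq nat -> A * seq nat) : parser_ok p -> parser_ok (p_list p).
Proof.
move=> [hp sp]; have [_ [_ [P [pP mP _ Sp]]]] := fp_elim hp.
have stepE st : (p_list_step p st).1 <= st.1.
  by rewrite /p_list_step; case: ifP => _ //=; lia.
split; last first.
  move=> ts; rewrite /p_list /=; apply: leq_trans (dsz_behead ts); rewrite /p_list_loop.
  have H : forall (l : seq nat) st,
    dsz (foldl (fun st (_ : nat) => p_list_step p st) st l).2.1 <= dsz st.2.1.
    elim=> // e l IH st /=; apply: leq_trans (IH _) _; rewrite /p_list_step.
    by case: ifP => _ /=; [exact: leqnn | exact: sp].
  exact: H.
have h : FP (p_list_loop p); last by rewrite /p_list; fp.
rewrite /p_list_loop.
apply: (fp_foldl_inv (b := fun _ st _ => p_list_step p st)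
  (Inv := fun ts j st => [/\ st.1 <= head 0 ts, dsz st.2.1 <= dsz ts
                           & dsz st.2.2 <= 1 + j * (P (dsz ts) + 1)])
  (Q := fun n => 10 + 3 * n + n * (P n + 1))).
- by rewrite /p_list_step; fp.
- by fp.
- by fp.
- by poly.
- by move=> ts; split=> //=; exact: dsz_behead.
- move=> ts j [n [r out]] e _ [/= h1 h2 h3]; rewrite /p_list_step /=.
  case: ifP => _ /=; first by split=> //; lia.
  split; first lia; first exact: leq_trans (sp _) h2.
  rewrite dsz_cons mulSn.
  have s1 := Sp r; have s2 := mP _ _ h2.
  have s3 : dsz (p r).1 <= dsz (p r) by rewrite [X in _ <= X]/dsz /=; lia.
  lia.
- move=> ts j [n [r out]] js [/= h1 h2 h3]; rewrite !dsz_pair.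
  have ss := @size_dsz nat Data_nat ts.
  have s1 : dsz n <= dsz ts.
    apply: leq_trans (blen_le h1) _; case: (ts) => [|t ts'] //=.
    by rewrite dsz_cons [X in _ <= X + _ + _]/dsz /=; lia.
  have : j * (P (dsz ts) + 1) <= dsz ts * (P (dsz ts) + 1) by apply: leq_mul; lia.
  lia.
Qed.
End Parsers.

Definition p_constraint := p_bind (p_bind p_seq (p_list (p_bind p_seq p_frac))) p_frac.
Definition p_input := p_bind p_seq (p_list p_constraint).

Lemma fp_input0 : FP p_input.
Proof.
have pe := parser_bind parser_seq parser_frac.
have pc := parser_bind (parser_bind parser_seq (parser_list pe)) parser_frac.
by have [] := parser_bind parser_seq (parser_list pc).
Qed.
#[global] Hint Resolve fp_input0 : fpdb.

(** * Correctness of the parsers *)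

Section ParserSpec.
Definition parses {A : Type} (p : seq nat -> A * seq nat) (x : A) (s : seq nat) : Prop :=
  forall r, p (s ++ r) = (x, r).

Lemma parses_seq s : parses p_seq s (size s :: s).
Proof. by move=> r; rewrite /p_seq /= take_size_cat // drop_size_cat. Qed.

Lemma parses_frac f : parses p_frac f [:: f.1; f.2].
Proof. by case: f => a b r. Qed.

Lemma parses_bind {A B : Type} (p : seq nat -> A * seq nat) (q : seq nat -> B * seq nat)
    x y s t : parses p x s -> parses q y t -> parses (p_bind p q) (x, y) (s ++ t).
Proof. by move=> hp hq r; rewrite /p_bind -catA hp /= hq. Qed.

(** Nonempty codes guarantee that the token list, which is the clock, is at least as long as the
    list to be read. *)
Lemma parses_list {A : Type} (p : seq nat -> A * seq nat) (enc : A -> seq nat) l :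
  (forall x, 0 < size (enc x)) -> (forall x, parses p x (enc x)) ->
  parses (p_list p) l (size l :: flatten (map enc l)).
Proof.
move=> enc0 hp r; rewrite /p_list /p_list_loop cat_cons [head _ _]/= [behead _]/=.
pose f := fun st (_ : nat) => p_list_step p st.
have H : forall l acc (c : seq nat), size l <= size c ->
  foldl f (size l, (flatten (map enc l) ++ r, acc)) c = (0, (r, catrev l acc)).
  elim=> [|x l' IH] acc c /=; first by move=> _; elim: c.
  case: c => // e c /= le; rewrite {2}/f /p_list_step /= subn1 -catA hp /=.
  by rewrite IH.
rewrite -/f H /=; first by rewrite catrevE cats0 revK.
rewrite size_cat; apply: leq_trans (leqnSn _); apply: leq_trans (leq_addr _ _).
by elim: (l) => //= x l' IH; rewrite size_cat; have := enc0 x; lia.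
Qed.
End ParserSpec.

(** * The algorithm *)

(* A fraction [(n, k)] stands for n/k. In a parsed constraint the support lists
   tuples of values, in a table it lists assignments as (variable, value) pairs. *)
Notation fraction := (nat * nat)%type.
Notation parsed := (seq nat * seq (seq nat * fraction) * fraction)%type.
Notation table := (seq nat * seq (seq (nat * nat) * fraction) * fraction)%type.

(** Deletion is performed on the original edges, all at once. Edges that become empty are kept;
    containing no vertex, they do not matter for nest points. *)
Definition candidates (E : seq (seq nat)) (out : seq nat) : seq nat :=
  filter (fun x => ~~ (x \in out) &&
            nest_point (map (filter (fun v => ~~ (v \in out))) E) x) (hvertices E).

Definition elim_order (E : seq (seq nat)) : seq nat :=
  foldl (fun out (_ : nat) => out ++ take 1 (candidates E out)) [::] (hvertices E).

(** A stable partition. Tables without [x] come first, so that of two nested variable sets the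
    smaller one precedes. *)
Definition radix_step (J : seq table) (x : nat) : seq table :=
  filter (fun c : table => ~~ (x \in c.1.1)) J ++ filter (fun c : table => x \in c.1.1) J.

Definition radix (J : seq table) (xs : seq nat) : seq table := foldl radix_step J xs.

Definition lookup (a : seq (nat * nat)) (y : nat) : nat :=
  foldr (fun p r => if y == p.1 then p.2 else r) 0 a.

Definition matches (e : seq (nat * nat)) (s : nat -> nat) : bool :=
  all (fun p : nat * nat => s p.1 == p.2) e.

Definition teval (c : table) (s : nat -> nat) : fraction :=
  foldr (fun (e : seq (nat * nat) * fraction) (r : fraction) =>
           if matches e.1 s then e.2 else r) c.2 c.1.2.

Definition frac_prod (l : seq fraction) : fraction :=
  (prodn (map fst l), prodn (map snd l)).

(** The product of all denominators is short enough to serve as common denominator; lowest terms are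
    restored in [frac_ratio]. *)
Definition frac_sum (l : seq fraction) : fraction :=
  (sumn (map (fun f : fraction => f.1 * (prodn (map snd l) %/ f.2)) l),
   prodn (map snd l)).

Definition chain_sum (D : seq nat) (x : nat) (chain : seq table)
    (a : seq (nat * nat)) : fraction :=
  frac_sum (map (fun b => frac_prod (map (fun c => teval c (lookup ((x, b) :: a))) chain)) D).

(** Bounds the size and ensures positivity whatever the input is. Where correctness is claimed, the
    reduced terms lie between 1 and [M] already ([frac_ratioE]). *)
Definition clamp (M n : nat) : nat := maxn 1 (minn M n).

Definition frac_ratio (M : nat) (f g : fraction) : fraction :=
  (clamp M ((f.1 * g.2) %/ gcdn (f.1 * g.2) (f.2 * g.1)),
   clamp M ((f.2 * g.1) %/ gcdn (f.1 * g.2) (f.2 * g.1))).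

Definition drop_var (x : nat) (a : seq (nat * nat)) : seq (nat * nat) :=
  filter (fun p : nat * nat => ~~ (p.1 == x)) a.

(** Entries that differ only at [x] become duplicates. They receive the same weight, so they may
    stay, and the number of entries remains constant. *)
Definition elim_table (D : seq nat) (M x : nat) (chain : seq table) (c : table) : table :=
  (filter (fun v => ~~ (v == x)) c.1.1,
   map (fun e : seq (nat * nat) * fraction =>
          (drop_var x e.1,
           frac_ratio M (chain_sum D x (chain ++ [:: c]) (drop_var x e.1))
                   (chain_sum D x chain (drop_var x e.1)))) c.1.2,
   c.2).

Definition elim_step (D : seq nat) (M x : nat) (pre : seq table) (c : table) : table :=
  if x \in c.1.1 then
    elim_table D M x (filter (fun c' : table => x \in c'.1.1) pre) c
  else c.

(** Each element is paired with the prefix before it, so that in [elim_var] all new tables are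
    computed from the old ones. *)
Definition splits {T : Type} (s : seq T) : seq (seq T * T) :=
  (foldl (fun (st : seq T * seq (seq T * T)) e =>
            (st.1 ++ [:: e], st.2 ++ [:: (st.1, e)])) ([::], [::]) s).2.

Definition elim_var (D : seq nat) (M : nat) (J : seq table) (x : nat) : seq table :=
  map (fun p : seq table * table => elim_step D M x p.1 p.2) (splits J).

Definition elim_all (D : seq nat) (M : nat) (J : seq table) (xs : seq nat) : seq table :=
  foldl (elim_var D M) J xs.

Definition zipn (s t : seq nat) : seq (nat * nat) :=
  (foldl (fun (st : seq nat * seq (nat * nat)) v =>
            (behead st.1, st.2 ++ map (fun y => (y, v)) (take 1 st.1))) (s, [::]) t).2.

Definition parsed_fracs (c : parsed) : seq fraction :=
  c.2 :: map (fun e : seq nat * fraction => e.2) c.1.2.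

Definition fracs (I : seq parsed) : seq fraction := flatten (map parsed_fracs I).

Definition delta (I : seq parsed) : nat := prodn (map snd (fracs I)).

(** Exceeds every weight scaled by the common denominator [delta I]. *)
Definition vmax (I : seq parsed) : nat := 1 + delta I * sumn (map fst (fracs I)).

(** The exponent is given in unary, as the length of a list: with a binary exponent the power would
    not be of polynomial size. *)
Definition powl {T : Type} (b : nat) (s : seq T) : nat := prodn (map (fun=> b) s).

(** Larger than the sum over all assignments of the products of the N + 1, for scaled weights N, as
    [round_sum] demands. *)
Definition base (D xs : seq nat) (I : seq parsed) : nat :=
  powl (size D) xs * powl (vmax I) I + 1.

(** The perturbed weights are at most [vmax I * base D xs I], so this bounds every partial partition
    function. *)
Definition bound (D xs : seq nat) (I : seq parsed) : nat :=
  powl (size D) xs * powl (vmax I * base D xs I) I + 1.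

Definition weight (dl b : nat) (f : fraction) : fraction :=
  (f.1 * (dl %/ f.2) * b + 1, 1).

Definition table_of (dl b : nat) (c : parsed) : table :=
  (c.1.1,
   map (fun e : seq nat * fraction => (zipn c.1.1 e.1, weight dl b e.2)) c.1.2,
   weight dl b c.2).

Definition tables (D xs : seq nat) (I : seq parsed) : seq table :=
  map (table_of (delta I) (base D xs I)) I.

Definition final_tables (D xs : seq nat) (I : seq parsed) : seq table :=
  elim_all D (bound D xs I) (radix (tables D xs I) xs) xs.

Definition final_value (J : seq table) : fraction :=
  frac_prod (map (fun c => teval c (lookup [::])) J).

(** The power of [size D] restores the factor lost in each elimination, the truncated division by
    the power of [base] removes the perturbation, and the power of [delta] undoes the scaling. *)
Definition readout (D xs : seq nat) (I : seq parsed) (f : fraction) : fraction :=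
  ((f.1 * powl (size D) xs) %/ (f.2 * powl (base D xs I) I), powl (delta I) I).

Definition solve_ordered (D xs : seq nat) (I : seq parsed) : fraction :=
  readout D xs I (final_value (final_tables D xs I)).

Definition solve (D : seq nat) (I : seq parsed) : fraction :=
  solve_ordered D (elim_order (map (fun c : parsed => c.1.1) I)) I.

Definition algorithm (bits : seq nat) : fraction :=
  solve (p_input (tokens bits)).1.1 (p_input (tokens bits)).1.2.

(** * Running time of the algorithm *)

Lemma fp_candidates : FP (fun p : seq (seq nat) * seq nat => candidates p.1 p.2).
Proof. by rewrite /candidates /hvertices /nest_point /subedge; fp. Qed.
Lemma fp_hvertices : FP hvertices.
Proof. by rewrite /hvertices; fp. Qed.
#[global] Hint Resolve fp_candidates fp_hvertices : fpdb.

Lemma fp_elim_order : FP elim_order.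
Proof.
have [_ [_ [P [pP mP _ Sp]]]] := fp_elim fp_hvertices.
apply: (fp_foldl_add (b := fun E out (_ : nat) => out ++ take 1 (candidates E out))
  (i := fun=> [::]) (l := hvertices) (R0 := fun n => P n)); [by fp | by fp | by fp | by poly |].
move=> E out e.
have s1 := @dsz_cat nat Data_nat out (take 1 (candidates E out)).
have s2 := @dsz_take nat Data_nat 1 (candidates E out).
have s3 : dsz (candidates E out) <= dsz (hvertices E) by exact: dsz_filter.
have s4 : P (dsz E) <= P (dsz E + dsz e) by apply: mP; lia.
have := Sp E; lia.
Qed.
#[global] Hint Resolve fp_elim_order : fpdb.

Lemma fp_radix : FP (fun p : seq table * seq nat => radix p.1 p.2).
Proof.
apply: (fp_foldl_add (b := fun _ => radix_step) (R0 := fun=> 0)); [|by fp|by fp|by poly|].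
  by rewrite /radix_step; fp.
by move=> p J x; rewrite /radix_step dsz_filterC; lia.
Qed.

Lemma fp_lookup : FP (fun p : seq (nat * nat) * nat => lookup p.1 p.2).
Proof.
apply: (fp_foldr_add (b := fun (x : seq (nat * nat) * nat) (p : nat * nat) (r : nat) =>
   if x.2 == p.1 then p.2 else r) (R0 := fun n => n)); [by fp | by fp | by fp | by poly |].
by move=> x p r; case: ifP => _; [rewrite [dsz p]/dsz /= | ]; lia.
Qed.
#[global] Hint Resolve fp_radix fp_lookup : fpdb.

Lemma fp_teval : FP (fun p : table * seq (nat * nat) => teval p.1 (lookup p.2)).
Proof.
apply: (fp_foldr_add (b := fun (x : table * seq (nat * nat))
   (e : seq (nat * nat) * fraction) (r : fraction) =>
     if matches e.1 (lookup x.2) then e.2 else r) (R0 := fun n => n));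
  [by rewrite /matches; fp | by fp | by fp | by poly |].
by move=> x p r; case: ifP => _; [rewrite [dsz p]/dsz /= | ]; lia.
Qed.

Lemma fp_teval_app {X : Type} {DX : Data X} (f : X -> table) (g : X -> seq (nat * nat)) :
  FP f -> FP g -> FP (fun x => teval (f x) (lookup (g x))).
Proof.
exact: (@fp_app2 _ _ _ _ _ _ _ _ (fun c a => teval c (lookup a)) f g fp_teval).
Qed.

Ltac fp_teval :=
  lazymatch goal with
  | |- FP (fun x => teval (@?f x) (lookup (@?g x))) =>
      refine (fp_teval_app (f := f) (g := g) _ _); fp
  end.

Lemma fp_frac_prod : FP frac_prod.
Proof. by rewrite /frac_prod; fp. Qed.
Lemma fp_frac_sum : FP frac_sum.
Proof. by rewrite /frac_sum; fp. Qed.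
#[global] Hint Resolve fp_frac_prod fp_frac_sum : fpdb.

Lemma fp_chain_sum : FP (fun p : seq nat * (nat * (seq table * seq (nat * nat))) =>
  chain_sum p.1 p.2.1 p.2.2.1 p.2.2.2).
Proof. by rewrite /chain_sum; fp; fp_teval. Qed.
Lemma fp_clamp : FP (fun p : nat * nat => clamp p.1 p.2).
Proof. by rewrite /clamp; fp. Qed.
#[global] Hint Resolve fp_chain_sum fp_clamp : fpdb.

Lemma fp_frac_ratio : FP (fun p : nat * (fraction * fraction) => frac_ratio p.1 p.2.1 p.2.2).
Proof. by rewrite /frac_ratio; fp. Qed.
Lemma fp_drop_var : FP (fun p : nat * seq (nat * nat) => drop_var p.1 p.2).
Proof. by rewrite /drop_var; fp. Qed.
#[global] Hint Resolve fp_frac_ratio fp_drop_var : fpdb.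

Lemma fp_elim_table : FP (fun p : seq nat * (nat * (nat * (seq table * table))) =>
  elim_table p.1 p.2.1 p.2.2.1 p.2.2.2.1 p.2.2.2.2).
Proof. by rewrite /elim_table; fp. Qed.
#[global] Hint Resolve fp_elim_table : fpdb.

Lemma fp_elim_step : FP (fun p : seq nat * (nat * (nat * (seq table * table))) =>
  elim_step p.1 p.2.1 p.2.2.1 p.2.2.2.1 p.2.2.2.2).
Proof. by rewrite /elim_step; fp. Qed.
#[global] Hint Resolve fp_elim_step : fpdb.

Lemma foldl_splits {T : Type} (s : seq T) :
  foldl (fun (st : seq T * seq (seq T * T)) e =>
           (st.1 ++ [:: e], st.2 ++ [:: (st.1, e)])) ([::], [::]) s = (s, splits s).
Proof.
rewrite /splits; elim/last_ind: s => // s e.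
by rewrite -cats1 foldl_cat /= => ->.
Qed.

Lemma splits_rcons {T : Type} (s : seq T) e :
  splits (rcons s e) = rcons (splits s) (s, e).
Proof. by rewrite {1}/splits -cats1 foldl_cat foldl_splits /= cats1. Qed.

Lemma map_snd_splits {T : Type} (s : seq T) : map snd (splits s) = s.
Proof. by elim/last_ind: s => // s e IH; rewrite splits_rcons map_rcons IH. Qed.

Lemma fp_splits {E : Type} {DE : Data E} : FP (@splits E).
Proof.
rewrite /splits.
have h : FP (fun s : seq E => foldl (fun (st : seq E * seq (seq E * E)) e =>
   (st.1 ++ [:: e], st.2 ++ [:: (st.1, e)])) ([::], [::]) s); last by fp.
apply: (fp_foldl_inv (b := fun _ (st : seq E * seq (seq E * E)) e =>
   (st.1 ++ [:: e], st.2 ++ [:: (st.1, e)]))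
   (Inv := fun s j st => dsz st.1 <= 1 + j * (dsz s + 1) /\
      dsz st.2 <= 1 + j * (3 + dsz s + j * (dsz s + 1)))
   (Q := fun n => 10 + n * (n + 1) + n * (3 + n + n * (n + 1)))).
- by fp.
- by fp.
- by fp.
- by poly.
- by [].
- move=> s j [u v] e de [/= h1 h2].
  have h3 : (dsz (u ++ [:: e])).+1 = dsz u + dsz [:: e] by exact: dsz_cat.
  have h4 : (dsz (v ++ [:: (u, e)])).+1 = dsz v + dsz [:: (u, e)] by exact: dsz_cat.
  rewrite !dsz_cons !dsz_nil dsz_pair in h3 h4.
  by split; nia.
- move=> s j [u v] js [/= h1 h2]; rewrite dsz_pair.
  have ss := @size_dsz E DE s.
  have m1 : j * (dsz s + 1) <= dsz s * (dsz s + 1) by apply: leq_mul; lia.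
  have : j * (3 + dsz s + j * (dsz s + 1)) <=
     dsz s * (3 + dsz s + dsz s * (dsz s + 1)) by apply: leq_mul; lia.
  lia.
Qed.
#[global] Hint Resolve fp_splits : fpdb.

Lemma fp_elim_var : FP (fun p : seq nat * (nat * (seq table * nat)) =>
  elim_var p.1 p.2.1 p.2.2.1 p.2.2.2).
Proof. by rewrite /elim_var; fp. Qed.
#[global] Hint Resolve fp_elim_var : fpdb.

(* An upper bound for the size of a table whose weights have size at most [C];
   unlike the size, it does not grow under variable elimination. *)
Definition tsz (C : nat) (c : table) : nat :=
  dsz c.1.1 + sumn (map (fun e : seq (nat * nat) * fraction => dsz e.1 + C + 2) c.1.2)
  + C + 3.

Definition light (C : nat) (c : table) : bool :=
  (dsz c.2 <= C) &&
  all (fun e : seq (nat * nat) * fraction => dsz e.2 <= C) c.1.2.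

Lemma dsz_le_tsz C c : light C c -> dsz c <= tsz C c.
Proof.
case: c => [[v s] w] /andP[/= hw hs]; rewrite /tsz /= !dsz_pair.
have H : dsz s <= 1 + sumn (map (fun e : seq (nat * nat) * fraction => dsz e.1 + C + 2) s); last by lia.
elim: s hs => // -[e f] s IH /andP[/= hf hs]; rewrite dsz_cons dsz_pair.
by have := IH hs; lia.
Qed.

Lemma tsz_le C c : tsz C c <= dsz c * C.+1.
Proof.
case: c => [[v s] w]; rewrite /tsz /= !dsz_pair.
have : sumn (map (fun e : seq (nat * nat) * fraction => dsz e.1 + C + 2) s) + C + 1 <= dsz s * C.+1.
  elim: s => [|[e f] s IH] /=; first by rewrite dsz_nil; lia.
  rewrite dsz_cons dsz_pair; have e0 : 0 < dsz f by exact: dsz_gt0.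
  nia.
have w0 : 0 < dsz w by exact: dsz_gt0.
nia.
Qed.

Lemma clamp_le M n : clamp M n <= M.+1.
Proof. by rewrite /clamp; lia. Qed.

Lemma sumn_drop_var C x (g : seq (nat * nat) * fraction -> fraction) s :
  sumn (map (fun e : seq (nat * nat) * fraction => dsz e.1 + C + 2)
         (map (fun e => (drop_var x e.1, g e)) s)) <=
  sumn (map (fun e : seq (nat * nat) * fraction => dsz e.1 + C + 2) s).
Proof.
elim: s => //= e s IH; apply: leq_add IH.
by rewrite !leq_add2r dsz_filter.
Qed.

Lemma elim_stepP D M x pre c C : 2 * dsz M + 5 <= C ->
  tsz C (elim_step D M x pre c) <= tsz C c /\
  (light C c -> light C (elim_step D M x pre c)).
Proof.
move=> leC; rewrite /elim_step; case: ifP => // _.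
case: c => [[v s] w]; rewrite /elim_table /tsz /light /=; split.
  rewrite !leq_add2r; apply: leq_add; first exact: dsz_filter.
  exact: sumn_drop_var.
case/andP=> -> _ /=; apply/allP => e /mapP[e' _ ->] /=.
rewrite /frac_ratio dsz_pair.
have h n : dsz (clamp M n) <= dsz M + 1.
  apply: leq_trans (blen_le (clamp_le _ _)) _.
  by rewrite -addn1; apply: leq_trans (blenD _ _) _.
have key a b : (dsz (clamp M a) + dsz (clamp M b) + 1 <= C)%N.
  by have := h a; have := h b; lia.
exact: key.
Qed.

(** [dsz J] covers the weights present at the start, the rest covers a pair of clamped numbers. *)
Definition weight_size (M : nat) (J : seq table) : nat := dsz J + 2 * dsz M + 5.

(** With every weight charged at the fixed price [Cx p], the total [tot] does not increase from
    round to round, and no weight ever exceeds its price. The bound is therefore independent of the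
    number of rounds. *)
Lemma fp_elim_all : FP (fun p : seq nat * (nat * (seq table * seq nat)) =>
  elim_all p.1 p.2.1 p.2.2.1 p.2.2.2).
Proof.
pose tot C (J : seq table) := 1 + sumn (map (fun c : table => tsz C c + 1) J).
pose Cx (p : seq nat * (nat * (seq table * seq nat))) := weight_size p.2.1 p.2.2.1.
have light0 p : all (light (Cx p)) p.2.2.1.
  have H : forall (J : seq table) C, dsz J <= C -> all (light C) J.
    elim=> // c J IH C; rewrite dsz_cons => le /=; rewrite IH ?andbT; last by lia.
    case: c le => [[v s] w]; rewrite !dsz_pair => le; rewrite /light /=; apply/andP; split; first lia.
    have {le} le : dsz s <= C by lia.
    elim: s le => // -[e f] s IHs; rewrite dsz_cons dsz_pair => le /=.
    by rewrite IHs ?andbT; lia.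
  by apply: H; rewrite /Cx /weight_size; lia.
apply: (fp_foldl_inv (b := fun p J x => elim_var p.1 p.2.1 J x)
   (i := fun p => p.2.2.1) (l := fun p => p.2.2.2)
   (Inv := fun p _ J => all (light (Cx p)) J /\ tot (Cx p) J <= tot (Cx p) p.2.2.1)
   (Q := fun n => n * (3 * n + 6))).
- by fp.
- by fp.
- by fp.
- by poly.
- by move=> p; split.
- move=> p j J x _ [h1 h2].
  have leC : 2 * dsz p.2.1 + 5 <= Cx p by rewrite /Cx /weight_size; lia.
  split.
    rewrite /elim_var; apply/allP => c' /mapP[[pre c] inc ->] /=.
    apply: (elim_stepP p.1 x pre c leC).2.
    have : c \in map snd (splits J) by apply/mapP; exists (pre, c).
    by rewrite map_snd_splits => /(allP h1).
  apply: leq_trans h2; rewrite /tot leq_add2l /elim_var -map_comp.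
  rewrite -{2}(map_snd_splits J) -map_comp.
  elim: (splits J) => //= -[pre c] s IH; apply: leq_add IH; rewrite /= leq_add2r.
  exact: (elim_stepP p.1 x pre c leC).1.
- move=> p j J _ [h1 h2].
  have l1 : dsz J <= tot (Cx p) J.
    elim: J h1 {h2} => // c J IH /andP[hc hJ]; rewrite dsz_cons /tot /=.
    by have := IH hJ; have := dsz_le_tsz hc; rewrite /tot; lia.
  have l2 : tot (Cx p) p.2.2.1 <= dsz p.2.2.1 * (Cx p).+1.
    elim: (p.2.2.1) => [|c J' IH]; first by rewrite /tot /= dsz_nil; lia.
    by rewrite dsz_cons; have := tsz_le (Cx p) c; move: IH; rewrite /tot /=; nia.
  apply: leq_trans l1 (leq_trans h2 (leq_trans l2 _)).
  case: p {h1 h2 l2 light0} => D [M [J0 xs]]; rewrite /Cx /weight_size /= !dsz_pair.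
  by apply: leq_mul; lia.
Qed.

Lemma fp_zipn : FP (fun p : seq nat * seq nat => zipn p.1 p.2).
Proof.
rewrite /zipn.
have h : FP (fun p : seq nat * seq nat =>
  foldl (fun (st : seq nat * seq (nat * nat)) v =>
     (behead st.1, st.2 ++ map (fun y => (y, v)) (take 1 st.1))) (p.1, [::]) p.2);
  last by fp.
apply: (fp_foldl_add (b := fun _ (st : seq nat * seq (nat * nat)) (v : nat) =>
   (behead st.1, st.2 ++ map (fun y => (y, v)) (take 1 st.1))) (R0 := fun n => n + 2));
  [by fp | by fp | by fp | by poly |].
move=> p [s t] v /=; rewrite !dsz_pair.
have h4 : (dsz (t ++ map (fun y => (y, v)) (take 1 s))).+1 =
   dsz t + dsz (map (fun y => (y, v)) (take 1 s)) by exact: dsz_cat.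
case: s h4 => [|y s] /=; rewrite ?take0 /= ?dsz_cons ?dsz_nil ?dsz_pair; lia.
Qed.

Lemma fp_fracs : FP fracs.
Proof. by rewrite /fracs /parsed_fracs; fp. Qed.
Lemma fp_powl {T : Type} {DT : Data T} : FP (fun p : nat * seq T => powl p.1 p.2).
Proof. by rewrite /powl; fp. Qed.
#[global] Hint Resolve fp_elim_all fp_zipn fp_fracs fp_powl : fpdb.
Lemma fp_delta : FP delta.
Proof. by rewrite /delta; fp. Qed.
#[global] Hint Resolve fp_delta : fpdb.
Lemma fp_vmax : FP vmax.
Proof. by rewrite /vmax; fp. Qed.
#[global] Hint Resolve fp_vmax : fpdb.
Lemma fp_base : FP (fun p : seq nat * (seq nat * seq parsed) => base p.1 p.2.1 p.2.2).
Proof. by rewrite /base; fp. Qed.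
#[global] Hint Resolve fp_base : fpdb.
Lemma fp_bound : FP (fun p : seq nat * (seq nat * seq parsed) => bound p.1 p.2.1 p.2.2).
Proof. by rewrite /bound; fp. Qed.
Lemma fp_tables : FP (fun p : seq nat * (seq nat * seq parsed) => tables p.1 p.2.1 p.2.2).
Proof. by rewrite /tables /table_of /weight; fp. Qed.
#[global] Hint Resolve fp_bound fp_tables : fpdb.
Lemma fp_final_tables :
  FP (fun p : seq nat * (seq nat * seq parsed) => final_tables p.1 p.2.1 p.2.2).
Proof. by rewrite /final_tables; fp. Qed.
Lemma fp_final_value : FP final_value.
Proof. by rewrite /final_value; fp; fp_teval. Qed.
#[global] Hint Resolve fp_final_tables fp_final_value : fpdb.
Lemma fp_readout : FP (fun p : seq nat * (seq nat * (seq parsed * fraction)) =>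
  readout p.1 p.2.1 p.2.2.1 p.2.2.2).
Proof. by rewrite /readout; fp. Qed.
#[global] Hint Resolve fp_readout : fpdb.
Lemma fp_solve_ordered :
  FP (fun p : seq nat * (seq nat * seq parsed) => solve_ordered p.1 p.2.1 p.2.2).
Proof. by rewrite /solve_ordered; fp. Qed.
#[global] Hint Resolve fp_solve_ordered : fpdb.
Lemma fp_solve : FP (fun p : seq nat * seq parsed => solve p.1 p.2).
Proof. by rewrite /solve; fp. Qed.
#[global] Hint Resolve fp_solve : fpdb.
Lemma fp_algorithm : FP algorithm.
Proof. by rewrite /algorithm; fp. Qed.

(** * Loading the input and returning the result *)

Lemma effs_cat s1 s2 m :
  effs (s1 ++ s2) m = ((effs s2 (effs s1 m).1).1, (effs s1 m).2 + (effs s2 (effs s1 m).1).2).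
Proof.
elim: s1 m => [|i s1 IH] m /=; first by case: (effs s2 m).
by rewrite IH /= addnA.
Qed.

Lemma init_mem_bit x i : 0 < i -> init_mem x i <= 1.
Proof.
rewrite /init_mem; case: i => // i _ /=; elim: x i => [|b x IH] [|i] //=; by case: b.
Qed.

Lemma seq_word_le m lo hi w (s : seq nat) : drep m lo hi w s -> w <= hi.
Proof. by case: s => [->|e s [_ lt _ _ _]] //; apply: ltnW; apply: ltnW. Qed.

Lemma blen_reg i : i < 12 -> blen i <= 4.
Proof. by move=> ?; apply: (@blen_le i 12); lia. Qed.

Section Loader.
Variables (K : nat) (x : seq bool).
Hypothesis K12 : 12 <= K.
Let m0 := init_mem x.
Let n := size x.
(** At least [K] bits are read. If the input is shorter, the registers past its end contain 0 and
    the list is padded with zeros. *)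
Let N := maxn n K.
Let lo := n + K + 2.

(* The working registers 1, ..., K initially hold input bits: they are saved as
   the K low-order bits of register 0. *)
Fixpoint pack_code (j : nat) : seq instr :=
  if j is j'.+1 then pack_code j' ++ [:: Iadd 0 0 0; Iadd 0 0 j] else [::].

(** Bit [j] is the least significant one, hence the first to be unpacked, as is needed to build the
    list from its end. *)
Fixpoint packed (j : nat) : nat := if j is j'.+1 then 2 * packed j' + m0 j else 0.

Lemma packed_lt j : packed j < 2 ^ j.
Proof.
elim: j => //= j IH; rewrite expnS; have := @init_mem_bit x j.+1 isT.
by rewrite -/m0; lia.
Qed.

Lemma pack_codeP j : let r := effs (pack_code j) m0 in
  [/\ r.1 0 = n * 2 ^ j + packed j, forall i, 0 < i -> r.1 i = m0 i
    & r.2 <= j * (10 + 4 * (n + 2 ^ j + j))].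
Proof.
elim: j => [|j] /=; first by split=> //; rewrite muln1 addn0.
rewrite effs_cat; case=> h1 h2 h3; split=> /=.
- by rewrite !updE /= h1 h2 // expnS; lia.
- by move=> i i0; rewrite !updE; regs; rewrite h2.
- rewrite !updE /= h1 h2 //; set r := (effs _ _).2 in h3 *.
  have pl := packed_lt j; have b1 := @init_mem_bit x j.+1 isT.
  have bb : blen (m0 j.+1) <= 1 by apply: (@blen_le (m0 j.+1) 1).
  have bj : blen j.+1 <= j.+2 by exact: blen_leS.
  have bn : blen (n * 2 ^ j + packed j) <= n + j + 2.
    have := ltn_blen n; have nl := blen_leS n; have nE := expnD 2 (blen n) j.
    have n2 : n < 2 ^ n by exact: ltn_expl.
    have lt : n * 2 ^ j + packed j < 2 ^ (n + j) by rewrite expnD; nia.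
    by have := blen_ltn lt; lia.
  have be : blen (n * 2 ^ j + packed j + (n * 2 ^ j + packed j)) <= n + j + 4.
    by have := blenM 2 (n * 2 ^ j + packed j); rewrite mul2n -addnn; have -> : blen 2 = 2 by []; lia.
  have -> : blen 0 = 1 by [].
  rewrite mulSn.
  have : j * (10 + 4 * (n + 2 ^ j + j)) <= j * (10 + 4 * (n + 2 ^ j.+1 + j.+1)).
    by rewrite leq_mul2l; apply/orP; right; rewrite expnS; lia.
  have p1 : j < 2 ^ j by exact: ltn_expl.
  by rewrite expnS; lia.
Qed.

Definition bits_from (j : nat) : seq nat := map m0 (iota j.+1 (N - j)).

Lemma bits_fromS j : j < N -> bits_from j = m0 j.+1 :: bits_from j.+1.
Proof. by move=> jN; rewrite /bits_from -(subnSK jN). Qed.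

Lemma bits_from0 : bits_from 0 = map nat_of_bool x ++ nseq (K - n) 0.
Proof.
apply: (@eq_from_nth _ 0) => [|i].
  by rewrite size_map size_iota size_cat size_map size_nseq /N -/n; lia.
rewrite size_map size_iota => iN; rewrite (nth_map 0) ?size_iota // nth_iota //.
rewrite /m0 /init_mem /= nth_cat size_map -/n.
case: ltnP => // ni; rewrite nth_default ?size_map //.
by rewrite nth_nseq if_same.
Qed.

(** Division by 2^K splits register 0 into the input length and the packed bits. Register 0 then
    becomes the heap pointer, placed beyond all input bits. *)
Definition setup_code : seq instr :=
  [:: Iconst 2 (2 ^ K); Idiv 3 0 2; Imul 4 3 2; Isub 5 0 4; Iconst 1 (K + 2);
      Iadd 0 3 1; Iconst 6 0; Iconst 1 K; Isub 7 3 1].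

Lemma setup_codeP m : m 0 = n * 2 ^ K + packed K ->
  let r := effs setup_code m in
  [/\ [/\ r.1 0 = lo, r.1 3 = n, r.1 5 = packed K, r.1 6 = 0 & r.1 7 = n - K],
      forall i, K < i -> r.1 i = m i
    & r.2 <= 200 + 20 * (n + 2 ^ K + K)].
Proof.
move=> h0; have pl := packed_lt K.
have dv : (n * 2 ^ K + packed K) %/ 2 ^ K = n.
  by rewrite divnMDl ?expn_gt0 // divn_small // addn0.
split.
- by split; rewrite /= !updE /= ?h0 ?dv /lo //; lia.
- by move=> i iK; rewrite /= !updE; regs.
- rewrite /= !updE /= h0 dv.
  have n2 : n < 2 ^ n by exact: ltn_expl.
  have lt : n * 2 ^ K + packed K < 2 ^ (n + K) by rewrite expnD; nia.
  have b1 := blen_ltn lt.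
  have b2 : blen (n * 2 ^ K) <= n + K.
    by apply: leq_trans (blen_le (leq_addr (packed K) _)) _; lia.
  have b3 := blen_leS n.
  have b4 := blen_leS K.
  have b5 : blen (K + 2) <= K + 3 by have := blen_leS (K + 2); lia.
  have b6 : blen (2 ^ K) <= K.+1 by rewrite /blen trunc_expnK.
  have p1 : K < 2 ^ K by exact: ltn_expl.
  have bl i : i < 8 -> blen i <= 4 by move=> ?; apply: (@blen_le i 8); lia.
  rewrite ?blen0 ?blen1.
  have c2 := bl 2 isT; have c3 := bl 3 isT; have c4 := bl 4 isT; have c5 := bl 5 isT.
  have c6 := bl 6 isT; have c7 := bl 7 isT.
  lia.
Qed.

(** Reads the bits still in place, from address [n] down to [K + 1]; register 3 holds the address
    and register 6 the list. *)
Definition loop1 : cmd := Cwhile 7 (Cseq (Cbs [:: Iload 8 3]) (Cseq (alloc 6 8 6)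
  (Cbs [:: Iconst 1 1; Isub 3 3 1; Iconst 1 K; Isub 7 3 1]))).

Let B := 2 * N + n + K + 5.

Lemma blen_lt2 h : h <= 2 * N + lo -> blen h <= B.
Proof. by move=> le; apply: leq_trans (blen_leS _) _; rewrite /B; move: le; rewrite /lo; lia. Qed.

Lemma loop1P j : j + K <= n -> forall m,
  m 3 = j + K -> m 7 = j -> m 5 = packed K -> m 0 = lo + 2 * (N - (j + K)) ->
  drep m lo (m 0) (m 6) (bits_from (j + K)) -> (forall a, K < a <= n -> m a = m0 a) ->
  exists m' t, [/\ exec loop1 m m' t, m' 5 = packed K, m' 0 = lo + 2 * (N - K),
    drep m' lo (m' 0) (m' 6) (bits_from K) & t <= j.+1 * (200 + 50 * B)].
Proof.
have loE : lo = n + K + 2 by [].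
have NE : N = maxn n K by [].
elim: j => [|j IH] jK m h3 h7 h5 h0 hr hb.
  exists m, (1 + blen 7 + blen (m 7)); split=> //; first exact: Ewhile0.
  by rewrite h7; have := blen_reg (isT : 7 < 12); rewrite blen0; lia.
have b0 : blen (m 0) <= B by apply: blen_lt2; lia.
have b6 : blen (m 6) <= B by have := seq_word_le hr; move/blen_le; lia.
have br := blen_reg.
set ma := (effs [:: Iload 8 3] m).1.
have maE i : i != 8 -> ma i = m i by move=> ?; rewrite /ma /= updE; regs.
have mh3 : m (m 3) = m0 (j.+1 + K) by rewrite h3 hb //; lia.
have bb : blen (m0 (j.+1 + K)) <= 1.
  by apply: (@blen_le _ 1); apply: init_mem_bit; lia.
have b3 : blen (m 3) <= B by rewrite h3; apply: blen_lt2; lia.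
have ma8 : ma 8 = m0 (j.+1 + K) by rewrite /ma /= updE.
have ma0 : ma 0 = m 0 by exact: maE.
have ma6 : ma 6 = m 6 by exact: maE.
have [|||m1 [t1 [e1 [a0 a6 ah ah1] ag le1]]] := @exec_alloc 6 8 6 ma;
  [rewrite ma0; lia..|].
rewrite ma8 ma0 ma6 in a0 a6 ah ah1 ag le1.
set m2 := upd (effs [:: Iconst 1 1; Isub 3 3 1; Iconst 1 K; Isub 7 3 1] m1).1 1 0.
have m2E i : i != 1 -> i != 3 -> i != 7 -> m2 i = m1 i.
  by move=> ? ? ?; rewrite /m2 /= !updE; regs.
have m13 : m1 3 = j.+1 + K by rewrite ag ?maE //; lia.
have [|||||||m3 [t3 [e3 p5 p0 pr le3]]] := IH _ m2.
- lia.
- by rewrite /m2 /= !updE /= m13; lia.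
- by rewrite /m2 /= !updE /= m13; lia.
- by rewrite m2E // ag // ?maE //; lia.
- by rewrite m2E // a0 h0; lia.
- have fr : frame 2 lo m m2.
    split; [by move=> i; lia | | by rewrite m2E // a0; lia].
    by move=> i ri; rewrite m2E ?ag ?maE //; lia.
  rewrite bits_fromS; last lia.
  rewrite !m2E // a6; split; try lia.
    by rewrite m2E ?ah //; lia.
  rewrite m2E; [|lia..]; rewrite ah1.
  by have := frame_rep fr hr; rewrite m2E.
- move=> a ra; rewrite m2E; [|lia..]; rewrite ag; [|lia..].
  by rewrite maE; [apply: hb|lia].
exists m3; eexists; split; [|exact: p5|exact: p0|exact: pr|].
  rewrite /loop1 in e3 *; apply: Ewhile1 e3; first by rewrite h7.
  apply: Eseq (exec_Cbs _ _ _) _ => //; apply: Eseq e1 _.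
  exact: exec_Cbs.
rewrite [X in _ <= X]mulSn; apply: leq_add le3.
have t0 : (effs [:: Iload 8 3] m).2 <= 10 + 2 * B.
  by rewrite /= mh3; have := br 8 isT; have := br 3 isT; lia.
have t2 : (effs [:: Iconst 1 1; Isub 3 3 1; Iconst 1 K; Isub 7 3 1] m1).2 <= 60 + 6 * B.
  rewrite /= !updE /= m13 ?blen1.
  have := br 7 isT; have := br 3 isT; rewrite h3 in b3.
  have bK : blen K <= B by apply: blen_lt2; lia.
  have b4 : blen (j.+1 + K - 1) <= B by apply: leq_trans b3; apply: blen_le; lia.
  lia.
have b7 : blen (m 7) <= B by rewrite h7; apply: blen_lt2; lia.
by have := br 7 isT; lia.
Qed.

(** Unpacks the saved bits [K] down to 1 by repeated halving of register 5. *)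
Definition loop2 : cmd := Cwhile 7 (Cseq
  (Cbs [:: Iconst 1 2; Idiv 8 5 1; Imul 9 8 1; Isub 9 5 9]) (Cseq (alloc 6 9 6)
  (Cbs [:: Iconst 1 0; Iadd 5 8 1; Iconst 1 1; Isub 7 7 1]))).

Lemma loop2P j : j <= K -> forall m,
  m 7 = j -> m 5 = packed j -> m 0 = lo + 2 * (N - j) ->
  drep m lo (m 0) (m 6) (bits_from j) ->
  exists m' t, [/\ exec loop2 m m' t, m' 0 = lo + 2 * N,
    drep m' lo (m' 0) (m' 6) (bits_from 0) & t <= j.+1 * (300 + 50 * B)].
Proof.
have loE : lo = n + K + 2 by [].
have NE : N = maxn n K by [].
elim: j => [|j IH] jK m h7 h5 h0 hr.
  exists m, (1 + blen 7 + blen (m 7)); split=> //; [exact: Ewhile0|by rewrite h0 subn0|].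
  by rewrite h7; have := blen_reg (isT : 7 < 12); rewrite blen0; lia.
have b0 : blen (m 0) <= B by apply: blen_lt2; lia.
have b6 : blen (m 6) <= B by have := seq_word_le hr; move/blen_le; lia.
have br := blen_reg.
have bit : m0 j.+1 <= 1 by exact: init_mem_bit.
have p2 : packed j.+1 %/ 2 = packed j.
  by rewrite /= mulnC divnMDl // divn_small ?addn0.
have p3 : packed j.+1 - packed j.+1 %/ 2 * 2 = m0 j.+1 by rewrite p2 /=; lia.
set c1 := [:: Iconst 1 2; Idiv 8 5 1; Imul 9 8 1; Isub 9 5 9].
set ma := (effs c1 m).1.
have maE i : i != 1 -> i != 8 -> i != 9 -> ma i = m i.
  by move=> ? ? ?; rewrite /ma /= !updE; regs.
have ma9 : ma 9 = m0 j.+1 by rewrite /ma /= !updE /= h5 p3.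
have ma8 : ma 8 = packed j by rewrite /ma /= !updE /= h5 p2.
have ma0 : ma 0 = m 0 by exact: maE.
have ma6 : ma 6 = m 6 by exact: maE.
have [|||m1 [t1 [e1 [a0 a6 ah ah1] ag le1]]] := @exec_alloc 6 9 6 ma;
  [rewrite ma0; lia..|].
rewrite ma9 ma0 ma6 in a0 a6 ah ah1 ag le1.
set c2 := [:: Iconst 1 0; Iadd 5 8 1; Iconst 1 1; Isub 7 7 1].
set m2 := upd (effs c2 m1).1 1 0.
have m2E i : i != 1 -> i != 5 -> i != 7 -> m2 i = m1 i.
  by move=> ? ? ?; rewrite /m2 /= !updE; regs.
have m17 : m1 7 = j.+1 by rewrite ag ?maE //; lia.
have m18 : m1 8 = packed j by rewrite ag ?ma8 //; lia.
have [|||||m3 [t3 [e3 p0 pr le3]]] := IH _ m2.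
- lia.
- by rewrite /m2 /= !updE /= m17; lia.
- by rewrite /m2 /= !updE /= m18 addn0.
- by rewrite m2E // a0 h0; lia.
- have fr : frame 2 lo m m2.
    split; [by move=> i; lia | | by rewrite m2E // a0; lia].
    by move=> i ri; rewrite m2E ?ag ?maE //; lia.
  rewrite bits_fromS; last lia.
  rewrite !m2E // a6; split; try lia.
    by rewrite m2E ?ah //; lia.
  rewrite m2E; [|lia..]; rewrite ah1.
  by have := frame_rep fr hr; rewrite m2E.
exists m3; eexists; split; [|exact: p0|exact: pr|].
  rewrite /loop2 in e3 *; apply: Ewhile1 e3; first by rewrite h7.
  apply: Eseq (exec_Cbs _ _ _) _ => //; apply: Eseq e1 _.
  exact: exec_Cbs.
rewrite [X in _ <= X]mulSn; apply: leq_add le3.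
have pk i : i <= K -> blen (packed i) <= B.
  move=> iK; have := blen_ltn (packed_lt i); rewrite /B; lia.
have bp1 := pk j.+1 jK; have bp := pk j (ltnW jK).
have t0 : (effs c1 m).2 <= 100 + 6 * B.
  rewrite /= !updE h5 p2 ?blen1; have -> : blen 2 = 2 by [].
  have l2 : blen (packed j * 2) <= B.
    by apply: leq_trans bp1; apply: blen_le; rewrite /=; lia.
  by rewrite /= in bp1 *; have := br 8 isT; have := br 9 isT; have := br 5 isT; lia.
have b7 : blen (m 7) <= B by rewrite h7; apply: blen_lt2; lia.
have t2 : (effs c2 m1).2 <= 100 + 6 * B.
  rewrite /= !updE /= m17 m18 ?blen1 ?blen0; rewrite h7 in b7.
  by have := br 8 isT; have := br 5 isT; have := br 7 isT; lia.
have bb : blen (m0 j.+1) <= 1 by exact: (@blen_le _ 1).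
by rewrite -/c1 -/c2; have := br 7 isT; lia.
Qed.
End Loader.

Lemma pack_code_basic j : all basic (pack_code j) /\ size (pack_code j) = 2 * j.
Proof.
elim: j => //= j [IH1 IH2]; rewrite all_cat size_cat IH1 IH2 /=; split=> //; lia.
Qed.

(** The number [z] of padding zeros comes from loading at least [K] bits; [f] has to cope with
    them. *)
Lemma fp_program (f : seq nat -> nat * nat) : FP f ->
  exists (p : program) (c k : nat), forall x : seq bool,
  exists (z fuel : nat) (m : memory) (cost : nat),
    [/\ run p fuel 0 (init_mem x) = Some (m, cost),
        cost <= c * (size x).+1 ^ k
      & (m 0, m 1) = f (map nat_of_bool x ++ nseq z 0)].
Proof.
move=> /fp_elim[nr [code [P [pP mP Cf Sf]]]].
(* Room for the registers of the loader, which go up to 9, and for the [nr] registers of the code of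
   [f], run in frame 2. *)
pose K := nr + 12.
have K12 : 12 <= K by rewrite /K; lia.
pose epi := [:: Iload 3 2; Iconst 1 1; Iadd 2 2 1; Iload 4 2; Iconst 1 0; Iadd 0 3 1; Iadd 1 4 1].
pose prog := Cseq (Cbs (pack_code K)) (Cseq (Cbs (setup_code K)) (Cseq (loop1 K)
  (Cseq (Cbs [:: Iconst 7 K]) (Cseq loop2 (Cseq (Cbs [:: Iconst 1 0; Iadd 2 6 1])
  (Cseq (code 2) (Cbs epi))))))).
pose Bn n := 2 * (n + K) + n + K + 5.
pose T n := K * (10 + 4 * (n + 2 ^ K + K)) + (200 + 20 * (n + 2 ^ K + K)) +
  n.+1 * (200 + 50 * Bn n) + 500 * (1 + K) + K.+1 * (300 + 50 * Bn n) + 500 * (1 + Bn n) +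
  P (2 * (n + K) + 1 + Bn n) + 100 * P (2 * (n + K) + 1).
have [b hb] : poly_bounded T by rewrite /T /Bn; poly.
pose p := compile 0 prog.
exists p, ((7 + 2 * blen (size p)) * 2 ^ b), b => x.
set n := size x; set m0 := init_mem x.
pose N := maxn n K; pose lo := n + K + 2.
have NE : N = maxn n K by []. have loE : lo = n + K + 2 by [].
have br := blen_reg.
have [q0 qE q2] := pack_codeP x K12 K.
have [[s0 s3 s5 s6 s7] sE st] := setup_codeP K12 q0.
rewrite -/n in s0 s3 s7 st q2.
set m1 := (effs (setup_code K) _).1 in s0 s3 s5 s6 s7 sE.
have [m2 [t2 [e2 h25 h20 h2r le2]]] : exists m' t,
   [/\ exec (loop1 K) m1 m' t, m' 5 = packed x K, m' 0 = lo + 2 * (N - K),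
       drep m' lo (m' 0) (m' 6) (bits_from K x K) & t <= n.+1 * (200 + 50 * Bn n)].
  case: (leqP K n) => Kn.
    have jn : n - K + K <= n by rewrite subnK.
    have [||||||m' [t [e1 e2 e3 e4 e5]]] := loop1P K12 jn (m := m1).
    - by rewrite s3 subnK.
    - exact: s7.
    - exact: s5.
    - by rewrite s0 subnK // (maxn_idPl _) // subnn addn0.
    - by rewrite subnK // s6 /bits_from (maxn_idPl _) // subnn.
    - by move=> a /andP[Ka an]; rewrite sE // qE //; lia.
    exists m', t; split=> //; apply: leq_trans e5 _; apply: leq_mul; first lia.
    by rewrite /Bn (maxn_idPl _) // -/n; lia.
  exists m1, (1 + blen 7 + blen (m1 7)); have z7 : m1 7 = 0 by rewrite s7; lia.
  split=> //.
  - exact: Ewhile0.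
  - by rewrite s0 /N (maxn_idPr _) ?(ltnW Kn) // subnn addn0.
  - by rewrite s6 /bits_from (maxn_idPr _) ?(ltnW Kn) // subnn.
  - by rewrite z7 blen0; have := br 7 isT; nia.
set m3 := (effs [:: Iconst 7 K] m2).1.
have m3E i : i != 7 -> m3 i = m2 i by move=> ?; rewrite /m3 /= updE; regs.
have m30 : m3 0 = m2 0 by exact: m3E.
have [||||m4 [t4 [e4 h40 h4r le4]]] := loop2P K12 (x := x) (leqnn K) (m := m3).
- by rewrite /m3 /= updE.
- by rewrite m3E.
- by rewrite m30.
- rewrite m3E //; apply: (frame_rep (k := 2) (m := m2)) h2r.
  split; rewrite ?m30 //; first by move=> i; lia.
  by move=> i ri; rewrite m3E //; lia.
rewrite -/n -/N -/lo in h40 h4r le4.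
have le4' : t4 <= K.+1 * (300 + 50 * Bn n).
  by apply: leq_trans le4 _; rewrite leq_mul2l /= /Bn; lia.
rewrite (bits_from0 x K12) -/n in h4r.
set bits := map _ _ ++ _ in h4r.
have db : dsz bits <= 2 * (n + K) + 1.
  have H : forall s : seq nat, all (leq^~ 1) s -> dsz s = 2 * size s + 1.
    elim=> // e s IH /andP[he hs]; rewrite dsz_cons IH // /=.
    have -> : dsz e = 1 by case: e he => [|[]].
    lia.
  rewrite H; first by rewrite size_cat size_map size_nseq -/n; lia.
  rewrite all_cat; apply/andP; split; last by rewrite all_nseq orbT.
  by rewrite all_map; apply/allP => -[].
set m5 := (effs [:: Iconst 1 0; Iadd 2 6 1] m4).1.
have m5E i : 2 < i -> m5 i = m4 i by move=> ?; rewrite /m5 /= !updE; regs.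
have m50 : m5 0 = m4 0 by rewrite /m5 /= !updE.
have h5r : drep m5 lo (m5 0) (m5 2) bits.
  have -> : m5 2 = m4 6 by rewrite /m5 /= !updE /= addn0.
  apply: (frame_rep (k := 2) (m := m4)) h4r.
  split; rewrite ?m50 //; first by move=> i; lia.
  by move=> i ri; rewrite m5E //; lia.
have l2nr : 2 + nr <= lo by rewrite loE /K; lia.
have lom5 : lo <= m5 0 by rewrite m50 h40; lia.
have [m6 [t6 [e6 fr6 h60 h6r le6]]] := Cf 2 lo m5 bits isT l2nr lom5 h5r.
case: h6r => w1 w2 w3 w4; rewrite /drep /= in w3 w4.
set m7 := (effs epi m6).1.
have m70 : m7 0 = (f bits).1.
  by rewrite /m7 /= !updE /= w3; lia.
have m71 : m7 1 = (f bits).2.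
  by rewrite /m7 /= !updE /= addn1; regs; rewrite w4; lia.
have bB : blen (m4 0) <= Bn n.
  by apply: leq_trans (blen_leS _) _; rewrite h40 /Bn; lia.
have [kb ks] := pack_code_basic K.
have dfb : dsz (f bits) <= P (2 * (n + K) + 1) by apply: leq_trans (Sf _) (mP _ _ db).
have t7 : (effs epi m6).2 <= 200 + 5 * blen (m6 0) + 4 * P (2 * (n + K) + 1).
  set PP := P (2 * (n + K) + 1) in dfb *.
  have dE : dsz (f bits) = blen (f bits).1 + blen (f bits).2 + 1 by [].
  rewrite /= !updE /= !addn1; regs; rewrite w3 w4.
  have v1 : blen (m6 2) <= blen (m6 0) by apply: blen_le; lia.
  have v2 : blen (m6 2).+1 <= blen (m6 0) by apply: blen_le; lia.
  have := br 2 isT; have := br 3 isT; have := br 4 isT; rewrite ?blen0 ?blen1; lia.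
have [t Te Tle] : exists2 t, exec prog m0 m7 t & t <= T n.
  eexists.
    apply: Eseq (exec_Cbs _ _ _) _; [by rewrite ks; lia|exact: kb|].
    apply: Eseq (exec_Cbs _ _ _) _ => //; apply: Eseq e2 _.
    apply: Eseq (exec_Cbs _ _ _) _ => //; apply: Eseq e4 _.
    apply: Eseq (exec_Cbs _ _ _) _ => //; apply: Eseq e6 _.
    exact: exec_Cbs.
  have l3 : (effs [:: Iconst 7 K] m2).2 <= 10 + K.
    by rewrite /=; have := br 7 isT; have := blen_leS K; lia.
  have l5 : (effs [:: Iconst 1 0; Iadd 2 6 1] m4).2 <= 30 + Bn n.
    rewrite /= !updE /= ?blen0 ?blen1; have := seq_word_le h4r; move/blen_le.
    by have := br 2 isT; have := br 6 isT; lia.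
  have l6 : t6 <= P (2 * (n + K) + 1 + Bn n).
    by apply: leq_trans le6 _; apply: mP; rewrite m50; lia.
  have l60 : blen (m6 0) <= Bn n + P (2 * (n + K) + 1) + 1.
    apply: leq_trans (blen_le h60) _; apply: leq_trans (blenD _ _) _; rewrite m50.
    have u1 : blen (P (dsz bits)) <= (P (dsz bits)).+1 by exact: blen_leS.
    have u2 : P (dsz bits) <= P (2 * (n + K) + 1) by exact: mP.
    lia.
  rewrite -/m0 in q2 st *; rewrite /T; lia.
have cod : code_at p 0 (compile 0 prog) by exists [::], [::]; rewrite cats0.
have [t' [sts let']] := exec_compile Te cod.
have halt : step p (0 + size (compile 0 prog)) m7 = None.
  by rewrite /step nth_default.
have [fuel run_] := steps_run sts halt.
exists (K - n), fuel, m7, t'; split; [exact: run_| |by rewrite m70 m71 -surjective_pairing].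
apply: leq_trans let' _; rewrite -mulnA leq_mul2l; apply/orP; right.
apply: leq_trans Tle (leq_trans (hb _) _); rewrite -expnMn.
by case: (b) => // b'; rewrite leq_exp2r //; lia.
Qed.

(** * Correctness of variable elimination *)

Definition fval (f : fraction) : rat := (f.1%:R / f.2%:R)%R.

Definition fpos (f : fraction) : bool := (0 < f.1) && (0 < f.2).

Lemma fval_gt0 f : fpos f -> (0 < fval f)%R.
Proof. by case/andP=> h1 h2; rewrite /fval divr_gt0 ?ltr0n. Qed.

Lemma natr_neq0 n : 0 < n -> (n%:R != 0 :> rat)%R.
Proof. by move=> n0; rewrite pnatr_eq0 -lt0n. Qed.

Lemma prodn_pos s : all (fun n => 0 < n) s -> 0 < prodn s.
Proof. by elim: s => //= n s IH /andP[n0 /IH h]; rewrite muln_gt0 n0. Qed.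

Lemma frac_prodE l : all fpos l -> fval (frac_prod l) = (\prod_(f <- l) fval f)%R /\ fpos (frac_prod l).
Proof.
elim: l => [|f l IH] /=.
  by rewrite big_nil /fval /frac_prod /= divr1.
case/andP=> hf /IH[e p]; rewrite big_cons -e; split.
  by rewrite /fval /frac_prod /= !natrM invfM mulrACA.
by move: hf p; rewrite /fpos /frac_prod /= !muln_gt0 => /andP[-> ->] /andP[-> ->].
Qed.

Lemma dvdn_prodn n s : n \in s -> n %| prodn s.
Proof.
elim: s => //= m s IH; rewrite inE => /orP[/eqP->|/IH h]; first exact: dvdn_mulr.
exact: dvdn_mull.
Qed.

Lemma frac_sumE l : all fpos l -> fval (frac_sum l) = (\sum_(f <- l) fval f)%R /\
  0 < (frac_sum l).2 /\ (0 < size l -> fpos (frac_sum l)).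
Proof.
move=> hl; set P := prodn (map snd l).
have P0 : 0 < P.
  by apply: prodn_pos; rewrite all_map; apply: sub_all hl => f /andP[].
have key (l' : seq fraction) : {subset l' <= l} ->
    ((sumn (map (fun f : fraction => (f.1 * (P %/ f.2))%N) l'))%:R / P%:R = \sum_(f <- l') fval f)%R.
  elim: l' => [|f l' IH] sub; first by rewrite big_nil mul0r.
  rewrite big_cons -IH; last by move=> g gl; apply: sub; rewrite inE gl orbT.
  have fl : f \in l by apply: sub; rewrite mem_head.
  have /andP[f1 f2] := allP hl _ fl.
  have dv : f.2 %| P by apply/dvdn_prodn/map_f.
  rewrite /= natrD mulrDl; congr (_ + _)%R; apply/eqP.
  rewrite /fval eqr_div ?natr_neq0 // -!natrM -mulnA; apply/eqP; congr (_%:R)%R.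
  by rewrite divnK.
split; last split=> //.
  exact: key.
move=> l0; rewrite /fpos /= -/P P0 andbT.
case: l hl l0 @P P0 key => // f l /= /andP[/andP[f1 f2] _] _ P0 _.
by rewrite addn_gt0 muln_gt0 f1 divn_gt0 // dvdn_leq // dvdn_mulr.
Qed.

Lemma frac_ratio_pos M f g : fpos (frac_ratio M f g).
Proof. by rewrite /fpos /frac_ratio /clamp /= !leq_maxl. Qed.

(** The reduced numerator and denominator are coprime, so they divide [U] and [U'] respectively.
    Both are thus at most [M], and [clamp] leaves them unchanged. *)
Lemma frac_ratioE M f g U U' : fpos f -> fpos g -> 0 < U <= M -> 0 < U' <= M ->
  (fval f / fval g = U%:R / U'%:R)%R -> (fval (frac_ratio M f g) = fval f / fval g)%R.
Proof.
case/andP=> f1 f2 /andP[g1 g2] /andP[U0 UM] /andP[V0 VM] e.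
set n := f.1 * g.2; set k := f.2 * g.1.
have n0 : 0 < n by rewrite muln_gt0 f1.
have k0 : 0 < k by rewrite muln_gt0 f2.
have eN : (fval f / fval g = n%:R / k%:R)%R.
  by rewrite /fval /n /k !natrM invf_div mulrACA [in RHS]invfM.
have eq1 : n * U' = k * U.
  move/eqP: e; rewrite eN eqr_div ?natr_neq0 // -!natrM eqr_nat => /eqP ->.
  exact: mulnC.
set h := gcdn n k; have h0 : 0 < h by rewrite gcdn_gt0 n0.
have En : n = n %/ h * h by rewrite divnK ?dvdn_gcdl.
have Ek : k = k %/ h * h by rewrite divnK ?dvdn_gcdr.
have cop : coprime (n %/ h) (k %/ h).
  rewrite /coprime -(eqn_pmul2r h0) mul1n muln_gcdl -En -Ek //.
have eq2 : n %/ h * U' = k %/ h * U.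
  apply/eqP; rewrite -(eqn_pmul2r h0) -mulnA [U' * h]mulnC mulnA -En.
  by rewrite -[_ * U * h]mulnA [U * h]mulnC mulnA -Ek eq1.
have nh : 0 < n %/ h by move: n0; rewrite {1}En muln_gt0 => /andP[].
have kh : 0 < k %/ h by move: k0; rewrite {1}Ek muln_gt0 => /andP[].
have leU : n %/ h <= U.
  by apply: dvdn_leq => //; rewrite -(Gauss_dvdr _ cop) -eq2 dvdn_mulr.
have leV : k %/ h <= U'.
  have cop' : coprime (k %/ h) (n %/ h) by rewrite coprime_sym.
  by apply: dvdn_leq => //; rewrite -(Gauss_dvdr _ cop') eq2 dvdn_mulr.
have cl v : 0 < v <= M -> clamp M v = v by rewrite /clamp; lia.
rewrite eN /frac_ratio -/n -/k -/h !cl ?nh ?kh ?(leq_trans leU) ?(leq_trans leV) //.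
apply/eqP; rewrite /fval /= eqr_div ?natr_neq0 // -!natrM; apply/eqP; congr (_%:R)%R.
move: En Ek; set a := n %/ h; set b := k %/ h => En Ek.
by rewrite [in LHS]Ek [in RHS]En mulnA [RHS]mulnAC.
Qed.

Definition tpos (c : table) : bool :=
  fpos c.2 && all (fun e : seq (nat * nat) * fraction => fpos e.2) c.1.2.

Definition twf (c : table) : bool :=
  uniq c.1.1 &&
  all (fun e : seq (nat * nat) * fraction => unzip1 e.1 == c.1.1) c.1.2.

Lemma teval_pos c s : tpos c -> fpos (teval c s).
Proof.
case: c => [[v es] w] /andP[/= hw]; rewrite /teval /=.
by elim: es => //= e es IH /andP[he /IH h]; case: ifP.
Qed.

Lemma matches_agree e s s' : {in unzip1 e, s =1 s'} -> matches e s = matches e s'.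
Proof.
move=> ag; apply: eq_in_all => p pe; rewrite ag //.
exact: map_f.
Qed.

Lemma teval_agree c s s' : twf c -> {in c.1.1, s =1 s'} -> teval c s = teval c s'.
Proof.
case: c => [[v es] w] /andP[/= _]; rewrite /teval /= => + ag.
elim: es => //= e es IH /andP[/eqP he /IH ->].
by rewrite (@matches_agree _ s s') // he.
Qed.

Lemma lookup_mem a p : uniq (unzip1 a) -> p \in a -> lookup a p.1 = p.2.
Proof.
elim: a => //= q a IH /andP[nq ua]; rewrite inE => /orP[/eqP->|pa]; first by rewrite eqxx.
case: eqP => [e|_]; last exact: IH.
by case/negP: nq; rewrite -e; apply: map_f.
Qed.

Lemma matches_lookup a s : uniq (unzip1 a) -> matches a s ->
  {in unzip1 a, lookup a =1 s}.
Proof.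
move=> ua /allP ma y /mapP[p pa ->]; rewrite lookup_mem //.
by apply/esym/eqP; apply: ma.
Qed.

Lemma unzip1_drop_var x a : unzip1 (drop_var x a) = filter (fun v => ~~ (v == x)) (unzip1 a).
Proof. by rewrite /unzip1 /drop_var filter_map. Qed.

Definition sumv (d : nat) := fix sumv (xs : seq nat) (G : (nat -> nat) -> nat)
    (s : nat -> nat) : nat :=
  if xs is x :: xs' then \sum_(b < d) sumv xs' G (upd s x b) else G s.

(** Numerators suffice: this is applied to the initial tables, whose weights have denominator 1. *)
Definition Wsum (d : nat) (r : seq nat) (pre : seq table) (s : nat -> nat) : nat :=
  sumv d r (fun s => \prod_(c <- pre) (teval c s).1) s.

Section Step.
Variables (d x M : nat).
Hypothesis d0 : 0 < d.
Local Notation D := (iota 0 d).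
Local Notation hasx := (fun c : table => x \in c.1.1).

(** The sum P_i of the overview if [J] is the chain. Over a whole prefix of the table list, the
    tables without [x] contribute the additional factor [Ns]. *)
Definition Qs (J : seq table) (s : nat -> nat) : rat :=
  (\sum_(b < d) \prod_(c <- J) fval (teval c (upd s x b)))%R.

Definition Ns (J : seq table) (s : nat -> nat) : rat :=
  (\prod_(c <- J | x \notin c.1.1) fval (teval c s))%R.

Lemma Qs_gt0 J s : all tpos J -> (0 < Qs J s)%R.
Proof.
move=> hJ; rewrite /Qs.
have p b : (0 < \prod_(c <- J) fval (teval c (upd s x b)))%R.
  rewrite big_seq; apply: prodr_gt0 => c cJ.
  by apply/fval_gt0/teval_pos/(allP hJ).
case: d d0 p => // d' _ p; rewrite big_ord_recl ltr_wpDr //.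
by apply: sumr_ge0 => i _; apply: ltW.
Qed.

Lemma Qs_split J s : all twf J -> (Qs J s = Qs (filter hasx J) s * Ns J s)%R.
Proof.
move=> hJ; rewrite /Qs mulr_suml; apply: eq_bigr => b _.
rewrite (bigID hasx) /= big_filter; congr (_ * _)%R.
rewrite /Ns big_seq_cond [RHS]big_seq_cond; apply: eq_bigr => c /andP[cJ nx].
congr fval; apply: teval_agree; first exact: (allP hJ).
by move=> y yc; rewrite updE; case: eqP => // e; rewrite -e yc in nx.
Qed.

Lemma chain_sumE chain a : all tpos chain ->
  fval (chain_sum D x chain a) = Qs chain (lookup a) /\ fpos (chain_sum D x chain a).
Proof.
move=> hc; rewrite /chain_sum.
have p b : all fpos (map (fun c => teval c (lookup ((x, b) :: a))) chain).
  by rewrite all_map; apply: sub_all hc => c hc; apply: teval_pos.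
set l := map _ _.
have pl : all fpos l.
  by rewrite all_map; apply/allP => b _ /=; have [] := frac_prodE (p b).
have [e [_ f]] := frac_sumE pl; split; last by apply: f; rewrite size_map size_iota.
rewrite e /l big_map /Qs (_ : D = index_iota 0 d); last by rewrite /index_iota subn0.
rewrite big_mkord; apply: eq_bigr => b _.
by have [-> _] := frac_prodE (p b); rewrite big_map.
Qed.

Lemma Qs_agree J (v : seq nat) s s' : all twf J ->
  (forall c, c \in J -> {subset c.1.1 <= v}) ->
  {in v, forall y, y != x -> s y = s' y} -> Qs J s = Qs J s'.
Proof.
move=> hJ sub ag; rewrite /Qs; apply: eq_bigr => b _.
apply: eq_big_seq => c cJ; congr fval; apply: teval_agree; first exact: (allP hJ).
move=> y yc; rewrite !updE; case: eqP => // /eqP yx.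
by apply: ag => //; apply: sub yc.
Qed.

(** By inclusion of the variable sets, the ratio depends only on the values of the variables of [c]
    other than [x]. If an entry of [c] matches on these, its new weight is the ratio by
    construction; otherwise the default has to be the ratio. *)
Lemma elim_tableE chain c s : x \in c.1.1 -> twf c -> tpos c -> all twf chain ->
  all tpos chain -> (forall c', c' \in chain -> {subset c'.1.1 <= c.1.1}) ->
  (forall s, exists U U', [/\ 0 < U <= M, 0 < U' <= M &
     (Qs (chain ++ [:: c]) s / Qs chain s = U%:R / U'%:R)%R]) ->
  (fval (teval (elim_table D M x chain c) s) = Qs (chain ++ [:: c]) s / Qs chain s)%R.
Proof.
move=> xc wc pc wch pch sub bnd.
have wch' : all twf (chain ++ [:: c]) by rewrite all_cat wch /= wc.
have pch' : all tpos (chain ++ [:: c]) by rewrite all_cat pch /= pc.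
set R := (Qs _ s / _)%R.
have Ragree s' : {in c.1.1, forall y, y != x -> s' y = s y} ->
    (Qs (chain ++ [:: c]) s' / Qs chain s' = R)%R.
  move=> ag; rewrite /R; congr (_ / _)%R; apply: (Qs_agree (v := c.1.1)) => //.
  by move=> c'; rewrite mem_cat inE => /orP[/sub|/eqP->].
pose F := fun e : seq (nat * nat) * fraction => (drop_var x e.1,
  frac_ratio M (chain_sum D x (chain ++ [:: c]) (drop_var x e.1))
    (chain_sum D x chain (drop_var x e.1))).
have FE e : e \in c.1.2 -> matches (drop_var x e.1) s -> fval (F e).2 = R.
  move=> ec me; rewrite /F /=.
  have [e1 p1] := chain_sumE (drop_var x e.1) pch'.
  have [e2 p2] := chain_sumE (drop_var x e.1) pch.
  have [U [U' [hU hU' eU]]] := bnd (lookup (drop_var x e.1)).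
  rewrite (frac_ratioE p1 p2 hU hU') e1 e2 //; apply: Ragree => y yc yx.
  case/andP: wc => uc /allP/(_ _ ec)/eqP we.
  apply: matches_lookup => //; rewrite unzip1_drop_var we.
    exact: filter_uniq.
  by rewrite mem_filter yx.
have evE es : {subset es <= c.1.2} ->
    fval (foldr (fun (e : seq (nat * nat) * fraction) (r : fraction) =>
       if matches e.1 s then e.2 else r) c.2 (map F es)) =
    if has (fun e : seq (nat * nat) * fraction => matches (drop_var x e.1) s) es
    then R else fval c.2.
  elim: es => //= e es IH se.
  have se' : {subset es <= c.1.2} by move=> y ye; apply: se; rewrite inE ye orbT.
  by case: ifP => [me|_] /=; [apply: FE => //; apply: se; rewrite mem_head | apply: IH].
rewrite /teval /elim_table /= -/F evE //; case: ifP => // /negbT/hasPn nm.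
(* If no entry matches outside [x], then [c] takes its default for every value of [x], and the
   default factors out of the sum. *)
have dflt b : teval c (upd s x b) = c.2.
  have H es : {subset es <= c.1.2} ->
     foldr (fun (e : seq (nat * nat) * fraction) (r : fraction) =>
       if matches e.1 (upd s x b) then e.2 else r) c.2 es = c.2.
    elim: es => //= e es IH se.
    rewrite ifF; first by apply: IH => y ye; apply: se; rewrite inE ye orbT.
    have ec : e \in c.1.2 by apply: se; rewrite mem_head.
    apply/negbTE; apply: contra (nm _ ec) => /allP me.
    apply/allP => p; rewrite mem_filter => /andP[px pe].
    by have := me _ pe; rewrite updE (negbTE px).
  exact: H.
have q0 : (Qs chain s != 0)%R by rewrite gt_eqF // Qs_gt0.
apply/(canRL (mulfK q0)); rewrite mulrC /Qs mulr_suml; apply: eq_bigr => b _.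
by rewrite big_cat big_seq1 /= dflt.
Qed.

Lemma elim_var_rcons E J c :
  elim_var E M (rcons J c) x = rcons (elim_var E M J x) (elim_step E M x J c).
Proof. by rewrite /elim_var splits_rcons map_rcons. Qed.

(** The product of ratios telescopes down to [Qs] of the empty list, which is [d]. The bounds are
    assumed for ratios of whole prefixes, as these are the ones expressible by [Wsum]. *)
Lemma elim_varE J s : all twf J -> all tpos J ->
  (forall pre c post, J = pre ++ c :: post -> x \in c.1.1 ->
     (forall c', c' \in pre -> x \in c'.1.1 -> {subset c'.1.1 <= c.1.1}) /\
     (forall s, exists U U', [/\ 0 < U <= M, 0 < U' <= M &
       (Qs (rcons pre c) s / Qs pre s = U%:R / U'%:R)%R])) ->
  (\prod_(c <- elim_var D M J x) fval (teval c s) * d%:R = Qs J s)%R.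
Proof.
elim/last_ind: J => [|J c IH].
  move=> _ _ _; rewrite big_nil mul1r /Qs.
  under eq_bigr do rewrite big_nil.
  by rewrite sumr_const card_ord.
rewrite !all_rcons => /andP[wc wJ] /andP[pc pJ] H.
have {}IH : (\prod_(c <- elim_var D M J x) fval (teval c s) * d%:R = Qs J s)%R.
  apply: IH => // pre c' post eJ; apply: (H pre c' (rcons post c)).
  by rewrite eJ rcons_cat.
have wf : all twf (filter hasx J) by rewrite all_filter; apply: sub_all wJ => y /= ->; rewrite implybT.
have pf : all tpos (filter hasx J) by rewrite all_filter; apply: sub_all pJ => y /= ->; rewrite implybT.
have wJc : all twf (rcons J c) by rewrite all_rcons wc.
rewrite elim_var_rcons -cats1 big_cat big_seq1 /= mulrAC IH.
rewrite /elim_step; case: ifP => xc; last first.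
  rewrite Qs_split // [in RHS]Qs_split // filter_rcons xc.
  rewrite -mulrA; congr (_ * _)%R.
  by rewrite /Ns -[rcons J c]cats1 big_cat big_cons big_nil xc /= mulr1.
have [sub bnd] := H J c [::] (esym (cats1 _ _)) xc.
have NE s' : Ns (rcons J c) s' = Ns J s'.
  by rewrite /Ns -cats1 big_cat big_cons big_nil xc /= mulr1.
have N0 s' : (Ns J s' != 0)%R.
  rewrite gt_eqF // /Ns big_seq_cond; apply: prodr_gt0 => c' /andP[cJ _].
  by apply/fval_gt0/teval_pos/(allP pJ).
(* The tables without [x] contribute the same factor above and below, so the chain may be replaced
   by the whole prefix. *)
have KE s' : (Qs (filter hasx J ++ [:: c]) s' / Qs (filter hasx J) s' =
              Qs (rcons J c) s' / Qs J s')%R.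
  rewrite [Qs (rcons _ _) _]Qs_split // [Qs J _]Qs_split // filter_rcons xc NE cats1.
  by rewrite -mulf_div divff // mulr1.
rewrite elim_tableE //.
- rewrite KE mulrC divfK // gt_eqF // Qs_gt0 //.
- move=> c'; rewrite mem_filter => /andP[xc' cJ]; exact: sub.
- by move=> s'; have := bnd s'; rewrite KE.
Qed.
End Step.

(** * Bounds on iterated sums, and the elimination invariant *)

Lemma sumv_le d r G s h : (forall s, G s <= h) -> sumv d r G s <= d ^ size r * h.
Proof.
move=> hG; elim: r s => [|x r IH] s /=; first by rewrite mul1n.
rewrite expnS -mulnA -[X in _ <= X * _]card_ord -sum_nat_const.
by apply: leq_sum => b _; apply: IH.
Qed.

Lemma sumv_gt0 d r G s : 0 < d -> (forall s, 0 < G s) -> 0 < sumv d r G s.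
Proof.
move=> d0 hG; elim: r s => [|x r IH] s; [exact: hG | rewrite /=].
by case: d d0 IH => // d' _ IH; rewrite big_ord_recl addn_gt0 IH.
Qed.

Definition fint (X : nat) (f : fraction) : bool := (f.2 == 1) && (0 < f.1 <= X).

Definition tint (X : nat) (c : table) : bool :=
  fint X c.2 && all (fun e : seq (nat * nat) * fraction => fint X e.2) c.1.2.

Lemma teval_int X c s : tint X c -> fint X (teval c s).
Proof.
case: c => [[v es] w] /andP[/= hw]; rewrite /teval /=.
by elim: es => //= e es IH /andP[he /IH h]; case: ifP.
Qed.

Lemma fint_pos X f : fint X f -> fpos f.
Proof. by case/andP=> /eqP f2 /andP[f1 _]; rewrite /fpos f2 f1. Qed.

Lemma tint_pos X c : tint X c -> tpos c.
Proof.
case/andP=> hw hs; rewrite /tpos (fint_pos hw) /=.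
by apply: sub_all hs => e; apply: fint_pos.
Qed.

Lemma prod_int X (J : seq table) s : all (tint X) J ->
  0 < \prod_(c <- J) (teval c s).1 <= X ^ size J.
Proof.
elim: J => [|c J IH] /=; first by rewrite big_nil.
case/andP=> /(@teval_int _ _ s)/andP[_ /andP[c0 cX]] /IH/andP[h1 h2].
by rewrite big_cons muln_gt0 c0 h1 expnS leq_mul.
Qed.

Lemma elim_step_pos D M x pre c : tpos c -> tpos (elim_step D M x pre c).
Proof.
move=> pc; rewrite /elim_step; case: ifP => // _.
case/andP: pc => hw _; rewrite /tpos /= hw /=.
by apply/allP => e /mapP[e' _ ->]; apply: frac_ratio_pos.
Qed.

Lemma elim_step_wf D M x pre c : twf c -> twf (elim_step D M x pre c).
Proof.
move=> wc; rewrite /elim_step; case: ifP => // _.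
case/andP: wc => uc /allP hc; rewrite /twf /= filter_uniq //=.
apply/allP => e /mapP[e' ec ->] /=.
by rewrite unzip1_drop_var (eqP (hc _ ec)).
Qed.

Lemma elim_step_vars D M x pre c :
  (elim_step D M x pre c).1.1 = filter (fun v => ~~ (v == x)) c.1.1.
Proof.
rewrite /elim_step; case: ifP => // nx.
apply/esym/all_filterP/allP => v vc; apply: contraFN nx => /eqP <-; exact: vc.
Qed.

Lemma elim_var_in D M J x c' : c' \in elim_var D M J x ->
  exists pre c, c \in J /\ c' = elim_step D M x pre c.
Proof.
case/mapP=> [[pre c] inc ->]; exists pre, c; split=> //.
by rewrite -(map_snd_splits J); apply/mapP; exists (pre, c).
Qed.

Lemma elim_var_cat D M J1 J2 x : exists J2',
  elim_var D M (J1 ++ J2) x = elim_var D M J1 x ++ J2' /\ size J2' = size J2.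
Proof.
elim/last_ind: J2 => [|J2 c [J2' [e es]]]; first by exists [::]; rewrite !cats0.
exists (rcons J2' (elim_step D M x (J1 ++ J2) c)).
by rewrite -rcons_cat elim_var_rcons e rcons_cat !size_rcons es.
Qed.

Lemma size_elim_var D M J x : size (elim_var D M J x) = size J.
Proof. by rewrite size_map -(size_map snd) map_snd_splits. Qed.

(** A new table depends only on the tables before it. This is what allows an invariant about all
    prefixes. *)
Lemma take_elim_var D M J x i : take i (elim_var D M J x) = elim_var D M (take i J) x.
Proof.
have [J2' [e es]] := elim_var_cat D M (take i J) (drop i J) x.
rewrite cat_take_drop in e; rewrite e take_cat size_elim_var.
case: ltnP => // h; last first.
  have : size J2' = 0 \/ i - size (take i J) = 0.
    by rewrite es size_drop size_take_min; lia.
  by case=> [/size0nil ->|->]; rewrite ?take0 cats0.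
by exfalso; move: h; rewrite size_take_min; lia.
Qed.

Section Elimination.
Variables (d M X : nat) (J0 : seq table).
Hypotheses (d0 : 0 < d) (wf0 : all twf J0) (int0 : all (tint X) J0).
Local Notation D := (iota 0 d).

(* The last clause holds for all prefixes, not only for the whole list: hence each
   weight is a quotient of two values of [Wsum], which bounds its size. *)
Definition elim_inv (r : seq nat) (J : seq table) : Prop :=
  [/\ map (fun c : table => c.1.1) J =
      map (fun c : table => filter (fun v => v \notin r) c.1.1) J0,
      all twf J, all tpos J
    & forall i s, (\prod_(c <- take i J) fval (teval c s) * d%:R ^+ size r =
                   (Wsum d r (take i J0) s)%:R)%R].

Lemma elim_inv0 : elim_inv [::] J0.
Proof.
split=> //.
- by apply: eq_map => c; rewrite filter_predT.
- by apply: sub_all int0 => c; apply: tint_pos.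
move=> i s; rewrite expr0 mulr1 /Wsum /= natr_prod.
apply: eq_big_seq => c /mem_take cJ.
by have /andP[/eqP e _] := teval_int s (allP int0 _ cJ); rewrite /fval e divr1.
Qed.

(** By the invariant, [Qs] of any prefix is a value of [Wsum] divided by d^|r| ([QE]). The powers
    cancel in a ratio, so each new weight is a quotient of two integers between 1 and [M] ([Wb]). *)
Lemma elim_inv_step r J x : elim_inv r J -> d ^ (size r).+1 * X ^ size J0 <= M ->
  0 < X ->
  (forall pre c post c', J0 = pre ++ c :: post -> c' \in pre ->
     x \in c'.1.1 -> x \in c.1.1 -> x \notin r ->
     forall y, y \in c'.1.1 -> y \notin r -> y \in c.1.1) ->
  elim_inv (x :: r) (elim_var D M J x).
Proof.
move=> [vJ wJ pJ pr] leM X0 ord.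
have sJ : size J = size J0 by have := congr1 size vJ; rewrite !size_map.
have QE i s : (Qs d x (take i J) s * d%:R ^+ size r = (Wsum d (x :: r) (take i J0) s)%:R)%R.
  rewrite /Qs mulr_suml /Wsum /= natr_sum; apply: eq_bigr => b _.
  exact: pr.
have Wb i s : 0 < Wsum d (x :: r) (take i J0) s <= M.
  have it : all (tint X) (take i J0).
    by apply/allP => c /mem_take cJ; apply: (allP int0).
  rewrite /Wsum sumv_gt0 //=; last by move=> s'; case/andP: (prod_int s' it).
  apply: leq_trans leM; apply: (leq_trans (sumv_le (h := X ^ size J0) d (x :: r) s _)) => //.
  move=> s'; case/andP: (prod_int s' it) => _ h; apply: (leq_trans h).
  by rewrite leq_pexp2l // size_take_min geq_minr.
have dr : (d%:R ^+ size r != 0 :> rat)%R by rewrite expf_neq0 // natr_neq0.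
split.
- rewrite /elim_var -map_comp (eq_map (g := fun p => filter (fun v => ~~ (v == x)) p.2.1.1)); last first.
    by move=> p /=; rewrite elim_step_vars.
  rewrite (map_comp (fun c : table => filter (fun v => ~~ (v == x)) c.1.1) snd) map_snd_splits.
  rewrite (map_comp (filter (fun v => ~~ (v == x))) (fun c : table => c.1.1)) vJ -map_comp.
  apply: eq_map => c /=; rewrite -filter_predI; apply: eq_filter => v /=.
  by rewrite inE negb_or.
- apply/allP => c' /elim_var_in[pre [c [cJ ->]]].
  by apply: elim_step_wf; apply: (allP wJ).
- apply/allP => c' /elim_var_in[pre [c [cJ ->]]].
  by apply: elim_step_pos; apply: (allP pJ).
move=> i s; rewrite take_elim_var exprS mulrA elim_varE //.
- by apply/allP => c /mem_take cJ; apply: (allP wJ).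
- by apply/allP => c /mem_take cJ; apply: (allP pJ).
move=> pre c post eJ xc.
have eJ' : J = pre ++ c :: (post ++ drop i J).
  by rewrite -[LHS](cat_take_drop i) eJ -catA.
have preE : pre = take (size pre) J by rewrite eJ' take_size_cat.
have preE' : rcons pre c = take (size pre).+1 J.
  by rewrite eJ' -cat_rcons take_size_cat ?size_rcons.
split; last first.
  move=> s'; rewrite preE' {2}preE.
  exists (Wsum d (x :: r) (take (size pre).+1 J0) s'), (Wsum d (x :: r) (take (size pre) J0) s').
  split=> //; rewrite -!QE.
  by rewrite -mulf_div divff // mulr1.
move=> c' c'pre xc'.
have spre : size pre < size J0 by rewrite -sJ eJ' size_cat /=; lia.
have [c0 _] : exists c0 : table, True by exists c.
(* [J] and [J0] correspond by position only, so the inclusion is transferred from the entries of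
   [J0] at the positions of [c'] and [c]. *)
pose k := index c' pre; have kp : k < size pre by rewrite index_mem.
have vE j : j < size J0 -> (nth c0 J j).1.1 = filter (fun v => v \notin r) (nth c0 J0 j).1.1.
  move=> jJ; have := congr1 (fun l => nth [::] l j) vJ.
  by rewrite (nth_map c0) ?sJ // (nth_map c0).
have cE : c.1.1 = filter (fun v => v \notin r) (nth c0 J0 (size pre)).1.1.
  by rewrite -vE // eJ' nth_cat ltnn subnn.
have c'E : c'.1.1 = filter (fun v => v \notin r) (nth c0 J0 k).1.1.
  by rewrite -vE ?(ltn_trans kp) // eJ' nth_cat kp nth_index.
have spl : J0 = take (size pre) J0 ++ nth c0 J0 (size pre) :: drop (size pre).+1 J0.
  by rewrite -drop_nth // cat_take_drop.
move=> y; rewrite c'E cE !mem_filter => /andP[yr yc']; rewrite yr /=.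
move: xc' xc; rewrite c'E cE !mem_filter => /andP[xr xc'] /andP[_ xc].
apply: (ord _ _ _ (nth c0 J0 k) spl) => //.
by rewrite -(nth_take c0 kp) mem_nth // size_take spre.
Qed.

Lemma elim_all_inv xs : d ^ size xs * X ^ size J0 <= M -> 0 < X ->
  (forall r x rest, xs = rev r ++ x :: rest ->
   forall pre c post c', J0 = pre ++ c :: post -> c' \in pre ->
     x \in c'.1.1 -> x \in c.1.1 -> x \notin r ->
     forall y, y \in c'.1.1 -> y \notin r -> y \in c.1.1) ->
  elim_inv (rev xs) (elim_all D M J0 xs).
Proof.
rewrite /elim_all; elim/last_ind: xs => [|xs x IH] leM X0 ord; first exact: elim_inv0.
rewrite rev_rcons -cats1 foldl_cat /=; apply: elim_inv_step => //.
- apply: IH => //.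
    apply: leq_trans leM; rewrite leq_mul2r size_rcons leq_pexp2l ?orbT //.
  by move=> r y rest e; apply: (ord r y (rcons rest x)); rewrite e rcons_cat.
- by rewrite size_rev; rewrite size_rcons in leM.
- by apply: (ord (rev xs) x [::]); rewrite revK cats1.
Qed.
End Elimination.

(** * Elimination orders *)

Definition nested (E : seq (seq nat)) (r : seq nat) (x : nat) : Prop :=
  forall e1 e2, e1 \in E -> e2 \in E -> x \in e1 -> x \in e2 -> x \notin r ->
    (forall y, y \in e1 -> y \notin r -> y \in e2) \/
    (forall y, y \in e2 -> y \notin r -> y \in e1).

Lemma subedgeP (r e1 e2 : seq nat) :
  reflect (forall y, y \in e1 -> y \notin r -> y \in e2)
    (subedge (filter (fun v => ~~ (v \in r)) e1) (filter (fun v => ~~ (v \in r)) e2)).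
Proof.
apply: (iffP allP) => [h y y1 yr|h y].
  by have := h y; rewrite !mem_filter y1 yr => /(_ isT)/andP[].
by rewrite !mem_filter => /andP[yr y1]; rewrite yr h.
Qed.

Lemma nest_pointP (E : seq (seq nat)) (r : seq nat) (x : nat) :
  nest_point (map (filter (fun v => ~~ (v \in r))) E) x <-> nested E r x.
Proof.
split=> [/allP h e1 e2 E1 E2 x1 x2 xr|h].
  have /allP/(_ _ (map_f _ E2)) := h _ (map_f (filter (fun v => ~~ (v \in r))) E1).
  by rewrite !mem_filter x1 x2 xr /= => /orP[] /subedgeP; [left|right].
apply/allP => _ /mapP[e1 E1 ->]; apply/allP => _ /mapP[e2 E2 ->].
rewrite !mem_filter; apply/implyP => /andP[xr x1]; apply/implyP => /andP[_ x2].
by apply/orP; case: (h e1 e2 E1 E2 x1 x2 xr) => H; [left|right]; apply/subedgeP.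
Qed.

Lemma mem_hvertices (E : seq (seq nat)) (y : nat) : y \in hvertices E = has (fun e => y \in e) E.
Proof.
rewrite mem_undup; apply/flattenP/hasP => [[e eE ye]|[e eE ye]]; by exists e.
Qed.

Lemma beta_elim_nested E s : beta_elim_order E s ->
  {subset hvertices E <= s} /\
  (forall s1 x s2, s = s1 ++ x :: s2 -> nested E s1 x).
Proof.
elim: s E => [|x s IH] E /=.
  by move=> /nilP ->; split=> // -[].
case/and3P=> xE nx /IH[sub nst]; split=> [y yE|].
  rewrite inE; case: eqP => //= /eqP yx; apply: sub.
  move: yE; rewrite !mem_hvertices => /hasP[e eE ye]; apply/hasP.
  have ye' : y \in filter (fun v => v != x) e by rewrite mem_filter yx.
  exists (filter (fun v => v != x) e) => //; rewrite mem_filter map_f // andbT.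
  by apply/negP => /nilP e0; rewrite e0 in ye'.
case=> [|z s1] y s2 /= [<- e].
  apply/nest_pointP; suff -> : map (filter (fun v => ~~ (v \in [::]))) E = E by [].
  by rewrite -[RHS]map_id; apply: eq_map => e'; rewrite filter_predT.
move=> e1 e2 E1 E2 y1 y2; rewrite inE negb_or => /andP[yx ys1].
have F e' : e' \in E -> y \in e' -> filter (fun v => v != x) e' \in del_vertex x E.
  move=> eE ye; have ye' : y \in filter (fun v => v != x) e' by rewrite mem_filter yx.
  rewrite mem_filter map_f // andbT.
  by apply/negP => /nilP e0; rewrite e0 in ye'.
have := nst s1 y s2 e _ _ (F _ E1 y1) (F _ E2 y2).
rewrite !mem_filter yx y1 y2 => /(_ isT isT ys1)[] h; [left|right] => v;
  rewrite inE negb_or => v1 /andP[vx vs]; have := h v; rewrite !mem_filter vx v1 => /(_ isT vs);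
  by case/andP.
Qed.

(** Deleting further vertices preserves inclusions between edges, so a nest point stays one until it
    is deleted itself. *)
Lemma nested_sub E (r r' : seq nat) x : x \notin r' ->
  (forall y, y \in hvertices E -> y \in r -> y \in r') ->
  x \notin r -> nested E r x -> nested E r' x.
Proof.
move=> xr' sub xr h e1 e2 E1 E2 x1 x2 _.
have V e y : e \in E -> y \in e -> y \notin r' -> y \notin r.
  move=> eE ye; apply: contra; apply: sub.
  by rewrite mem_hvertices; apply/hasP; exists e.
case: (h e1 e2 E1 E2 x1 x2 xr) => H; [left|right] => y ye yr; apply: H => //.
  exact: V E1 ye yr.
exact: V E2 ye yr.
Qed.

(** Greedy choice never gets stuck: the first vertex of the given order [s] that is still present is
    a nest point by [nested_sub], all its predecessors in [s] having been deleted. *)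
Lemma elim_orderP E : beta_acyclic E ->
  [/\ uniq (elim_order E), elim_order E =i hvertices E &
   forall s1 x s2, elim_order E = s1 ++ x :: s2 -> nested E s1 x].
Proof.
case=> s /beta_elim_nested[sub nst]; set V := hvertices E.
have uV : uniq V by exact: undup_uniq.
have H : forall l : seq nat, size l <= size V ->
  let out := foldl (fun out (_ : nat) => out ++ take 1 (candidates E out)) [::] l in
  [/\ uniq out, {subset out <= V}, size out = size l &
   forall s1 x s2, out = s1 ++ x :: s2 -> nested E s1 x].
  elim/last_ind=> [|l e IH] le.
    by split=> // -[].
  rewrite size_rcons in le *; have := IH (ltnW le) => {IH}.
  rewrite -cats1 foldl_cat /=; set out := foldl _ _ _; case=> uo so zo no.
  have [y /andP[yV yo]] : exists y, (y \in V) && (y \notin out).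
    case: (boolP (all (mem out) V)) => [/allP h|/allPn[y yV yo]]; last first.
      by exists y; rewrite yV.
    have hh : size V <= size out by exact: uniq_leq_size.
    by rewrite zo in hh; have := leq_trans le hh; rewrite ltnn.
  have hs : has (fun z => (z \in V) && (z \notin out)) s.
    by apply/hasP; exists y; [exact: sub | rewrite yV].
  (* [z] is the first vertex in [s] that has not been chosen yet. *)
  have [s1 [z [s2 [es zV zout hs1]]]] : exists s1 z s2, [/\ s = s1 ++ z :: s2,
      z \in V, z \notin out & ~~ has (fun z => (z \in V) && (z \notin out)) s1].
    case: (split_find_nth 0 hs) => z s1 s2 /andP[zV zout] h.
    by exists s1, z, s2; rewrite cat_rcons.
  have cz : z \in candidates E out.
    rewrite mem_filter zV andbT zout /=; apply/nest_pointP.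
    move: hs1 => /hasPn hs1.
    case: (boolP (z \in s1)) => [z1|z1].
      by have := hs1 _ z1; rewrite zV zout.
    apply: (@nested_sub _ s1) => //.
      move=> w wV w1; have := hs1 _ w1; rewrite wV /=.
      by rewrite negbK.
    exact: (nst s1 z s2).
  case ce : (candidates E out) cz => [|w cs] // _.
  have : w \in candidates E out by rewrite ce mem_head.
  rewrite mem_filter => /andP[/andP[wo /nest_pointP nw] wV].
  rewrite /= take0 cats1; split.
  - by rewrite rcons_uniq wo.
  - by move=> v; rewrite mem_rcons inE => /orP[/eqP->|/so].
  - by rewrite size_rcons zo.
  move=> r1 v r2; case/lastP: r2 => [|r2 u].
    by rewrite cats1 => /rcons_inj[<- <-].
  by rewrite -rcons_cons -rcons_cat => /rcons_inj[e1 _]; apply: no e1.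
have [uo so zo no] := H V (leqnn _).
split=> //; apply: (uniq_min_size uo so _).2.
by rewrite zo.
Qed.

(** * The linear order of the tables *)

Fixpoint lexle (r : seq nat) (c c' : table) : bool :=
  if r is y :: r' then
    if (y \in c.1.1) == (y \in c'.1.1) then lexle r' c c' else y \in c'.1.1
  else true.

Lemma pairwise_filter_in (T : eqType) (R R' : rel T) (p : pred T) s :
  (forall a b, p a -> p b -> R a b -> R' a b) ->
  pairwise R s -> pairwise R' (filter p s).
Proof.
move=> h; elim: s => //= a s IH /andP[/allP ha ps]; case: ifP => pa; last exact: IH.
rewrite /= IH // andbT; apply/allP => b; rewrite mem_filter => /andP[pb bs].
by apply: h => //; apply: ha.
Qed.

(* Least-significant-digit radix sort. *)
Lemma radix_sorted J xs : pairwise (lexle (rev xs)) (radix J xs).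
Proof.
elim/last_ind: xs => [|xs x IH]; first by elim: J => //= c J ->; rewrite andbT; apply/allP.
rewrite /radix rev_rcons -cats1 foldl_cat /= -/(radix J xs) /radix_step pairwise_cat.
apply/and3P; split.
- apply/allrelP => c c'; rewrite !mem_filter => /andP[/negbTE nx _] /andP[xc' _].
  by rewrite /= nx xc'.
- apply: pairwise_filter_in IH => c c' /negbTE h /negbTE h' /=.
  by rewrite h h'.
- by apply: pairwise_filter_in IH => c c' /= -> ->.
Qed.

Lemma radix_perm J xs : perm_eq (radix J xs) J.
Proof.
rewrite /radix; elim: xs J => //= x xs IH J; apply: perm_trans (IH _) _.
rewrite /radix_step perm_catC; exact/permEl/perm_filterC.
Qed.

(** At the first variable of [s] where the two differ, the larger table has it and the smaller one
    lacks it, against the assumed inclusion; so they agree on all of [s]. *)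
Lemma lexle_cat s r c c' : lexle (s ++ r) c c' ->
  (forall y, y \in s -> y \in c'.1.1 -> y \in c.1.1) ->
  forall y, y \in s -> y \in c.1.1 -> y \in c'.1.1.
Proof.
elim: s => //= z s IH; case: eqP => [e l h y|ne zc' h]; last first.
  by case: ne; rewrite zc' (h z) // mem_head.
rewrite inE => /orP[/eqP->|ys]; first by rewrite e.
by apply: IH => // w ws; apply: h; rewrite inE ws orbT.
Qed.

(** Off the eliminated variables [r] the two edges are nested. If the inclusion goes the wrong way,
    [lexle_cat] gives equality, because the variables not yet eliminated are the leading positions
    of the lexicographic order. *)
Lemma radix_chain (E : seq (seq nat)) J xs : uniq xs ->
  (forall c, c \in J -> c.1.1 \in E) -> xs =i hvertices E ->
  (forall s1 x s2, xs = s1 ++ x :: s2 -> nested E s1 x) ->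
  forall r x rest, xs = rev r ++ x :: rest ->
   forall pre c post c', radix J xs = pre ++ c :: post -> c' \in pre ->
     x \in c'.1.1 -> x \in c.1.1 -> x \notin r ->
     forall y, y \in c'.1.1 -> y \notin r -> y \in c.1.1.
Proof.
move=> uxs JE xsE nst r x rest exs pre c post c' eJ c'pre xc' xc xr.
have inE' b : b \in radix J xs -> b.1.1 \in E by rewrite (perm_mem (radix_perm _ _)) => /JE.
have cE : c.1.1 \in E by apply: inE'; rewrite eJ mem_cat mem_head orbT.
have c'E : c'.1.1 \in E by apply: inE'; rewrite eJ mem_cat c'pre.
have lx : lexle (rev xs) c' c.
  have := radix_sorted J xs; rewrite eJ pairwise_cat => /and3P[/allrelP h _ _].
  by apply: h => //; rewrite mem_head.
have xr' : x \notin rev r by rewrite mem_rev.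
have [H|H] := nst _ _ _ exs _ _ c'E cE xc' xc xr'.
  by move=> y yc' yr; apply: H => //; rewrite mem_rev.
move=> y yc' yr.
have yxs : y \in xs.
  by rewrite xsE mem_hvertices; apply/hasP; exists c'.1.1.
have ey : y \in rev (x :: rest).
  by move: yxs; rewrite exs mem_cat !mem_rev (negbTE yr).
rewrite exs rev_cat revK in lx.
apply: (lexle_cat lx) => // z zs zc; apply: H => //.
move: uxs; rewrite exs cat_uniq => /and3P[_ /hasPn nh _]; apply: nh.
by rewrite -mem_rev.
Qed.

(** * Sums over assignments *)

Definition extensional (G : (nat -> nat) -> nat) : Prop :=
  forall s s', s =1 s' -> G s = G s'.

Lemma upd_ext s s' x b : s =1 s' -> upd s x b =1 upd s' x b.
Proof. by move=> e y; rewrite !updE e. Qed.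

Lemma sumv_ext d r G : extensional G -> extensional (sumv d r G).
Proof.
move=> eG; elim: r => [|x r IH] s s' e /=; first exact: eG.
by apply: eq_bigr => b _; apply/IH/upd_ext.
Qed.

Lemma eq_sumv d r G G' s : G =1 G' -> sumv d r G s = sumv d r G' s.
Proof. by move=> e; elim: r s => //= x r IH s; apply: eq_bigr => b _. Qed.

Lemma leq_sumv d r G G' s : (forall s, G s <= G' s) -> sumv d r G s <= sumv d r G' s.
Proof. by move=> e; elim: r s => //= x r IH s; apply: leq_sum => b _. Qed.

Lemma sumvD d r G G' s :
  sumv d r (fun s => G s + G' s) s = sumv d r G s + sumv d r G' s.
Proof.
elim: r s => //= x r IH s; rewrite -big_split /=; apply: eq_bigr => b _; exact: IH.
Qed.

Lemma sumvZ d r k G s : sumv d r (fun s => k * G s) s = k * sumv d r G s.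
Proof.
elim: r s => //= x r IH s; rewrite big_distrr /=; apply: eq_bigr => b _; exact: IH.
Qed.

Lemma sumv_rem d r x G s : extensional G -> x \in r -> uniq r ->
  sumv d r G s = sumv d (x :: rem x r) G s.
Proof.
move=> eG; elim: r s => //= y r IH s; rewrite inE => xr /andP[yr ur].
case: (eqVneq y x) xr => [-> //|yx] /= xr.
under eq_bigr do rewrite IH //=.
rewrite exchange_big /=; apply: eq_bigr => b _; apply: eq_bigr => b' _.
apply: sumv_ext => // z; rewrite !updE.
by case: (eqVneq z x) => // ->; rewrite eq_sym (negbTE yx).
Qed.

Lemma sumv_perm d r r' G s : extensional G -> uniq r -> perm_eq r r' ->
  sumv d r G s = sumv d r' G s.
Proof.
move=> eG; elim: r r' s => [|x r IH] r' s ur pr.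
  by move: pr; rewrite perm_sym => /perm_nilP ->.
have xr' : x \in r' by rewrite -(perm_mem pr) mem_head.
have ur' : uniq r' by rewrite -(perm_uniq pr).
rewrite (sumv_rem _ _ eG xr' ur') /=; apply: eq_bigr => b _; apply: IH.
  by case/andP: ur.
by rewrite -(perm_cons x); apply: perm_trans pr _; apply: perm_to_rem.
Qed.

(** Links the sum over finite functions in [partition_fn] to iterated sums: the bijection [h] splits
    off the value at the first variable. *)
Lemma sum_ffun d V G s : extensional G -> uniq V ->
  \sum_(a : {ffun 'I_(size V) -> 'I_d})
     G (fun y => if insub (index y V) is Some i then nat_of_ord (a i) else s y) =
  sumv d V G s.
Proof.
move=> eG; elim: V s => [|x V IH] s /=.
  move=> _; rewrite (eq_bigr (fun=> G s)); last first.
    by move=> a _; apply: eG => y; rewrite insubF.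
  by rewrite sum_nat_const card_ffun !card_ord expn0 mul1n.
case/andP=> xV uV.
pose h (p : 'I_d * {ffun 'I_(size V) -> 'I_d}) : {ffun 'I_(size V).+1 -> 'I_d} :=
  [ffun i => oapp p.2 p.1 (unlift ord0 i)].
pose g (a : {ffun 'I_(size V).+1 -> 'I_d}) : 'I_d * {ffun 'I_(size V) -> 'I_d} :=
  (a ord0, [ffun j => a (lift ord0 j)]).
have hb : bijective h.
  exists g => [[b a]|a]; rewrite /g /h.
    rewrite ffunE unlift_none /=; congr (_, _); apply/ffunP => j.
    by rewrite !ffunE liftK.
  apply/ffunP => i; rewrite ffunE; case: unliftP => [j ->|->] //=.
  by rewrite ffunE.
rewrite (reindex h) /=; last exact: onW_bij.
rewrite -(pair_bigA _ (fun b a => G (fun y => match insub (if x == y then 0 else (index y V).+1)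
   with Some i => nat_of_ord (h (b, a) i) | None => s y end))) /=.
apply: eq_bigr => b _; rewrite -IH //; apply: eq_bigr => a _; apply: eG => y.
rewrite updE eq_sym; case: eqP => [->|/eqP yx].
  rewrite insubT /= insubF ?index_mem ?(negbTE xV) // /h ffunE.
  by rewrite (_ : Sub 0 _ = ord0) ?unlift_none //; apply/val_inj.
case: (ltnP (index y V) (size V)) => iV; last by rewrite !insubF // ltnNge ?ltnS ?iV.
rewrite !insubT /= /h ffunE.
by rewrite (_ : Sub _ _ = lift ord0 (Ordinal iV)) ?liftK //; apply/val_inj.
Qed.

(** * Recovering a sum from its perturbation *)

Lemma prod_round_lower B (l : seq nat) :
  B ^ size l * \prod_(n <- l) n <= \prod_(n <- l) (n * B + 1).
Proof.
elim: l => [|n l IH]; first by rewrite !big_nil.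
rewrite !big_cons /= expnS mulnACA; apply: leq_mul IH; lia.
Qed.

Lemma prod_le_succ (l : seq nat) : \prod_(n <- l) n <= \prod_(n <- l) (n + 1).
Proof. by apply: leq_prod => n _; rewrite leq_addr. Qed.

(** In the expanded product all terms but the leading one carry a power of B of exponent at most m -
    1, with m the length of [l], and their coefficients add up to the product of the n + 1 minus
    that of the n. Multiplying by [B] and moving terms avoids m - 1 and truncated subtraction. *)
Lemma prod_round_upper B (l : seq nat) : 0 < B ->
  B * \prod_(n <- l) (n * B + 1) + B ^ size l * \prod_(n <- l) n <=
  B ^ size l * (B * \prod_(n <- l) n + \prod_(n <- l) (n + 1)).
Proof.
move=> B0; elim: l => [|n l IH]; first by rewrite !big_nil /= expn0; lia.
have := prod_le_succ l; rewrite !big_cons /= expnS; move: IH.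
set T := \prod_(m <- l) (m * B + 1); set P := \prod_(m <- l) m.
set R := \prod_(m <- l) (m + 1); set Bm := B ^ size l => IH PR.
have [q qE] : exists q, R = P + q by exists (R - P); lia.
rewrite qE in IH *.
have IH' : B * T <= Bm * (B * P + q) by nia.
have h1 : (n * B + 1) * (B * T) <= (n * B + 1) * (Bm * (B * P + q)) by rewrite leq_mul2l IH' orbT.
have h2 : Bm * q <= Bm * (B * q) by rewrite leq_mul2l; apply/orP; right; nia.
nia.
Qed.

(** Summing the two bounds over all assignments places the perturbed sum between B^m times the true
    one and B^m times its successor, the latter excluded because the error sum is below [B]. *)
Lemma round_sum d r (L : (nat -> nat) -> seq nat) m B s : 0 < B ->
  (forall s, size (L s) = m) ->
  sumv d r (fun s => \prod_(n <- L s) (n + 1)) s < B ->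
  sumv d r (fun s => \prod_(n <- L s) (n * B + 1)) s %/ B ^ m =
  sumv d r (fun s => \prod_(n <- L s) n) s.
Proof.
move=> B0 sL lt.
set wB := sumv _ _ (fun s => \prod_(n <- L s) (n * B + 1)) s.
set wN := sumv _ _ (fun s => \prod_(n <- L s) n) s; set w1 := sumv _ _ _ _ in lt.
have lo : B ^ m * wN <= wB.
  by rewrite -sumvZ; apply: leq_sumv => s'; rewrite -(sL s'); apply: prod_round_lower.
have hi : B * wB + B ^ m * wN <= B ^ m * (B * wN + w1).
  rewrite /wB /wN /w1 -!sumvZ -!sumvD -sumvZ; apply: leq_sumv => s'.
  by rewrite -(sL s'); apply: prod_round_upper.
have Bm : 0 < B ^ m by rewrite expn_gt0 B0.
apply/eqP; rewrite eqn_leq leq_divRL // [wN * _]mulnC lo andbT -ltnS ltn_divLR //.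
by rewrite -(ltn_pmul2l B0); nia.
Qed.

(** * Correctness of the algorithm *)

Definition frac (q : rat) : fraction := (`|numq q|%N, `|denq q|%N).

Definition parsed_of (c : constraint) : parsed :=
  (cvars c, map (fun e : seq nat * rat => (e.1, frac e.2)) (csupp c), frac (cdef c)).

Lemma frac_pos q : 0 < (frac q).2.
Proof. by rewrite /frac /= absz_gt0 denq_neq0. Qed.

Lemma fval_frac q : (0 <= q)%R -> fval (frac q) = q.
Proof.
move=> q0; rewrite -[RHS]divq_num_den /fval /frac /= !natr_absz.
by rewrite !ger0_norm ?numq_ge0 // ltW.
Qed.

Lemma eval_foldr c s : eval_constraint c s =
  foldr (fun (p : seq nat * rat) r => if p.1 == map s (cvars c) then p.2 else r)
    (cdef c) (csupp c).
Proof.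
rewrite /eval_constraint; elim: (csupp c) => //= p l IH.
by case: (p.1 == _) => //=; rewrite -IH ?ltnS.
Qed.

Lemma eval_mem c s : eval_constraint c s \in cdef c :: map snd (csupp c).
Proof.
rewrite eval_foldr; elim: (csupp c) => [|p l IH] /=; first by rewrite mem_head.
case: ifP => _; first by rewrite !inE eqxx orbT.
by move: IH; rewrite !inE => /orP[->|->]; rewrite ?orbT.
Qed.

Lemma zipnE s t : size s = size t -> zipn s t = zip s t.
Proof.
rewrite /zipn => e; rewrite -[RHS]cat0s.
elim: t s [::] e => [|v t IH] [|y s] acc //= e; first by rewrite cats0.
by case: e => e; rewrite take0 IH //= -catA.
Qed.

Lemma matches_zip s t f : size s = size t -> matches (zip s t) f = (t == map f s).
Proof.
elim: s t => [|y s IH] [|v t] //= e; case: e => e.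
by rewrite /matches /= eqseq_cons eq_sym -IH.
Qed.

Lemma powlE {T : Type} b (s : seq T) : powl b s = b ^ size s.
Proof. by elim: s => //= x s IH; rewrite /powl /= -/(powl b s) IH expnS. Qed.

Section Solve.
Variables (d : nat) (I : instance).
Hypotheses (wfI : wf_instance d I) (bI : beta_acyclic (hypergraph_of I)).
Let Ip := map parsed_of I.
Let dl := delta Ip.
Let V := vmax Ip.
Let xs := elim_order (map (fun c : parsed => c.1.1) Ip).
Let D := iota 0 d.
Let B := base D xs Ip.

Definition scaled (q : rat) : nat := (frac q).1 * (dl %/ (frac q).2).

Let values (c : constraint) := cdef c :: map snd (csupp c).

Lemma frac_in c q : c \in I -> q \in values c -> frac q \in fracs Ip.
Proof.
move=> cI qc; apply/flattenP; exists (parsed_fracs (parsed_of c)); first by rewrite !map_f.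
rewrite /parsed_fracs /=; move: qc; rewrite !inE => /orP[/eqP->|]; first by rewrite eqxx.
case/mapP=> e ec ->; apply/orP; right; rewrite -map_comp.
by apply/mapP; exists e.
Qed.

Lemma value_ge0 c q : c \in I -> q \in values c -> (0 <= q)%R.
Proof.
move=> cI; have /and4P[_ /allP h _ h0] := allP wfI _ cI.
by rewrite inE => /orP[/eqP->|/mapP[e /h /and3P[_ _ ?] ->]].
Qed.

Lemma dl_gt0 : 0 < dl.
Proof.
apply: prodn_pos; apply/allP => n /mapP[f fI ->]; move: fI => /flattenP[l /mapP[p /mapP[c _ ->] ->]].
rewrite inE => /orP[/eqP->|/mapP[e /mapP[e' _ ->] ->]]; exact: frac_pos.
Qed.

Lemma scaledE c q : c \in I -> q \in values c -> (q = (scaled q)%:R / dl%:R)%R.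
Proof.
move=> cI qc; rewrite -[LHS](fval_frac (value_ge0 cI qc)); apply/eqP.
have dv : (frac q).2 %| dl by apply/dvdn_prodn/map_f; apply: frac_in cI qc.
rewrite /fval eqr_div ?natr_neq0 ?frac_pos ?dl_gt0 // -!natrM /scaled.
by rewrite -mulnA divnK.
Qed.

Lemma leq_sumn n (s : seq nat) : n \in s -> n <= sumn s.
Proof.
elim: s => //= m s IH; rewrite inE => /orP[/eqP->|/IH]; first exact: leq_addr.
by move=> h; apply: leq_trans h (leq_addl _ _).
Qed.

Lemma scaled_lt c q : c \in I -> q \in values c -> scaled q < V.
Proof.
move=> cI qc; rewrite /V /vmax add1n ltnS mulnC; apply: leq_mul; last exact: leq_div.
exact/leq_sumn/map_f/(frac_in cI qc).
Qed.

Lemma B_gt0 : 0 < B. Proof. by rewrite /B /base addn1. Qed.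

Lemma teval_table c s : c \in I ->
  teval (table_of dl B (parsed_of c)) s = (scaled (eval_constraint c s) * B + 1, 1).
Proof.
move=> cI; have /and4P[_ /allP h _ _] := allP wfI _ cI.
rewrite eval_foldr /teval /table_of /parsed_of /=; elim: (csupp c) h => //= e l IH h.
have /and3P[/eqP se _ _] := h e (mem_head _ _).
rewrite zipnE ?matches_zip ?se //; case: ifP => // _; apply: IH => e' e'l.
by apply: h; rewrite inE e'l orbT.
Qed.

Lemma table_wf c : c \in I -> twf (table_of dl B (parsed_of c)).
Proof.
move=> cI; have /and4P[uc /allP h _ _] := allP wfI _ cI.
rewrite /twf /= uc /=; apply/allP => e /mapP[e' /mapP[e'' ec ->] ->] /=.
have /and3P[/eqP se _ _] := h _ ec.
by rewrite zipnE ?se // unzip1_zip // se.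
Qed.

Lemma weight_int c q : c \in I -> q \in values c -> fint (V * B) (weight dl B (frac q)).
Proof.
move=> cI qc; rewrite /fint /weight /= addn1 /=.
have h : (scaled q).+1 * B <= V * B by rewrite leq_mul2r (scaled_lt cI qc) orbT.
by apply: leq_trans h; rewrite mulSn -[X in X < _]add0n ltn_add2r B_gt0.
Qed.

Lemma table_int c : c \in I -> tint (V * B) (table_of dl B (parsed_of c)).
Proof.
move=> cI; rewrite /tint /=; apply/andP; split.
  by apply: (weight_int cI); rewrite mem_head.
apply/allP => e /mapP[e' /mapP[e'' ec ->] ->] /=.
by apply: (weight_int cI); rewrite inE map_f ?orbT.
Qed.

Let J0 := radix (tables D xs Ip) xs.

Let GN s := \prod_(c <- I) scaled (eval_constraint c s).

Lemma J0_perm : perm_eq J0 (map (fun c => table_of dl B (parsed_of c)) I).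
Proof. by apply: perm_trans (radix_perm _ _) _; rewrite /tables -map_comp. Qed.

Lemma J0_in c : c \in J0 -> exists2 c', c' \in I & c = table_of dl B (parsed_of c').
Proof. by rewrite (perm_mem J0_perm) => /mapP. Qed.

Lemma eval_ext c s s' : s =1 s' -> eval_constraint c s = eval_constraint c s'.
Proof. by move=> e; rewrite /eval_constraint (eq_map e). Qed.

Lemma partition_sumv s0 : s0 =1 (fun=> 0) ->
  (partition_fn d I = (sumv d (rev xs) GN s0)%:R / dl%:R ^+ size I)%R.
Proof.
move=> s0E.
have eG : extensional GN.
  by move=> s s' e; rewrite /GN; apply: eq_bigr => c _; rewrite (eval_ext c e).
have mE : map (fun c : parsed => c.1.1) Ip = hypergraph_of I by rewrite /Ip -map_comp.
have [ux xE _] := elim_orderP bI.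
have uI : uniq (ivars I) by exact: undup_uniq.
have pm : perm_eq (ivars I) (rev xs).
  apply: uniq_perm => //; first by rewrite rev_uniq /xs mE.
  by move=> y; rewrite mem_rev /xs mE xE.
rewrite -(sumv_perm _ _ eG uI pm) (sumv_ext d (ivars I) eG s0E) -sum_ffun // natr_sum mulr_suml.
apply: eq_bigr => a _.
rewrite (_ : GN _ = GN (asg_of a)) // /GN natr_prod.
rewrite (_ : dl%:R ^+ size I = \prod_(c <- I) dl%:R)%R; last first.
  by rewrite big_const_seq count_predT iter_mulr_1.
rewrite -prodf_div; apply: eq_big_seq => c cI.
by apply: (scaledE cI); apply: eval_mem.
Qed.

Lemma solve_final : let F := final_value (final_tables D xs Ip) in
  F.1 * d ^ size xs %/ (F.2 * B ^ size I) = sumv d (rev xs) GN (lookup [::]).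
Proof.
set J := final_tables D xs Ip.
have mE : map (fun c : parsed => c.1.1) Ip = hypergraph_of I by rewrite /Ip -map_comp.
have wf0 : all twf J0 by apply/allP => c /J0_in[c' cI ->]; apply: table_wf.
have int0 : all (tint (V * B)) J0 by apply/allP => c /J0_in[c' cI ->]; apply: table_int.
have sJ : size J0 = size I by rewrite (perm_size J0_perm) size_map.
have VB0 : 0 < V * B by rewrite muln_gt0 B_gt0 andbT.
(* The elimination divides by sums over the domain, so an empty domain is treated apart: both sides
   vanish if there is a variable, and otherwise nothing is eliminated. *)
have [z|inv] : (d = 0 /\ xs <> [::]) \/ elim_inv d J0 (rev xs) J.
  have [dz|d0] := posnP d; last first.
    right; apply: (elim_all_inv d0 wf0 int0) => //.
      by rewrite /bound !powlE size_iota size_map sJ leq_addr.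
    rewrite /J0; apply: (radix_chain (E := hypergraph_of I)).
    - by have [] := elim_orderP bI; rewrite -mE.
    - move=> c /mapP[c' /mapP[c'' cI ->] ->] /=; exact: map_f.
    - by have [_ + _] := elim_orderP bI; rewrite -mE.
    - by have [_ _] := elim_orderP bI; rewrite -mE.
  case E : xs => [|x xs']; last by left.
  right; rewrite /J /final_tables E /elim_all /=.
  by rewrite /radix /=; move: (elim_inv0 d wf0 int0); rewrite /J0 E.
  case: z => dz nx; have sx : 0 < size xs by rewrite lt0n size_eq0; apply/eqP.
  have e1 : d ^ size xs = 0 by rewrite dz exp0n.
  rewrite /= e1 muln0 div0n; case er : (rev xs) => [|y r].
    by move: sx; rewrite -size_rev er.
  by rewrite /= big1 // => b _; have := ltn_ord b; lia.
(* A prefix length that exhausts both lists. *)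
case: inv => _ _ pJ /(_ (size J0 + size J) (lookup [::])).
rewrite !take_oversize ?leq_addl ?leq_addr // size_rev.
have pl : all fpos (map (fun c => teval c (lookup [::])) J).
  by rewrite all_map; apply: sub_all pJ => c; apply: teval_pos.
have [fe /andP[F1 F2]] := frac_prodE pl; rewrite big_map in fe.
rewrite -fe => e /=; rewrite -/(final_value J) in F1 F2 e *.
set W := Wsum _ _ _ _ in e; set F := final_value J in F1 F2 e *.
have eN : F.1 * d ^ size xs = W * F.2.
  apply/eqP; rewrite -(eqr_nat rat) !natrM natrX -e /fval.
  by rewrite mulrAC divfK // natr_neq0.
rewrite eN mulnC divnMl // /W /Wsum.
pose L s := map (fun c => scaled (eval_constraint c s)) I.
have -> : sumv d (rev xs) (fun s => \prod_(c <- J0) (teval c s).1) (lookup [::]) =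
          sumv d (rev xs) (fun s => \prod_(n <- L s) (n * B + 1)) (lookup [::]).
  apply: eq_sumv => s; rewrite (perm_big _ J0_perm) /= /L !big_map.
  by apply: eq_big_seq => c cI; rewrite teval_table.
rewrite (round_sum (m := size I) (L := L)) ?B_gt0 //.
- by apply: eq_sumv => s; rewrite /L big_map.
- by move=> s; rewrite size_map.
(* This is the inequality for which [base] was chosen: a scaled weight plus one is at most [V]. *)
rewrite /B /base addn1 ltnS !powlE size_iota size_map -(size_rev xs).
apply: sumv_le => s; rewrite /L big_map -(size_map (fun c => scaled (eval_constraint c s))).
have : {subset I <= I} by [].
elim: {1 3 4}I => [|c l IH] sub; first by rewrite big_nil.
rewrite big_cons /= expnS; apply: leq_mul.
  by rewrite addn1; apply: (@scaled_lt c); [apply: sub; rewrite mem_head | exact: eval_mem].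
by apply: IH => c' c'l; apply: sub; rewrite inE c'l orbT.
Qed.

Lemma solveE : 0 < (solve D Ip).2 /\ fval (solve D Ip) = partition_fn d I.
Proof.
rewrite /solve -/xs /solve_ordered /readout /fval /= !powlE size_iota size_map -/B -/dl.
split; first by rewrite expn_gt0 dl_gt0.
by rewrite solve_final (@partition_sumv (lookup [::])) // natrX.
Qed.
End Solve.

(** * Correctness of decoding *)

Fixpoint bits_value (l : seq bool) : nat :=
  if l is b :: l' then b + 2 * bits_value l' else 0.

Lemma bits_value_nbits f n : n <= f -> bits_value (nbits f n) = n.
Proof.
elim: f n => [|f IH] n le /=; first by lia.
case: eqP => [-> //|nz] /=; rewrite IH; last by lia.
by rewrite mul2n odd_double_half.
Qed.

Lemma tok_bits l pw a out :
  foldl tok_step (0, (pw, (a, out)))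
    (map nat_of_bool (flatten (map (fun b => [:: true; b]) l))) =
  (0, (2 ^ size l * pw, (a + pw * bits_value l, out))).
Proof.
elim: l pw a => [|b l IH] pw a /=; first by rewrite muln0 addn0 mul1n.
by case: b; rewrite /= IH expnS /=; congr (_, (_, (_, _))); nia.
Qed.

Definition encs (ts : seq nat) : seq bool := flatten (map enc_nat ts).

Lemma encs_cat s t : encs (s ++ t) = encs s ++ encs t.
Proof. by rewrite /encs map_cat flatten_cat. Qed.

(** A padding bit is read as an end mark, hence as a token 0. These tokens follow the encoded input,
    and the parser leaves them as remainder. *)
Lemma tokens_encs ts z :
  tokens (map nat_of_bool (encs ts) ++ nseq z 0) = ts ++ nseq z 0.
Proof.
rewrite /tokens -[RHS]revK rev_cat rev_nseq; congr rev.
rewrite foldl_cat.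
have H out : foldl tok_step (0, (1, (0, out))) (map nat_of_bool (encs ts)) =
     (0, (1, (0, rev ts ++ out))).
  elim: ts out => [|t ts IH] out //; rewrite /encs /= -/(encs ts) map_cat foldl_cat.
  rewrite /enc_nat map_cat foldl_cat tok_bits /= /tok_step /= add0n mul1n.
  by rewrite bits_value_nbits // -/tok_step IH rev_cons cat_rcons.
rewrite H cats0; elim: z (rev ts) => //= z IH out.
by rewrite IH; elim: (z) => //= z' ->.
Qed.

Definition tok_list {A : Type} (g : A -> seq nat) (l : seq A) : seq nat :=
  size l :: flatten (map g l).

Lemma enc_list_encs {A : Type} (f : A -> seq bool) (g : A -> seq nat) l :
  (forall x, f x = encs (g x)) -> enc_list f l = encs (tok_list g l).
Proof.
move=> fg; rewrite /enc_list /tok_list /encs /=; congr (_ ++ _).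
by elim: l => //= x l ->; rewrite fg map_cat flatten_cat.
Qed.

Lemma enc_seq_encs s : enc_list enc_nat s = encs (size s :: s).
Proof. by []. Qed.

Definition tok_frac (f : fraction) : seq nat := [:: f.1; f.2].

Definition tok_entry (e : seq nat * fraction) : seq nat :=
  (size e.1 :: e.1) ++ tok_frac e.2.

Definition tok_parsed (c : parsed) : seq nat :=
  ((size c.1.1 :: c.1.1) ++ tok_list tok_entry c.1.2) ++ tok_frac c.2.

Definition tok_input (D : seq nat) (I : seq parsed) : seq nat :=
  (size D :: D) ++ tok_list tok_parsed I.

Lemma tok_list_map {A B : Type} (h : A -> B) (g : B -> seq nat) l :
  tok_list g (map h l) = tok_list (fun x => g (h x)) l.
Proof. by rewrite /tok_list size_map -map_comp. Qed.

Lemma enc_input_encs d I :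
  enc_input d I = encs (tok_input (iota 0 d) (map parsed_of I)).
Proof.
rewrite /enc_input /tok_input encs_cat enc_seq_encs tok_list_map; congr (_ ++ _).
apply: enc_list_encs => c; rewrite /enc_constraint /tok_parsed !encs_cat enc_seq_encs -catA.
congr (_ ++ (_ ++ _)); last by rewrite /enc_rat /encs /= cats0.
rewrite /= tok_list_map; apply: enc_list_encs => e.
by rewrite /tok_entry encs_cat enc_seq_encs /enc_rat {3}/encs /= cats0.
Qed.

Lemma parses_input D I : parses p_input (D, I) (tok_input D I).
Proof.
apply: parses_bind; first exact: parses_seq.
apply: parses_list => [c|[[v es] w]]; first by [].
apply: parses_bind; last exact: parses_frac.
apply: parses_bind; first exact: parses_seq.
apply: parses_list => [e|[t f]]; first by [].
by apply: parses_bind; [exact: parses_seq | exact: parses_frac].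
Qed.

Lemma algorithm_enc d I z :
  algorithm (map nat_of_bool (enc_input d I) ++ nseq z 0) =
  solve (iota 0 d) (map parsed_of I).
Proof. by rewrite /algorithm enc_input_encs tokens_encs parses_input. Qed.

(* There is a (fixed) log-cost RAM program and a polynomial bound c*(n+1)^k
   such that, on the binary encoding of any domain D = {0..d-1} and any
   well-formed beta-acyclic #CSP_def instance I, it halts within cost
   c*(|input|+1)^k with R[0]/R[1] = w(I). *)
Theorem theorem5 :
  exists (p : program) (c k : nat),
    forall (d : nat) (I : instance),
      wf_instance d I ->
      beta_acyclic (hypergraph_of I) ->
      exists (fuel : nat) (m : memory) (cost : nat),
        run p fuel 0 (init_mem (enc_input d I)) = Some (m, cost) /\
        (cost <= c * (size (enc_input d I)).+1 ^ k)%N /\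
        (0 < m 1%N)%N /\
        (((m 0%N)%:R / (m 1%N)%:R)%R = partition_fn d I :> rat).
Proof.
have [p [c [k H]]] := fp_program fp_algorithm.
exists p, c, k => d I wfI bI.
have [z [fuel [m [cost [hrun hcost]]]]] := H (enc_input d I).
rewrite algorithm_enc; have [pos <-] := solveE wfI bI.
move=> e; exists fuel, m, cost; split=> //; split=> //.
by move: pos; rewrite /fval -e.
Qed.
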